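(* Let $p$ be a prime and let $R$ be a Krull domain with $\mathbb{Z}_{(p)}[X]\subseteq R\subseteq\mathbb{Q}[X]$. Then there exist finitely many admissible pairs $(\alpha_i,\delta_i)\in\mathbb{O}_p^{\mathrm{br}}\times(\mathbb{Q}_{\ge0}\cup\{\infty\})$, $i=1,\dots,n$ ($n\ge0$), such that $$R=\bigcap_{i=1}^n\mathbb{Z}_{(p),\alpha_i,\delta_i}\cap\mathbb{Q}[X]=\mathrm{Int}_{\mathbb{Q}}(E_p,\mathbb{O}_p),\qquad E_p=\bigcup_{i=1}^n\bar B_p(\alpha_i,\delta_i).$$ Moreover, if this representation is irredundant (no $\mathbb{Z}_{(p),\alpha_i,\delta_i}$ can be omitted without changing the intersection), then $R$ is a Dedekind domain if and only if either $n=0$ (so $R=\mathbb{Q}[X]$) or $\delta_i=\infty$ for every $i=1,\dots,n$; equivalently, $R$ is Dedekind if and only if $E_p$ is finite.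
   Context: Fix a prime $p$. $\overline{\mathbb{Q}_p}$ is an algebraic closure of $\mathbb{Q}_p$, $v_p$ the unique extension of the $p$-adic valuation, $\mathbb{C}_p$ the completion of $\overline{\mathbb{Q}_p}$, $\mathbb{O}_p=\{x\in\mathbb{C}_p:v_p(x)\ge0\}$. $\mathbb{C}_p^{\mathrm{br}}$ is the set of $\alpha\in\mathbb{C}_p$ such that the ramification index of $\mathbb{Q}_p(\alpha)/\mathbb{Q}_p$ is finite, and $\mathbb{O}_p^{\mathrm{br}}=\mathbb{O}_p\cap\mathbb{C}_p^{\mathrm{br}}$. A pair $(\alpha,\delta)\in\mathbb{C}_p\times(\mathbb{Q}\cup\{\infty\})$ is admissible if: when $\delta\in\mathbb{Q}$, $\alpha\in\overline{\mathbb{Q}_p}$; when $\delta=\infty$, $\alpha$ is transcendental over $\mathbb{Q}$. For $\delta\in\mathbb{Q}$, $v_{p,\alpha,\delta}$ is the monomial valuation on $\mathbb{C}_p(X)$ given on polynomials by $v_{p,\alpha,\delta}(\sum_i a_i(X-\alpha)^i)=\min_i\{v_p(a_i)+i\delta\}$; for $\delta=\infty$, $v_{p,\alpha,\infty}(\varphi)=v_p(\varphi(\alpha))$ for $\varphi\in\mathbb{Q}(X)$. $\mathbb{Z}_{(p),\alpha,\delta}=\{\varphi\in\mathbb{Q}(X):v_{p,\alpha,\delta}(\varphi)\ge0\}$. $\bar B_p(\alpha,\delta)=\{x\in\mathbb{C}_p:v_p(x-\alpha)\ge\delta\}$ (equal to $\{\alpha\}$ if $\delta=\infty$). For $E\subseteq\mathbb{C}_p$,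 $\mathrm{Int}_{\mathbb{Q}}(E,\mathbb{O}_p)=\{f\in\mathbb{Q}[X]:f(x)\in\mathbb{O}_p\ \forall x\in E\}$. *)

(* Defs.v *)
From Stdlib Require Import List.
From HB Require Import structures.
From mathcomp Require Import all_boot all_order all_algebra.
Set Implicit Arguments. Unset Strict Implicit. Unset Printing Implicit Defensive.
Import Order.TTheory GRing.Theory Num.Theory.
Local Open Scope ring_scope.

Definition padicv (p : nat) (q : rat) : rat :=
  ((logn p (absz (numq q)))%:Z - (logn p (absz (denq q)))%:Z)%:~R.

Section ValuedField.
Variables (K : fieldType) (v : K -> rat).

(* v_p(x) >= r, with the convention v_p(0) = +oo *)
Definition vge (x : K) (r : rat) : Prop := x = 0 \/ r <= v x.

Definition algebraic_over_Q (x : K) : Prop :=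
  exists q : {poly rat}, q != 0 /\ root (map_poly (@ratr K) q) x.

Definition cauchy_seq (u : nat -> K) : Prop :=
  forall N : rat, exists n0, forall m n, (n0 <= m)%N -> (n0 <= n)%N -> vge (u m - u n) N.

Definition converges_to (u : nat -> K) (l : K) : Prop :=
  forall N : rat, exists n0, forall n, (n0 <= n)%N -> vge (u n - l) N.

Definition in_Qp (x : K) : Prop := forall N : rat, exists q : rat, vge (x - ratr q) N.

Definition alg_over_Qp (x : K) : Prop :=
  exists P : {poly K}, P != 0 /\ (forall i, in_Qp P`_i) /\ root P x.

Definition subfield_pred (S : K -> Prop) : Prop :=
  [/\ S 0, S 1, (forall x y, S x -> S y -> S (x - y)),
      (forall x y, S x -> S y -> S (x * y)) & (forall x, S x -> x != 0 -> S x^-1)].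

Definition in_Qp_adjoin (alpha x : K) : Prop :=
  forall S, subfield_pred S -> (forall y, in_Qp y -> S y) -> S alpha -> S x.

(* the ramification index of Q_p(alpha)/Q_p (index of the value group of
   Q_p(alpha) over v_p of nonzero elements of Q_p, i.e. Z) is finite *)
Definition finite_ramification (alpha : K) : Prop :=
  exists e : nat, (0 < e)%N /\
    forall x, in_Qp_adjoin alpha x -> x != 0 -> exists z : int, e%:R * v x = z%:~R.

Definition in_Op_br (alpha : K) : Prop := vge alpha 0 /\ finite_ramification alpha.

(* delta : option rat, None standing for infinity *)
Definition admissible (alpha : K) (delta : option rat) : Prop :=
  match delta with
  | Some _ => alg_over_Qp alpha
  | None => ~ algebraic_over_Q alpha
  end.

Definition in_Zpad (alpha : K) (delta : option rat) (f : {poly rat}) : Prop :=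
  match delta with
  | Some d => forall i : nat,
      vge ((map_poly (@ratr K) f)^`N(i)).[alpha] (- (i%:R * d))
  | None => vge (map_poly (@ratr K) f).[alpha] 0
  end.

Definition cball (alpha : K) (delta : option rat) (x : K) : Prop :=
  match delta with
  | Some d => vge (x - alpha) d
  | None => x = alpha
  end.

Definition in_IntQ (E : K -> Prop) (f : {poly rat}) : Prop :=
  forall x, E x -> vge (map_poly (@ratr K) f).[x] 0.

End ValuedField.

(* (K, v) is (isometric to) C_p: an algebraically closed field of char. 0,
   with a (Q-valued) non-archimedean valuation extending v_p, complete,
   in which the algebraic numbers are dense (so K is the completion of an
   algebraic closure of Q_p). *)
Definition is_Cp (p : nat) (K : closedFieldType) (v : K -> rat) : Prop :=
  [pchar K] =i pred0 /\
  [/\ (forall x y : K, x != 0 -> y != 0 -> v (x * y) = v x + v y),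
      (forall (x y : K) r, vge v x r -> vge v y r -> vge v (x + y) r),
      (forall q : rat, q != 0 -> v (ratr q) = padicv p q),
      (forall u, cauchy_seq v u -> exists l, converges_to v u l)
    & (forall (x : K) (N : rat), exists y, algebraic_over_Q y /\ vge v (x - y) N)].

Notation QX := {poly rat}.
Notation QXF := {fraction {poly rat}}.
Definition toF (f : QX) : QXF := FracField.tofrac f.

Definition is_subring (R : QX -> Prop) : Prop :=
  [/\ R 1, (forall x y, R x -> R y -> R (x - y)) & (forall x y, R x -> R y -> R (x * y))].

Definition contains_ZpX (p : nat) (R : QX -> Prop) : Prop :=
  forall f : QX, (forall i, ~~ (p %| absz (denq f`_i))%N) -> R f.

Definition is_dvaluation (w : QXF -> int) : Prop :=
  (forall x y, x != 0 -> y != 0 -> w (x * y) = w x + w y) /\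
  (forall x y, x != 0 -> y != 0 -> x + y != 0 -> Num.min (w x) (w y) <= w (x + y)).

(* Krull domain: intersection of discrete valuation rings of its quotient
   field Q(X), with finite character *)
Definition Krull_domain (R : QX -> Prop) : Prop :=
  exists (I : Type) (w : I -> QXF -> int),
    [/\ (forall i, is_dvaluation (w i)),
        (forall x : QXF, (exists f, R f /\ x = toF f) <-> (forall i, x != 0 -> 0 <= w i x))
      & (forall x : QXF, x != 0 -> exists s : seq I, forall i, w i x != 0 -> In i s)].

Definition ideal_of (R I : QX -> Prop) : Prop :=
  [/\ (forall x, I x -> R x), I 0, (forall x y, I x -> I y -> I (x - y))
    & (forall r x, R r -> I x -> I (r * x))].

Definition noetherian (R : QX -> Prop) : Prop :=
  forall I, ideal_of R I -> exists s : seq QX, (forall x, x \in s -> I x) /\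
    forall x, I x -> exists c : seq QX, [/\ size c = size s, (forall r, r \in c -> R r)
      & x = \sum_(i < size s) c`_i * s`_i].

Definition prime_ideal (R P : QX -> Prop) : Prop :=
  [/\ ideal_of R P, ~ P 1 & forall x y, R x -> R y -> P (x * y) -> P x \/ P y].

Definition maximal_ideal (R M : QX -> Prop) : Prop :=
  [/\ ideal_of R M, ~ M 1 &
      forall J, ideal_of R J -> (forall x, M x -> J x) -> (forall x, J x -> M x) \/ J 1].

Definition integrally_closed (R : QX -> Prop) : Prop :=
  forall x : QXF, (exists P : {poly QXF}, [/\ P \is monic,
                      (forall i, exists r, R r /\ P`_i = toF r) & root P x]) ->
    exists f, R f /\ x = toF f.

Definition Dedekind_domain (R : QX -> Prop) : Prop :=
  [/\ noetherian R, integrally_closed R &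
      forall P, prime_ideal R P -> (exists x, P x /\ x != 0) -> maximal_ideal R P].

Definition valid_pair (K : fieldType) (v : K -> rat) (alpha : K) (delta : option rat) : Prop :=
  [/\ in_Op_br v alpha,
      (match delta with Some d => 0 <= d | None => True end)
    & admissible v alpha delta].

Definition represents (K : fieldType) (v : K -> rat) (R : QX -> Prop)
  (n : nat) (a : 'I_n -> K) (d : 'I_n -> option rat) : Prop :=
  forall f, R f <-> (forall i, in_Zpad v (a i) (d i) f).

Definition Eset (K : fieldType) (v : K -> rat) (n : nat) (a : 'I_n -> K)
  (d : 'I_n -> option rat) (x : K) : Prop :=
  exists i, cball v (a i) (d i) x.

Definition irredundant (K : fieldType) (v : K -> rat) (n : nat) (a : 'I_n -> K)
  (d : 'I_n -> option rat) : Prop :=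
  forall j : 'I_n, exists f : QX,
    (forall i, i != j -> in_Zpad v (a i) (d i) f) /\ ~ in_Zpad v (a j) (d j) f.

Definition finite_set (K : fieldType) (E : K -> Prop) : Prop :=
  exists s : seq K, forall x, E x -> x \in s.

(* Main.v *)
Require Import Defs.
From HB Require Import structures.
From mathcomp Require Import all_boot all_order all_algebra.
From mathcomp Require Import boolp classical_sets.
From mathcomp Require Import zify ring lra.
Set Implicit Arguments. Unset Strict Implicit. Unset Printing Implicit Defensive.
Import Order.TTheory GRing.Theory Num.Theory.
Local Open Scope ring_scope.

(** Only finitely many of the discrete valuations w defining R satisfy w(p) > 0, and
    together with Q[X] these already cut out R.  Such a w is extended, by Chevalley's
    argument, to a valuation ring B of K(X) that also induces v on K = C_p, and one
    looks at how well X is approximated by constants.  If X is infinitely close to a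
    constant a, then w is f |-> v(f(a)); if some a is closest to X and the distance is
    finite, then w is the monomial valuation of a ball around a, and choosing a of least
    degree over Q bounds the ramification of Q_p(a).  In the remaining case K(X) is an
    immediate extension of K; since w is discrete, expanding in powers of a uniformizer
    with Teichmuller-like digits then approximates X by constants to any precision, and
    completeness of K gives a contradiction.

    If a ball of finite radius occurs irredundantly, the centre of its valuation on R is
    not maximal: R contains an element t of value 0 vanishing at some algebraic point of
    the ball.  If all the centres are transcendental points a_i, then for every nonzero
    q in Q[X] some multiple of q is p-adically close to 1 at all the a_i; this
    substitute for weak approximation makes nonzero primes maximal and shows that every
    nonzero ideal is generated by an element of least total value at the a_i together
    with an element of least degree. *)

(** * Valued fields *)

(** C_p is complete but not spherically complete: nested balls may have empty intersection, so K(X)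
    does carry immediate extensions of [v], and nothing about K alone excludes the last case. Only
    discreteness on Q(X) does. Hence the expansion must keep its remainders in Q(X) while its digits
    stay close to constants. A second constraint is that [B] comes from Zorn's lemma and may have
    rank greater than one, as it does when X is infinitely close to a constant; lying in the maximal
    ideal of [B] then does not by itself give a positive rational value. The structural input about
    K is that its residue field is algebraic over F_p. This supplies the digits, a power of any unit
    that is congruent to 1, and inverses modulo primes above p. Balls are handled through generic
    points: the value group of K is Q and its residue field is infinite, so on finitely many
    polynomials a monomial valuation is evaluation at one point of the ball. *)

Lemma classical_min (P : nat -> Prop) : (exists n, P n) ->
  exists2 n, P n & forall m, P m -> (n <= m)%N.
Proof.
move=> [n0 Pn0]; have h : exists n, `[< P n >] by exists n0; apply/asboolP.
case: (ex_minnP h) => n /asboolP Pn hn; exists n => // m Pm.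
by apply: hn; apply/asboolP.
Qed.

Definition vgt (K : fieldType) (v : K -> rat) (x : K) (r : rat) : Prop :=
  x = 0 \/ r < v x.

Structure valuation (K : fieldType) := Valuation {
  val_fun :> K -> rat;
  _ : forall x y : K, x != 0 -> y != 0 -> val_fun (x * y) = val_fun x + val_fun y;
  _ : forall (x y : K) r, vge val_fun x r -> vge val_fun y r -> vge val_fun (x + y) r }.

Section ValuedFieldTheory.
Variables (K : fieldType) (v : valuation K).
Implicit Types (x y : K) (r s : rat).

Lemma vM x y : x != 0 -> y != 0 -> v (x * y) = v x + v y.
Proof. by case: v => f fM fD; apply: fM. Qed.

Lemma vD x y r : vge v x r -> vge v y r -> vge v (x + y) r.
Proof. by case: v => f ? fD; apply: fD. Qed.

Lemma vgeE x r : x != 0 -> vge v x r <-> r <= v x.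
Proof. by move=> x0; split=> [[xE|//]|]; [rewrite xE eqxx in x0|right]. Qed.

Lemma vgtE x r : x != 0 -> vgt v x r <-> r < v x.
Proof. by move=> x0; split=> [[xE|//]|]; [rewrite xE eqxx in x0|right]. Qed.

Lemma vge_refl x : vge v x (v x). Proof. by right. Qed.

Lemma vge_le x r s : s <= r -> vge v x r -> vge v x s.
Proof. by move=> sr [->|rx]; [left|right; apply: le_trans rx]. Qed.

Lemma vgtW x r : vgt v x r -> vge v x r.
Proof. by case=> [->|/ltW ?]; [left|right]. Qed.

Lemma vge_gt x r s : s < r -> vge v x r -> vgt v x s.
Proof. by move=> sr [->|rx]; [left|right; apply: lt_le_trans rx]. Qed.

Lemma vgtP x r : vgt v x r \/ (x != 0 /\ v x <= r).
Proof.
have [->|x0] := eqVneq x 0; first by left; left.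
by case: (ltP r (v x)) => rx; [left; right|right].
Qed.

Lemma vgeP x r : vge v x r \/ (x != 0 /\ v x < r).
Proof.
have [->|x0] := eqVneq x 0; first by left; left.
by case: (leP r (v x)) => rx; [left; right|right].
Qed.

Lemma v1 : v 1 = 0.
Proof.
have := vM (oner_neq0 K) (oner_neq0 K); rewrite mulr1.
by move/eqP; rewrite -subr_eq0 opprD addNKr oppr_eq0 => /eqP.
Qed.

Lemma vN1 : v (- 1) = 0.
Proof.
have N10 : (-1 : K) != 0 by rewrite oppr_eq0 oner_neq0.
have := vM N10 N10; rewrite mulrNN mulr1 v1 -mulr2n => /esym/eqP.
by rewrite mulrn_eq0 => /eqP.
Qed.

Lemma vN x : v (- x) = v x.
Proof.
have [->|x0] := eqVneq x 0; first by rewrite oppr0.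
by rewrite -mulN1r vM ?oppr_eq0 ?oner_neq0 // vN1 add0r.
Qed.

Lemma vV x : x != 0 -> v x^-1 = - v x.
Proof.
move=> x0; apply/eqP; rewrite -addr_eq0 addrC -vM ?invr_eq0 // mulfV //.
by rewrite v1.
Qed.

Lemma vX x n : x != 0 -> v (x ^+ n) = n%:R * v x.
Proof.
move=> x0; elim: n => [|n IH]; first by rewrite expr0 v1 mul0r.
by rewrite exprS vM ?expf_neq0 // IH -nat1r mulrDl mul1r.
Qed.

Lemma v_div x y : x != 0 -> y != 0 -> v (x / y) = v x - v y.
Proof. by move=> x0 y0; rewrite vM ?invr_eq0 ?vV. Qed.

Lemma vgeN x r : vge v x r -> vge v (- x) r.
Proof. by case=> [->|rx]; [left; rewrite oppr0|right; rewrite vN]. Qed.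

Lemma vgeB x y r : vge v x r -> vge v y r -> vge v (x - y) r.
Proof. by move=> xr /vgeN; apply: vD. Qed.

Lemma vgeM x y r s : vge v x r -> vge v y s -> vge v (x * y) (r + s).
Proof.
case=> [->|rx]; first by left; rewrite mul0r.
case=> [->|sy]; first by left; rewrite mulr0.
have [->|x0] := eqVneq x 0; first by left; rewrite mul0r.
have [->|y0] := eqVneq y 0; first by left; rewrite mulr0.
by right; rewrite vM // lerD.
Qed.

Lemma vgeM0 x y r : vge v x 0 -> vge v y r -> vge v (x * y) r.
Proof. by move=> hx hy; have := vgeM hx hy; rewrite add0r. Qed.

Lemma vgeMr0 x y r : vge v x r -> vge v y 0 -> vge v (x * y) r.
Proof. by move=> hx hy; rewrite mulrC; apply: vgeM0. Qed.

Lemma vgt_ge x r : vgt v x r -> exists2 s, r < s & vge v x s.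
Proof.
by case=> [->|rx]; [exists (r + 1); [rewrite ltrDl|left]|exists (v x); [|right]].
Qed.

Lemma vgtD x y r : vgt v x r -> vgt v y r -> vgt v (x + y) r.
Proof.
move=> /vgt_ge [s rs xs] /vgt_ge [t rt yt].
apply: (@vge_gt _ (Num.min s t)); first by rewrite lt_min rs.
by apply: vD; [apply: vge_le xs|apply: vge_le yt]; rewrite ge_min lexx ?orbT.
Qed.

Lemma vgtN x r : vgt v x r -> vgt v (- x) r.
Proof. by case=> [->|rx]; [left; rewrite oppr0|right; rewrite vN]. Qed.

Lemma vgtB x y r : vgt v x r -> vgt v y r -> vgt v (x - y) r.
Proof. by move=> xr /vgtN; apply: vgtD. Qed.

Lemma vgtM x y r s : vge v x r -> vgt v y s -> vgt v (x * y) (r + s).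
Proof.
by move=> xr /vgt_ge [t st yt]; apply: (vge_gt _ (vgeM xr yt)); rewrite ltrD2l.
Qed.

Lemma vgtM0 x y r : vge v x 0 -> vgt v y r -> vgt v (x * y) r.
Proof. by move=> hx hy; have := vgtM hx hy; rewrite add0r. Qed.

Lemma vge1 : vge v 1 0. Proof. by right; rewrite v1. Qed.

Lemma vgeX x n r : vge v x r -> vge v (x ^+ n) (n%:R * r).
Proof.
move=> xr; elim: n => [|n IH]; first by rewrite mul0r; apply: vge1.
by rewrite exprS -nat1r mulrDl mul1r; apply: vgeM.
Qed.

Lemma vgeX0 x n : vge v x 0 -> vge v (x ^+ n) 0.
Proof. by move=> hx; have := vgeX n hx; rewrite mulr0. Qed.

Lemma vge_sum (I : Type) (l : seq I) (P : pred I) (f : I -> K) r :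
  (forall i, P i -> vge v (f i) r) -> vge v (\sum_(i <- l | P i) f i) r.
Proof. by move=> h; elim/big_ind : _ => //; [left|move=> x y; apply: vD]. Qed.

Lemma vge_nat n : vge v n%:R 0.
Proof.
elim: n => [|n IH]; first by left.
by rewrite -nat1r; apply: vD => //; apply: vge1.
Qed.

Lemma vge_int z : vge v z%:~R 0.
Proof. by case: z => n; [|rewrite NegzE mulrNz; apply: vgeN]; exact: vge_nat. Qed.

Lemma vD_lt x y : x != 0 -> vgt v y (v x) -> x + y != 0 /\ v (x + y) = v x.
Proof.
move=> x0 hy.
have h : ~ vgt v (x + y) (v x).
  by move=> /vgtB/(_ hy); rewrite addrK vgtE // ltxx.
have [//|[xy0 le1]] := vgtP (x + y) (v x); split=> //.
apply/eqP; rewrite eq_le le1 /=.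
have /vgeE -> // : vge v (x + y) (v x).
by apply: vD; [exact: vge_refl|exact: vgtW].
Qed.

Lemma v_near x y : x != 0 -> vgt v (y - x) (v x) -> y != 0 /\ v y = v x.
Proof. by move=> x0 /(vD_lt x0); rewrite addrC subrK. Qed.

Lemma vgt_expr x n : vgt v (x ^+ n) 0 -> vgt v x 0.
Proof.
have [->|x0] := eqVneq x 0; first by left.
rewrite !vgtE ?expf_neq0 // vX //; case: n => [|n]; first by rewrite mul0r.
by rewrite pmulr_rgt0 // ltr0n.
Qed.

Lemma vge_poly (P : {poly K}) x : (forall i, vge v P`_i 0) -> vge v x 0 -> vge v P.[x] 0.
Proof.
move=> hP hx; rewrite horner_coef; apply: vge_sum => i _.
by apply: vgeM0 => //; apply: vgeX0.
Qed.

End ValuedFieldTheory.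

Structure CpField := MkCpField {
  cp_prime : nat;
  cp_field :> closedFieldType;
  cp_val : valuation cp_field;
  cp_prime_prime : prime cp_prime;
  cp_axioms : is_Cp cp_prime cp_val }.

Section CpBasics.
Variable C : CpField.
Local Notation K := (cp_field C).
Local Notation v := (cp_val C).
Local Notation p := (cp_prime C).

Let nz_int (z : int) : z != 0 -> z%:~R != 0 :> K.
Proof.
have [/pcharf0P h _] := cp_axioms C.
case: z => n; rewrite ?NegzE ?mulrNz ?oppr_eq0 -?pmulrn ?h //.
Qed.

Let nz_den (x : rat) : (denq x)%:~R != 0 :> K.
Proof. by rewrite nz_int // denq_eq0. Qed.

Lemma cp_ratr_frac (a b : int) : b != 0 ->
  ratr (a%:~R / b%:~R : rat) = a%:~R / b%:~R :> K.
Proof.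
move=> b0; set x := (_ / _); apply/eqP.
rewrite /ratr eqr_div ?nz_den ?nz_int // -!intrM; apply/eqP; congr _%:~R.
apply: (@intr_inj rat); rewrite !intrM; apply/eqP.
by rewrite -eqr_div ?intr_eq0 ?denq_eq0 // divq_num_den.
Qed.

Fact cp_ratr_is_zmod_morphism : zmod_morphism (@ratr K).
Proof.
move=> x y; rewrite -{1}[x]divq_num_den -{1}[y]divq_num_den.
rewrite -mulNr addf_div ?intr_eq0 ?denq_eq0 // -!(intrM, intrN, intrD).
rewrite cp_ratr_frac ?mulf_neq0 ?denq_eq0 // /ratr -mulNr addf_div //.
by rewrite !(intrM, intrN, intrD).
Qed.

Fact cp_ratr_is_monoid_morphism : monoid_morphism (@ratr K).
Proof.
split=> [|x y]; first by rewrite /ratr divr1.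
rewrite -{1}[x]divq_num_den -{1}[y]divq_num_den mulf_div -!intrM.
by rewrite cp_ratr_frac ?mulf_neq0 ?denq_eq0 // /ratr mulf_div -!intrM.
Qed.

(* The library declares [ratr] as a morphism only into ordered fields. *)
Definition iQ : rat -> K := @ratr K.

HB.instance Definition _ := GRing.isZmodMorphism.Build rat K iQ
  cp_ratr_is_zmod_morphism.
HB.instance Definition _ := GRing.isMonoidMorphism.Build rat K iQ
  cp_ratr_is_monoid_morphism.

Lemma v_iQ q : q != 0 -> v (iQ q) = padicv p q.
Proof. by have [_ [_ _ h _ _]] := cp_axioms C; apply: h. Qed.

Lemma cp_complete u : cauchy_seq v u -> exists l, converges_to v u l.
Proof. by have [_ [_ _ _ h _]] := cp_axioms C; apply: h. Qed.

Lemma cp_dense x N : exists y, algebraic_over_Q y /\ vge v (x - y) N.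
Proof. by have [_ [_ _ _ _ h]] := cp_axioms C; apply: h. Qed.

Lemma p_gt0 : (0 < p)%N. Proof. exact/prime_gt0/cp_prime_prime. Qed.
Lemma p_neq0 : (p%:R : K) != 0. Proof. by rewrite pmulrn nz_int // eqz_nat -lt0n p_gt0. Qed.
Lemma pQ_neq0 : (p%:R : rat) != 0. Proof. by rewrite pnatr_eq0 -lt0n p_gt0. Qed.

Lemma v_p : v p%:R = 1.
Proof.
have -> : (p%:R : K) = iQ p%:R by rewrite rmorph_nat.
rewrite v_iQ ?pQ_neq0 // /padicv pmulrn numq_int denq_int /= logn1 subr0.
by rewrite logn_prime ?cp_prime_prime // eqxx.
Qed.

End CpBasics.

Arguments iQ : clear implicits.

(** * Closed balls and monomial valuations *)

Section Balls.
Variable C : CpField.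
Local Notation K := (cp_field C).
Local Notation v := (cp_val C).
Local Notation p := (cp_prime C).
Implicit Types (x y a b c : K) (r s d : rat).

(** A root of ['X^n - y] with [n] the denominator of [d] and [y] a power of p. As the value group is
    all of Q, every radius and every rational threshold is the value of a constant. *)
Lemma rat_value d : exists2 c : K, c != 0 & v c = d.
Proof.
have n0 : (0 < `|denq d|)%N by rewrite absz_gt0 denq_eq0.
have dE : (`|denq d|)%:Z = denq d by rewrite gtz0_abs // denq_gt0.
have [y y0 vy] : exists2 y : K, y != 0 & v y = (numq d)%:~R.
  case: (numq d) => n; first by exists (p%:R ^+ n); rewrite ?expf_neq0 ?p_neq0 ?vX ?p_neq0 // v_p mulr1 pmulrn.
  exists (p%:R ^- n.+1); rewrite ?invr_eq0 ?expf_neq0 ?p_neq0 ?vV ?expf_neq0 ?p_neq0 ?vX ?p_neq0 //.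
  by rewrite v_p mulr1 NegzE mulrNz pmulrn.
have sz : size ('X^(`|denq d|) - y%:P) != 1 by rewrite size_XnsubC // -lt0n.
have /closed_rootP [c] := sz.
rewrite /root !hornerE subr_eq0 => /eqP cy.
have c0 : c != 0.
  by apply: contraNneq y0 => c0; rewrite -cy c0 expr0n eqn0Ngt n0.
exists c => //; move: vy; rewrite -cy vX // pmulrn dE => h.
apply: (@mulfI _ (denq d)%:~R); first by rewrite intr_eq0 denq_eq0.
by rewrite h numqE mulrC.
Qed.

Lemma algebraic_over_Q_alg_over_Qp x : algebraic_over_Q x -> alg_over_Qp v x.
Proof.
move=> [q [q0 qx]]; exists (map_poly (iQ C) q); split; first by rewrite map_poly_eq0.
by split=> // i N; exists q`_i; left; rewrite coef_map subrr.
Qed.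

(** The minimum of [v x] and [d] under the convention v(0) = +oo. For [x = a - g] it is the value of
    X - g under the monomial valuation of the ball. *)
Definition mval x d : rat := if x == 0 then d else Num.min (v x) d.

Lemma mval_le_r x d : mval x d <= d.
Proof. by rewrite /mval; case: ifP; rewrite ?ge_min ?lexx ?orbT. Qed.

Lemma mval_vge x d : vge v x (mval x d).
Proof. by rewrite /mval; case: eqP => [->|_]; [left|right; rewrite ge_min lexx]. Qed.

(* A root of [X * prod (X - g) = 1] avoids the residue classes of all the g. *)
Lemma avoid_residues (l : seq K) : (forall g, g \in l -> vge v g 0) ->
  exists2 y, vge v y 0 & forall g, g \in l -> y != g /\ v (y - g) = 0.
Proof.
move=> hl; pose P : {poly K} := 'X * \prod_(g <- l) ('X - g%:P).
have szP : (1 < size P)%N.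
  rewrite /P -[X in X * _]subr0 -(big_cons _ _ 0 l xpredT (fun g => 'X - g%:P)).
  by rewrite size_prod_XsubC.
have sz : size (P - 1) != 1.
  by rewrite size_polyDl ?size_polyN ?size_poly1 //; case: (size P) szP => [|[]].
have /closed_rootP [y] := sz; rewrite /root !hornerE horner_prod subr_eq0 => /eqP yE.
have {}yE : y * \prod_(g <- l) (y - g) = 1.
  by rewrite -[RHS]yE; congr (_ * _); apply: eq_bigr => g _; rewrite !hornerE.
have y0 : y != 0 by apply: contra_eq_neq yE => ->; rewrite mul0r eq_sym oner_neq0.
have hy : vge v y 0.
  have [//|[_ vy]] := vgeP v y 0; exfalso.
  have hz : forall g, g \in l -> y - g != 0 /\ v (y - g) = v y.
    move=> g gl; apply: vD_lt => //.
    by apply: vgtN; apply: vge_gt vy _; apply: hl.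
  have : v (y * \prod_(g <- l) (y - g)) = v y *+ (size l).+1.
    elim: (l) hz => [|g s IH] hz; first by rewrite big_nil mulr1 mulr1n.
    rewrite big_cons mulrCA; have [h1 h2] := hz g (mem_head _ _).
    have hs : y * \prod_(i <- s) (y - i) != 0.
      rewrite mulf_neq0 // prodf_seq_neq0; apply/allP => i /= si.
      by have [] := hz i; rewrite ?inE ?si ?orbT.
    rewrite vM // IH ?h2 // => i si; apply: hz; by rewrite inE si orbT.
  by rewrite yE v1 => /eqP; rewrite eq_sym mulrn_eq0 /= lt_eqF.
exists y => // g gl.
have hyg : y - g != 0.
  by apply: contra_eq_neq yE => h; rewrite (big_rem g) //= h mul0r mulr0 eq_sym oner_neq0.
split; first by rewrite -subr_eq0.
have [||//] := ltgtP (v (y - g)) 0.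
  by move=> h; have /vgeE := vgeB hy (hl g gl); rewrite leNgt h => /(_ hyg).
move=> h; have h1 : vgt v (y - g) 0 by right.
have : vgt v (y * \prod_(g <- l) (y - g)) 0.
  rewrite (big_rem g) //= mulrCA mulrC; apply: vgtM0 => //.
  apply: vgeM0 => //; elim: (rem g l) (@mem_rem _ g l) => [|i s IH] hs.
    by rewrite big_nil; apply: vge1.
  rewrite big_cons; apply: vgeM0.
    by apply: vgeB => //; apply: hl; apply: hs; rewrite mem_head.
  by apply: IH => j js; apply: hs; rewrite inE js orbT.
by rewrite yE vgtE ?oner_neq0 // v1 ltxx.
Qed.

(** Scaling by a constant of value [d] turns the ball into the unit disc. The [g] inside the ball
    become residues to be avoided; those outside are farther from [a] than the radius, so all points
    of the ball have the same distance to them. *)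
Lemma generic_point a d (l : seq K) : exists2 x, vge v (x - a) d &
  forall g, g \in l -> x != g /\ v (x - g) = mval (a - g) d.
Proof.
have [c c0 vc] := rat_value d.
pose l' := [seq (g - a) / c | g <- l & ((g == a) || (d <= v (g - a)))].
have [|y hy yl] := @avoid_residues l'.
  move=> z /mapP [g]; rewrite mem_filter => /andP [/orP [/eqP ->|dg] _] ->.
    by rewrite subrr mul0r; left.
  have [->|ga] := eqVneq g a; first by rewrite subrr mul0r; left.
  by right; rewrite v_div ?subr_eq0 // vc subr_ge0.
exists (a + c * y) => [|g gl].
  by rewrite addrC addKr; have := vgeM (vge_refl v c) hy; rewrite vc addr0.
have [hg|] := boolP ((g == a) || (d <= v (g - a))).
  have /yl [] : (g - a) / c \in l' by apply/mapP; exists g; rewrite // mem_filter hg.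
  rewrite -subr_eq0 => h1 h2.
  have E : a + c * y - g = c * (y - (g - a) / c) by field.
  split; first by rewrite -subr_eq0 E mulf_neq0.
  rewrite E vM // h2 addr0 vc /mval subr_eq0 eq_sym; case: eqP hg => //= _ hg.
  by rewrite -opprB vN; apply/esym/min_r.
rewrite negb_or -ltNge => /andP [ga hg].
have h0 : a - g != 0 by rewrite subr_eq0 eq_sym.
have := @vD_lt _ v (a - g) (c * y) h0.
have -> : a - g + c * y = a + c * y - g by ring.
rewrite subr_eq0 /mval (negPf h0) => -[].
  apply: (@vge_gt _ v _ d); first by rewrite -opprB vN.
  by have := vgeM (vge_refl v c) hy; rewrite vc addr0.
by move=> -> ->; split=> //; rewrite min_l // -opprB vN ltW.
Qed.

Definition roots_of (P : {poly K}) : seq K := sval (closed_field_poly_normal P).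

Lemma roots_ofE P : P = lead_coef P *: \prod_(g <- roots_of P) ('X - g%:P).
Proof. exact: (svalP (closed_field_poly_normal P)). Qed.

Lemma mem_roots_of P x : P != 0 -> (x \in roots_of P) = root P x.
Proof.
by move=> P0; rewrite {2}(roots_ofE P) rootZ ?lead_coef_eq0 // root_prod_XsubC.
Qed.

Lemma horner_roots_of P x : P.[x] = lead_coef P * \prod_(g <- roots_of P) (x - g).
Proof.
rewrite {1}(roots_ofE P) hornerZ horner_prod; congr (_ * _).
by apply: eq_bigr => g _; rewrite !hornerE.
Qed.

(* By multiplicativity this is the monomial valuation v_{p,a,d} of the context,
   defined there through the coefficients of P in powers of X - a. *)
Definition gval a d P : rat := v (lead_coef P) + \sum_(g <- roots_of P) mval (a - g) d.

Lemma gval_generic a d P x : P != 0 ->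
  (forall g, g \in roots_of P -> x != g /\ v (x - g) = mval (a - g) d) ->
  P.[x] != 0 /\ v P.[x] = gval a d P.
Proof.
move=> P0 hx; rewrite horner_roots_of.
have [h1 h2] : \prod_(g <- roots_of P) (x - g) != 0 /\
   v (\prod_(g <- roots_of P) (x - g)) = \sum_(g <- roots_of P) mval (a - g) d.
  elim: (roots_of P) hx => [|g s IH] hs.
    by rewrite !big_nil oner_neq0 v1.
  have [h1 h2] := hs g (mem_head _ _).
  have [|i1 i2] := IH; first by move=> i si; apply: hs; rewrite inE si orbT.
  have xg : x - g != 0 by rewrite subr_eq0.
  by rewrite !big_cons mulf_neq0 // vM // h2 i2.
by rewrite mulf_neq0 ?vM ?h2 ?lead_coef_eq0.
Qed.

(** One point is generic for all roots of all polynomials in the list. On that list the monomial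
    valuation is an evaluation, so multiplicativity and the ultrametric inequality are inherited
    from [v]. *)
Lemma generic_value a d (l : seq {poly K}) : exists2 x, vge v (x - a) d &
  forall P, P \in l -> P != 0 -> P.[x] != 0 /\ v P.[x] = gval a d P.
Proof.
have [x hx xl] := generic_point a d (flatten (map roots_of l)).
exists x => // P Pl P0; apply: gval_generic => // g gP; apply: xl.
by apply/flatten_mapP; exists P.
Qed.

(** The Hasse derivatives at [a] are the Taylor coefficients there. Induction on the linear factors:
    multiplying by X - g turns the coefficients c_i into c_(i-1) + (a - g) c_i. *)
Lemma nderivn_gval a d P i : P != 0 -> vge v (P^`N(i)).[a] (gval a d P - i%:R * d).
Proof.
move=> P0; rewrite /gval {1}(roots_ofE P).
move: (lead_coef P) => c; elim: (roots_of P) i => [|g s IH] i.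
  rewrite !big_nil addr0 alg_polyC; case: i => [|i].
    by rewrite nderivn0 hornerC mul0r subr0; apply: vge_refl.
  by rewrite nderivnC horner0; left.
rewrite !big_cons; pose Q := c *: \prod_(j <- s) ('X - j%:P).
have -> : c *: (('X - g%:P) * \prod_(j <- s) ('X - j%:P)) = Q * 'X + 0%:P - g *: Q.
  by rewrite scalerAr -/Q -[g *: Q]mul_polyC; ring.
set D := \sum_(j <- s) _ in IH *.
case: i => [|i]; rewrite nderivnB nderivnZ hornerD hornerN hornerZ addr0.
  rewrite !nderivn0 hornerMX mul0r subr0.
  have := vgeM (IH 0) (mval_vge (a - g) d).
  rewrite nderivn0 mul0r subr0 -/Q; congr vge; ring.
rewrite -[Q * 'X]addr0 nderivnMXaddC hornerD hornerMX.
have -> : Q^`N(i).[a] + Q^`N(i.+1).[a] * a - g * Q^`N(i.+1).[a] =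
   Q^`N(i).[a] + Q^`N(i.+1).[a] * (a - g) by ring.
apply: vD.
  apply: vge_le (IH i); have := mval_le_r (a - g) d; rewrite -natr1 mulrDl; lra.
by have := vgeM (IH i.+1) (mval_vge (a - g) d); congr vge; ring.
Qed.

Lemma gval_ball a d P x : P != 0 -> vge v (x - a) d -> vge v P.[x] (gval a d P).
Proof.
move=> P0 xd; have -> : x = a + (x - a) by ring.
rewrite nderiv_taylor; last exact: mulrC.
apply: vge_sum => i _; apply: vge_le (vgeM (nderivn_gval a d i P0) (vgeX i xd)).
by rewrite subrK.
Qed.

(** The lower bound of [gval_ball] is attained at a generic point of the ball. *)
Lemma gval_ge0_ball a d P : P != 0 ->
  0 <= gval a d P <-> forall x, vge v (x - a) d -> vge v P.[x] 0.
Proof.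
move=> P0; split=> [h x xd|h]; first exact: vge_le h (gval_ball P0 xd).
have [x xd /(_ P)] := generic_value a d [:: P]; rewrite mem_head => -[] // h1 h2.
by rewrite -h2 -vgeE //; apply: h.
Qed.

Lemma gvalM a d P Q : P != 0 -> Q != 0 -> gval a d (P * Q) = gval a d P + gval a d Q.
Proof.
move=> P0 Q0; have [x _ h] := generic_value a d [:: P; Q; P * Q].
have [||h1 <-] := h P; rewrite ?mem_head //.
have [||h2 <-] := h Q; rewrite ?inE ?eqxx ?orbT //.
have [||h3 <-] := h (P * Q); rewrite ?inE ?eqxx ?orbT ?mulf_neq0 //.
by rewrite hornerM vM.
Qed.

Lemma gvalB a d P Q r : P != 0 -> Q != 0 -> P - Q != 0 ->
  r < gval a d P -> r < gval a d Q -> r < gval a d (P - Q).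
Proof.
move=> P0 Q0 PQ0; have [x _ h] := generic_value a d [:: P; Q; P - Q].
have [||h1 <-] := h P; rewrite ?mem_head //.
have [||h2 <-] := h Q; rewrite ?inE ?eqxx ?orbT //.
have [||h3 <-] := h (P - Q); rewrite ?inE ?eqxx ?orbT ?mulf_neq0 //.
by rewrite -!vgtE // hornerD hornerN; apply: vgtB.
Qed.

Lemma gvalC a d c : c != 0 -> gval a d c%:P = v c.
Proof.
move=> c0; have [x _ /(_ c%:P)] := generic_value a d [:: c%:P].
by rewrite mem_head polyC_eq0 hornerC => -[].
Qed.

Lemma gvalX a d P n : P != 0 -> gval a d (P ^+ n) = n%:R * gval a d P.
Proof.
move=> P0; elim: n => [|n IH].
  by rewrite expr0 -polyC1 gvalC ?oner_neq0 // v1 mul0r.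
by rewrite exprS gvalM ?expf_neq0 // IH -nat1r mulrDl mul1r.
Qed.

Lemma in_Zpad_gval a d f : f != 0 ->
  in_Zpad v a (Some d) f <-> 0 <= gval a d (map_poly (iQ C) f).
Proof.
move=> f0; have F0 : map_poly (iQ C) f != 0 by rewrite map_poly_eq0.
split=> [h|h i]; last first.
  by apply: vge_le (nderivn_gval a d i F0); rewrite lerBrDl addrN.
apply/gval_ge0_ball => // x xd; have -> : x = a + (x - a) by ring.
rewrite nderiv_taylor; last exact: mulrC.
by apply: vge_sum => i _; have := vgeM (h i) (vgeX i xd); rewrite addNr.
Qed.

Lemma in_Zpad_cball a D f :
  in_Zpad v a D f <-> forall x, cball v a D x -> vge v (map_poly (iQ C) f).[x] 0.
Proof.
case: D => [d|]; last by split=> [h x -> //|]; apply.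
have [->|f0] := eqVneq f 0.
  split=> [_ x _|_ i]; first by rewrite map_poly0 horner0; left.
  by rewrite map_poly0 -(scale0r 0) nderivnZ scale0r horner0; left.
have F0 : map_poly (iQ C) f != 0 by rewrite map_poly_eq0.
by rewrite in_Zpad_gval // gval_ge0_ball.
Qed.

Lemma represents_IntQ (R : {poly rat} -> Prop) n (a : 'I_n -> K) D :
  represents v R a D <-> forall f, R f <-> in_IntQ v (Eset v a D) f.
Proof.
have E f : in_IntQ v (Eset v a D) f <-> forall i, in_Zpad v (a i) (D i) f.
  split=> [h i|h x [i xi]]; first by apply/in_Zpad_cball => x xi; apply: h; exists i.
  by have /in_Zpad_cball := h i; apply.
by split=> h f; rewrite h E.
Qed.

End Balls.

(** * Residues are algebraic over the prime field *)

Lemma pigeonhole (T : finType) (g : nat -> T) : exists k l, (k < l)%N /\ g k = g l.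
Proof.
pose h (i : 'I_(#|T|.+1)) := g i.
have /injectivePn [i [j ij gij]] : ~~ injectiveb h.
  by apply/injectiveP => /leq_card; rewrite card_ord ltnn.
have [] : (i < j)%N \/ (j < i)%N by apply/orP; rewrite -neq_ltn.
  by exists i, j.
by exists j, i.
Qed.

(** Two of the powers X^(p^k) coincide modulo [c], there being finitely many residues, and in
    characteristic p the difference of X^(p^l) and X^(p^k) is the p^k-th power of X^(p^(l-k)) -
    X. *)
Lemma poly_dvd_frobenius p (c : {poly 'F_p}) : prime p -> c != 0 ->
  exists f k, (0 < f)%N /\ (c %| ('X^(p ^ f) - 'X) ^+ (p ^ k))%R.
Proof.
move=> pp c0.
have [k [l [kl]]] := pigeonhole (fun k => poly_rV ('X^(p ^ k) %% c) : 'rV_(size c)).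
have szm (q : {poly 'F_p}) : (size (q %% c)%R <= size c)%N by rewrite ltnW // ltn_modp.
move/(congr1 (@rVpoly _ _)); rewrite !poly_rV_K // => E.
exists (l - k)%N, k; split; first by rewrite subn_gt0.
have pch : p \in [pchar {poly 'F_p}] by rewrite pchar_poly pchar_Fp.
have pn : ([pchar {poly 'F_p}]).-nat (p ^ k)%N.
  by rewrite pnatX pnatE // pch.
rewrite exprDn_pchar // exprNn_pchar // -exprM -expnD subnK ?(ltnW kl) //.
by rewrite /dvdp modpD modpN E subrr.
Qed.

Section Frobenius.
Variable C : CpField.
Local Notation K := (cp_field C).
Local Notation v := (cp_val C).
Local Notation p := (cp_prime C).
Implicit Types (x y : K).

Lemma algebraic_prim_poly y : algebraic_over_Q y ->
  exists2 Q : {poly int}, map_poly (intr : int -> 'F_p) Q != 0 & (map_poly intr Q).[y] = 0.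
Proof.
move=> [q [q0 qy]]; have [r [a a0 qE]] := rat_poly_scale q.
have r0 : r != 0 by apply: contraNneq q0 => r0; rewrite qE r0 rmorph0 scaler0.
exists (zprimitive r).
  apply/eqP => h; have : (p %| zcontents (zprimitive r))%Z.
    rewrite dvdz_contents; apply/polyOverP => i.
    by rewrite (dvdz_pcharf (pchar_Fp (cp_prime_prime C))) -coef_map h coef0.
  by rewrite zcontents_primitive r0 dvdzE /= dvdn1 => /eqP p1; have := cp_prime_prime C; rewrite p1.
apply/eqP; rewrite -[_ == 0](mulrI_eq0 _ (mulfI (x := (zcontents r)%:~R) _)); last first.
  have -> : ((zcontents r)%:~R : K) = iQ C (zcontents r)%:~R by rewrite rmorph_int.
  by rewrite fmorph_eq0 intr_eq0 zcontents_eq0.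
rewrite -hornerZ -map_polyZ -zpolyEprim.
move: qy; rewrite -/(iQ C) qE map_polyZ rootZ; last first.
  by rewrite fmorph_eq0 invr_eq0 intr_eq0.
rewrite -map_poly_comp /root; congr (_.[_] == 0); apply: eq_map_poly => z /=.
by rewrite rmorph_int.
Qed.

Lemma vge_p_dvd (Q : {poly int}) y : map_poly (intr : int -> 'F_p) Q = 0 ->
  vge v y 0 -> vge v (map_poly intr Q).[y] 1.
Proof.
move=> Q0 hy; rewrite horner_coef; apply: vge_sum => i _.
rewrite coef_map /=; apply: vgeMr0; last exact: vgeX0.
have : (p %| Q`_i)%Z.
  by rewrite (dvdz_pcharf (pchar_Fp (cp_prime_prime C))) -coef_map Q0 coef0.
case/dvdzP => z ->; rewrite intrM; apply: vgeM0; first exact: vge_int.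
by right; rewrite -pmulrn v_p.
Qed.

(** The residue of [x] is algebraic over F_p: it is the residue of an algebraic number [y], whose
    primitive integral equation survives reduction modulo p and then divides a power of X^(p^f) -
    X. *)
Lemma frobenius_fix x : vge v x 0 ->
  exists2 f, (0 < f)%N & vgt v (x ^+ (p ^ f) - x) 0.
Proof.
move=> hx; have [y [algy xy]] := cp_dense x 1.
have xy0 : vgt v (x - y) 0 by apply: vge_gt xy; rewrite ltr01.
have hy : vge v y 0.
  have -> : y = x - (x - y) by ring.
  by apply: vgeB => //; apply: vgtW.
have [Q Q0 Qy] := algebraic_prim_poly algy.
have [f [k [f0 /dvdpP [g gE]]]] := poly_dvd_frobenius (cp_prime_prime C) Q0.
exists f => //; set N := (p ^ f)%N in gE *.
have [G GE] : exists G : {poly int}, map_poly (intr : int -> 'F_p) G = g.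
  exists (\poly_(i < size g) (nat_of_ord g`_i)%:Z); apply/polyP => i.
  rewrite coef_map coef_poly /=; case: ltnP => [_|/(nth_default 0) ->//].
  by rewrite -pmulrn natr_Zp.
have : vge v (map_poly intr (('X^N - 'X) ^+ (p ^ k) - G * Q)).[y] 1.
  apply: vge_p_dvd => //; rewrite rmorphB rmorphM rmorphXn rmorphB /= map_polyXn.
  by rewrite map_polyX GE -gE subrr.
rewrite rmorphB rmorphM rmorphXn rmorphB /= map_polyXn map_polyX.
rewrite !(hornerD, hornerN, hornerM, Qy, mulr0, subr0, horner_exp, hornerXn, hornerX) => h.
have {}h : vgt v (y ^+ N - y) 0.
  by apply: (@vgt_expr _ v _ (p ^ k)); apply: vge_gt h; rewrite ltr01.
have -> : x ^+ N - x = (x ^+ N - y ^+ N) + ((y ^+ N - y) - (x - y)) by ring.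
apply: vgtD; last exact: vgtB.
rewrite subrXX mulrC; apply: vgtM0 => //; apply: vge_sum => i _.
by apply: vgeM0; apply: vgeX0.
Qed.

Lemma frobenius_iter x q m : (0 < q)%N -> vge v x 0 -> vgt v (x ^+ q - x) 0 ->
  vgt v (x ^+ (q ^ m) - x) 0.
Proof.
move=> q0 hx h; elim: m => [|m IH]; first by rewrite expn0 expr1 subrr; left.
have -> : x ^+ (q ^ m.+1) - x = ((x ^+ (q ^ m)) ^+ q - x ^+ q) + (x ^+ q - x).
  by rewrite expnSr exprM; ring.
apply: vgtD => //; rewrite subrXX mulrC; apply: vgtM0 => //; apply: vge_sum => i _.
by apply: vgeM0; apply: vgeX0 => //; apply: vgeX0.
Qed.

Lemma frobenius_fix_all n (x : 'I_n -> K) : (forall i, vge v (x i) 0) ->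
  exists2 Q, (1 < Q)%N & forall i, vgt v (x i ^+ Q - x i) 0.
Proof.
move=> hx; have /choice [f hf] : forall i, exists f, (0 < f)%N /\ vgt v (x i ^+ (p ^ f) - x i) 0.
  by move=> i; have [f f0 h] := frobenius_fix (hx i); exists f.
exists (p ^ \prod_i f i)%N => [|i].
  rewrite -{1}(expn0 p) ltn_exp2l ?prime_gt1 ?cp_prime_prime //.
  by apply: prodn_gt0 => i; have [] := hf i.
rewrite (bigD1 i) //= expnM; have [f0 h] := hf i.
by apply: frobenius_iter => //; rewrite expn_gt0 p_gt0.
Qed.

End Frobenius.

(** * Values of rational polynomials *)

Lemma nat_upper_bound (l : seq rat) : exists k, forall x, x \in l -> x <= k%:R.
Proof.
elim: l => [|r l [k hk]]; first by exists 0%N.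
exists (k + Num.bound `|r|)%N => x; rewrite inE natrD => /orP [/eqP ->|/hk h].
  by rewrite ler_wpDl // (le_trans (ler_norm r)) // ltW // archi_boundP.
by rewrite ler_wpDr.
Qed.

Lemma nat_upper_boundf (I : finType) (r : I -> rat) : exists k, forall i, r i <= k%:R.
Proof.
have [k hk] := nat_upper_bound [seq r i | i : I].
by exists k => i; apply/hk/map_f; rewrite mem_enum.
Qed.

Section Evaluation.
Variable C : CpField.
Local Notation K := (cp_field C).
Local Notation v := (cp_val C).
Local Notation p := (cp_prime C).
Implicit Types (f g h : {poly rat}) (x y a : K).

Definition ev f x : K := (map_poly (iQ C) f).[x].

Lemma evD f g x : ev (f + g) x = ev f x + ev g x.
Proof. by rewrite /ev rmorphD hornerD. Qed.
Lemma evB f g x : ev (f - g) x = ev f x - ev g x.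
Proof. by rewrite /ev rmorphB hornerD hornerN. Qed.
Lemma evM f g x : ev (f * g) x = ev f x * ev g x.
Proof. by rewrite /ev rmorphM hornerM. Qed.
Lemma evX f n x : ev (f ^+ n) x = ev f x ^+ n.
Proof. by rewrite /ev rmorphXn horner_exp. Qed.
Lemma evC q x : ev q%:P x = iQ C q.
Proof. by rewrite /ev map_polyC hornerC. Qed.
Lemma evZ q f x : ev (q *: f) x = iQ C q * ev f x.
Proof. by rewrite /ev map_polyZ hornerZ. Qed.
Lemma ev1 x : ev 1 x = 1.
Proof. by rewrite -polyC1 evC rmorph1. Qed.
Lemma ev0 x : ev 0 x = 0.
Proof. by rewrite -polyC0 evC rmorph0. Qed.
Lemma ev_var x : ev 'X x = x.
Proof. by rewrite /ev map_polyX hornerX. Qed.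

Lemma map_iQ_neq0 f : f != 0 -> map_poly (iQ C) f != 0.
Proof. by rewrite map_poly_eq0. Qed.

Lemma iQ_pX k : iQ C (p%:R ^+ k) = p%:R ^+ k.
Proof. by rewrite rmorphXn /= rmorph_nat. Qed.

Lemma v_pX k : v (p%:R ^+ k) = k%:R.
Proof. by rewrite vX ?p_neq0 // v_p mulr1. Qed.

Lemma pX_neq0 k : (p%:R : K) ^+ k != 0.
Proof. by rewrite expf_neq0 ?p_neq0. Qed.

Lemma pQX_neq0 k : (p%:R : rat) ^+ k != 0.
Proof. by rewrite expf_neq0 ?pQ_neq0. Qed.

Lemma denq_vge q : ~~ (p %| absz (denq q))%N <-> vge v (iQ C q) 0.
Proof.
have [->|q0] := eqVneq q 0.
  by rewrite rmorph0 (_ : denq 0 = 1) //= dvdn1 neq_ltn prime_gt1 ?cp_prime_prime ?orbT; split=> // _; left.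
have iq0 : iQ C q != 0 by rewrite fmorph_eq0.
rewrite vgeE // v_iQ // /padicv ler0z subr_ge0 lez_nat; split=> [h|h].
  by rewrite (logn_coprime (m := absz (denq q))) // prime_coprime ?cp_prime_prime.
apply/negP => pd; have : (0 < logn p (absz (denq q)))%N.
  by rewrite logn_gt0 mem_primes cp_prime_prime pd absz_gt0 denq_eq0.
have cop := coprime_num_den q; rewrite ltnNge => /negP; apply.
have -> // : (logn p (absz (denq q)) <= 0)%N.
apply: leq_trans h _; rewrite logn_coprime //.
rewrite prime_coprime ?cp_prime_prime //; apply/negP => pn.
have : (p %| gcdn (absz (numq q)) (absz (denq q)))%N by rewrite dvdn_gcd pn.
by rewrite (eqP cop) dvdn1 => /eqP p1; have := cp_prime_prime C; rewrite p1.
Qed.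

Lemma vge_scale_pX k y r : vge v y r -> vge v (p%:R ^+ k * y) (k%:R + r).
Proof. by apply: vgeM; right; rewrite v_pX. Qed.

Lemma clear_denominators f : exists k, forall i, vge v (iQ C (p%:R ^+ k *: f)`_i) 0.
Proof.
have [k hk] := nat_upper_bound [seq - v (iQ C c) | c <- f : seq rat].
exists k => i; rewrite coefZ rmorphM /= iQ_pX.
have [sz|sz] := leqP (size f) i; first by rewrite nth_default // rmorph0 mulr0; left.
apply: vge_le (vge_scale_pX k (vge_refl v (iQ C f`_i))).
by rewrite -lerBlDr sub0r; apply: hk; apply: (map_f (fun c => - v (iQ C c))); apply: mem_nth.
Qed.

Lemma vge_ev f x : (forall i, vge v (iQ C f`_i) 0) -> vge v x 0 -> vge v (ev f x) 0.
Proof. by move=> hf hx; apply: vge_poly => // i; rewrite coef_map; apply: hf. Qed.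

(** A ramification bound tested only on values at [a] of rational polynomials, which is the part of
    Q_p(a) that a valuation of Q(X) can see. *)
Definition value_denominator (e : nat) a : Prop :=
  forall f, ev f a != 0 -> exists z : int, e%:R * v (ev f a) = z%:~R.

Lemma finite_ramification_ev a : finite_ramification v a ->
  exists2 e, (0 < e)%N & value_denominator e a.
Proof.
move=> [e [e0 he]]; exists e => // f f0; apply: he => // S [S0 S1 SB SM SV] SQ Sa.
have SD x y : S x -> S y -> S (x + y).
  by move=> Sx Sy; rewrite -[y]opprK; apply: (SB) => //; rewrite -sub0r; apply: SB.
rewrite /ev; elim/poly_ind: f {f0} => [|f c IH]; first by rewrite rmorph0 horner0.
rewrite rmorphD rmorphM /= map_polyX map_polyC !hornerE; apply: SD; first exact: SM.
by apply: SQ => N; exists c; left; rewrite subrr.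
Qed.

(* Q(a) is dense in Q_p(a), so both have the same value group. *)
Lemma ev_finite_ramification a e : (0 < e)%N -> value_denominator e a ->
  finite_ramification v a.
Proof.
move=> e0 he; exists e; split=> // x xa x0.
pose S y := forall N, exists g h, ev h a != 0 /\ vge v (y - ev g a / ev h a) N.
have S_rat g h : ev h a != 0 -> S (ev g a / ev h a).
  by move=> h0 N; exists g, h; split=> //; left; rewrite subrr.
have : S x.
  apply: xa; [split|move=> y hy N|].
  - by have := @S_rat 0 1; rewrite ev0 ev1 mul0r; apply; rewrite oner_neq0.
  - by have := @S_rat 1 1; rewrite ev1 divr1; apply; rewrite oner_neq0.
  - move=> y z hy hz N; have [g [h [h0 H]]] := hy N; have [g' [h' [h'0 H']]] := hz N.
    exists (g * h' - g' * h), (h * h'); rewrite evB !evM; split; first by rewrite mulf_neq0.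
    have -> : y - z - (ev g a * ev h' a - ev g' a * ev h a) / (ev h a * ev h' a)
       = (y - ev g a / ev h a) - (z - ev g' a / ev h' a) by field; rewrite h0 h'0.
    exact: vgeB.
  - move=> y z hy hz N; have [g [h [h0 H]]] := hy (N - v z).
    have [g' [h' [h'0 H']]] := hz (Num.max (N - v y) (v z)).
    exists (g * g'), (h * h'); rewrite !evM; split; first by rewrite mulf_neq0.
    set s := ev g a / ev h a in H; set t := ev g' a / ev h' a in H'.
    have -> : y * z - ev g a * ev g' a / (ev h a * ev h' a) = y * (z - t) + (y - s) * t.
      by rewrite /s /t; field; rewrite h0 h'0.
    apply: vD.
      apply: vge_le (vgeM (vge_refl v y) H').
      by rewrite -lerBlDl le_max lexx.
    have ht : vge v t (v z).
      have -> : t = z - (z - t) by ring.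
      by apply: vgeB (vge_refl v z) _; apply: vge_le H'; rewrite le_max lexx orbT.
    by apply: vge_le (vgeM H ht); rewrite subrK.
  (* Since 1/y - 1/s = (s - y)/(y s), the precision must exceed [N] by [2 * v y]; the bound
     [v y + 1] forces [v s = v y]. *)
  - move=> y hy y0 N; have [g [h [h0 H]]] := hy (Num.max (v y + 1) (N + 2 * v y)).
    set s := ev g a / ev h a in H.
    have [s0 vs] : s != 0 /\ v s = v y.
      apply: v_near => //; rewrite -opprB; apply: vgtN; apply: vge_gt H.
      by rewrite lt_max ltrDl ltr01.
    have g0 : ev g a != 0 by apply: contraNneq s0 => g0; rewrite /s g0 mul0r.
    exists h, g; split=> //.
    have -> : y^-1 - ev h a / ev g a = - (y - s) * (y^-1 * s^-1).
      by rewrite /s; field; rewrite g0 h0.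
    apply: vge_le (vgeM (vgeN H) (vge_refl v _)).
    rewrite vM ?invr_eq0 // !vV // vs.
    have : N + 2 * v y <= Num.max (v y + 1) (N + 2 * v y) by rewrite le_max lexx orbT.
    by lra.
  - have [q hq] := hy N; exists q%:P, 1; rewrite ev1 evC divr1.
    by split=> //; rewrite oner_neq0.
  - by have := @S_rat 'X 1; rewrite ev1 ev_var divr1; apply; rewrite oner_neq0.
case/(_ (v x + 1)) => g [h [h0 H]]; set s := ev g a / ev h a in H.
have [s0 vs] : s != 0 /\ v s = v x.
  apply: v_near => //; rewrite -opprB; apply: vgtN; apply: vge_gt H.
  by rewrite ltrDl ltr01.
have g0 : ev g a != 0 by apply: contraNneq s0 => g0; rewrite /s g0 mul0r.
have [z hz] := he g g0; have [z' hz'] := he h h0.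
by exists (z - z'); rewrite -vs v_div // mulrBr hz hz' intrB.
Qed.

End Evaluation.

(** * A ball obstructs the Dedekind property *)

Section NotDedekind.
Variable C : CpField.
Local Notation K := (cp_field C).
Local Notation v := (cp_val C).
Local Notation p := (cp_prime C).
Local Notation ev := (@ev C).
Variables (R : {poly rat} -> Prop) (E : K -> Prop).
Hypothesis RE : forall f, R f <-> forall x, E x -> vge v (ev f x) 0.
Hypothesis EO : forall x, E x -> vge v x 0.

Lemma subring_scalar q : vge v (iQ C q) 0 -> R q%:P.
Proof. by move=> hq; apply/RE => x _; rewrite evC. Qed.

Lemma subringB f g : R f -> R g -> R (f - g).
Proof.
by move=> /RE hf /RE hg; apply/RE => x xE; rewrite evB; apply: vgeB; [apply: hf|apply: hg].
Qed.

Lemma subringD f g : R f -> R g -> R (f + g).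
Proof.
by move=> /RE hf /RE hg; apply/RE => x xE; rewrite evD; apply: vD; [apply: hf|apply: hg].
Qed.

Lemma subringM f g : R f -> R g -> R (f * g).
Proof.
by move=> /RE hf /RE hg; apply/RE => x xE; rewrite evM; apply: vgeM0; [apply: hf|apply: hg].
Qed.

Lemma subringX f n : R f -> R (f ^+ n).
Proof. by move=> /RE hf; apply/RE => x xE; rewrite evX; apply/vgeX0/hf. Qed.

Lemma subring0 : R 0.
Proof. by apply/RE => x _; rewrite ev0; left. Qed.

Lemma subring1 : R 1.
Proof. by apply/RE => x _; rewrite ev1; apply: vge1. Qed.

Lemma subring_pX k : R (p%:R ^+ k)%:P.
Proof. by apply: subring_scalar; rewrite iQ_pX; right; rewrite v_pX ler0n. Qed.

Lemma subring_clear f : exists k, R (p%:R ^+ k *: f).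
Proof.
have [k hk] := clear_denominators C f.
by exists k; apply/RE => x xE; apply: vge_ev => //; apply: EO.
Qed.

Lemma ideal_add_principal P t : ideal_of R P -> R t ->
  ideal_of R (fun x => exists a s, [/\ P a, R s & x = a + t * s]).
Proof.
move=> [PR P0 PB PM] Rt; split.
- by move=> _ [a [s [Pa Rs ->]]]; apply: subringD; [exact: PR|exact: subringM].
- by exists 0, 0; rewrite mulr0 addr0; split=> //; exact: subring0.
- move=> _ _ [a [s [Pa Rs ->]]] [b [u [Pb Ru ->]]].
  exists (a - b), (s - u); split; [exact: PB|exact: subringB|ring].
- move=> r _ Rr [a [s [Pa Rs ->]]].
  exists (r * a), (r * s); split; [exact: PM|exact: subringM|ring].
Qed.

Variables (a : K) (d : rat).
Hypothesis ballE : forall x, vge v (x - a) d -> E x.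
Local Notation gv f := (gval a d (map_poly (iQ C) f)).
(* This is what irredundancy provides. *)
Variable f0 : {poly rat}.
Hypothesis f0_bad : ~ in_Zpad v a (Some d) f0.
Hypothesis f0_good : forall x, E x -> vge v (x - a) d \/ vge v (ev f0 x) 0.

Let gvM f g : f != 0 -> g != 0 -> gv (f * g) = gv f + gv g.
Proof. by move=> f0' g0; rewrite rmorphM gvalM ?map_iQ_neq0. Qed.

Let gvX f n : f != 0 -> gv (f ^+ n) = n%:R * gv f.
Proof. by move=> h; rewrite rmorphXn gvalX ?map_iQ_neq0. Qed.

Let gvZ q f : q != 0 -> f != 0 -> gv (q *: f) = v (iQ C q) + gv f.
Proof.
move=> q0 h; rewrite -mul_polyC gvM ?polyC_eq0 // map_polyC gvalC //.
by rewrite fmorph_eq0.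
Qed.

Lemma gv_ge0 f : f != 0 -> R f -> 0 <= gv f.
Proof.
move=> h /RE hf; apply/gval_ge0_ball; first exact: map_iQ_neq0.
by move=> x /ballE; apply: hf.
Qed.

Lemma gv_ball f x : f != 0 -> vge v (x - a) d -> vge v (ev f x) (gv f).
Proof. by move=> h; apply/gval_ball/map_iQ_neq0. Qed.

Lemma rat_split (r : rat) : exists (z : int) (b : nat), (0 < b)%N /\ b%:R * r = z%:~R.
Proof.
exists (numq r), `|denq r|%N; split; first by rewrite absz_gt0 denq_eq0.
by rewrite pmulrn gtz0_abs ?denq_gt0 // numqE mulrC.
Qed.

Lemma v_iQ_pz (z : int) : p%:R ^ z != 0 :> rat /\ v (iQ C (p%:R ^ z)) = z%:~R.
Proof.
split; first by rewrite expfz_eq0 negb_and pQ_neq0 orbT.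
case: z => k; first by rewrite -[p%:R ^ k]/(p%:R ^+ k) iQ_pX v_pX pmulrn.
by rewrite -[p%:R ^ _]/(p%:R ^- k.+1) fmorphV /= iQ_pX vV ?pX_neq0 // v_pX NegzE mulrNz pmulrn.
Qed.

Lemma gv_normalize f : f != 0 -> exists (q : rat) (b : nat),
  [/\ q != 0, (0 < b)%N & gv (q *: f ^+ b) = 0].
Proof.
move=> h; have [z [b [b0 hb]]] := rat_split (gv f).
have [q0 vq] := v_iQ_pz (- z).
exists (p%:R ^ (- z)), b; split=> //.
by rewrite gvZ ?expf_neq0 // vq gvX // hb intrN addNr.
Qed.

(* The witness f0, raised to a power and scaled to value 0 on the ball, is p times an
   element that is integral away from the ball. *)
Lemma local_unit : exists g1, [/\ g1 != 0, gv (p%:R *: g1) = 0 &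
  forall x, E x -> vge v (x - a) d \/ vge v (ev g1 x) 0].
Proof.
have h0 : f0 != 0.
  by apply/eqP => h; apply: f0_bad; apply/in_Zpad_cball => x _; rewrite h -/(ev 0 x) ev0; left.
have neg : gv f0 < 0.
  by rewrite ltNge; apply/negP => /in_Zpad_gval => /(_ h0).
have [z [b [b0 hb]]] := rat_split (gv f0).
have : z < 0 by rewrite -(ltrz0 rat) -hb pmulr_rlt0 // ltr0n.
case: z hb => // m hb _; exists (p%:R ^+ m *: f0 ^+ b).
split; first by rewrite scaler_eq0 negb_or pQX_neq0 expf_neq0.
  rewrite scalerA -exprS gvZ ?pQX_neq0 ?expf_neq0 // iQ_pX v_pX gvX // hb NegzE.
  by rewrite mulrNz -pmulrn subrr.
move=> x /f0_good [|h]; [by left|right].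
rewrite evZ evX; apply: vgeM0; last exact: vgeX0.
by rewrite iQ_pX; right; rewrite v_pX ler0n.
Qed.

Lemma ball_algebraic_point : exists (q : {poly rat}) (y : K),
  [/\ q != 0, ev q y = 0 & vge v (y - a) d].
Proof.
have [y [[q [q0 /eqP qy]] hy]] := cp_dense a d.
by exists q, y; split=> //; rewrite -opprB; apply: vgeN.
Qed.

(** Clear the denominators of [h] by p^k. On the ball p g1 has value 0, so multiplying [h] by its
    k-th power keeps the value 0, which gives integrality there; off the ball the factor p^k clears
    [h], and [g1] is integral. *)
Lemma transcendental_residue : exists (t : {poly rat}) (y : K),
  [/\ R t, t != 0, gv t = 0, ev t y = 0 & vge v (y - a) d].
Proof.
have [q [y [q0 qy ya]]] := ball_algebraic_point.
have [s [b [s0 b0 hh]]] := gv_normalize q0.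
set h := s *: q ^+ b in hh; have h0 : h != 0 by rewrite scaler_eq0 negb_or s0 expf_neq0.
have hy : ev h y = 0 by rewrite evZ evX qy expr0n eqn0Ngt b0 mulr0.
have [g1 [g10 gg gE]] := local_unit.
have [k Rk] := subring_clear h.
have t0 : h * (p%:R *: g1) ^+ k != 0.
  by rewrite mulf_neq0 // expf_neq0 // scaler_eq0 negb_or pQ_neq0.
have gt : gv (h * (p%:R *: g1) ^+ k) = 0.
  by rewrite gvM ?gvX ?hh ?gg ?mulr0 ?addr0 // ?expf_neq0 // scaler_eq0 negb_or pQ_neq0.
exists (h * (p%:R *: g1) ^+ k), y; split=> //; last by rewrite evM hy mul0r.
apply/RE => x xE; have [xa|gx] := gE x xE.
  by apply: vge_le (gv_ball t0 xa); rewrite gt.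
have -> : h * (p%:R *: g1) ^+ k = (p%:R ^+ k *: h) * g1 ^+ k.
  by rewrite -!mul_polyC exprMn polyC_exp; ring.
move/RE: Rk => Rk.
by rewrite evM evX; apply: vgeM0; [apply: Rk|apply: vgeX0].
Qed.

Lemma center_prime : prime_ideal R (fun f => R f /\ (f = 0 \/ 0 < gv f)).
Proof.
split; first split.
- by move=> f [].
- by split; [exact: subring0|left].
- move=> f g [Rf hf] [Rg hg]; split; first exact: subringB.
  have [->|fg] := eqVneq (f - g) 0; [by left|right].
  have [g0|g0] := eqVneq g 0.
    rewrite g0 subr0 in fg *; by case: hf => // fE; rewrite fE eqxx in fg.
  case: hg => [gE|hg]; first by rewrite gE eqxx in g0.
  have [fE|f00] := eqVneq f 0.
    have := @gvM (-1)%:P g; rewrite fE sub0r polyCN mulN1r => ->//.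
      have iN1 : iQ C (-1) = -1 by rewrite rmorphN rmorph1.
      by rewrite -polyCN map_polyC /= iN1 gvalC ?oppr_eq0 ?oner_neq0 // vN1 add0r.
    by rewrite oppr_eq0 polyC_eq0 oner_neq0.
  case: hf => [fE|hf]; first by rewrite fE eqxx in f00.
  by rewrite rmorphB; apply: gvalB; rewrite -?rmorphB ?map_iQ_neq0.
- move=> r f Rr [Rf hf]; split; first exact: subringM.
  have [->|r0] := eqVneq r 0; first by left; rewrite mul0r.
  have [->|f00] := eqVneq f 0; first by left; rewrite mulr0.
  case: hf => [fE|hf]; first by rewrite fE eqxx in f00.
  by right; rewrite gvM // ltr_wpDl // gv_ge0.
- case=> _ [/eqP|]; first by rewrite oner_eq0.
  by rewrite rmorph1 -polyC1 gvalC ?oner_neq0 // v1 ltxx.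
- move=> f g Rf Rg [_ hfg].
  have [->|f00] := eqVneq f 0; first by left; split; [exact: subring0|left].
  have [->|g0] := eqVneq g 0; first by right; split; [exact: subring0|left].
  case: hfg => [/eqP|]; first by rewrite mulf_eq0 (negPf f00) (negPf g0).
  rewrite gvM // => h; case: (ltP 0 (gv f)) => hf; first by left; split=> //; right.
  by right; split=> //; right; lra.
Qed.

Lemma not_Dedekind : ~ Dedekind_domain R.
Proof.
move=> [_ _ dim1].
have /dim1 [|id P1 hmax] := center_prime.
  exists (p%:R)%:P; split; last by rewrite polyC_eq0 pQ_neq0.
  split; first by have := subring_pX 1; rewrite expr1.
  by right; rewrite map_polyC gvalC /= rmorph_nat ?p_neq0 // v_p.
have [t [y [Rt t0 gt ty ya]]] := transcendental_residue.
case: (hmax _ (ideal_add_principal id Rt)).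
- move=> x Px; exists x, 0; rewrite mulr0 addr0; split=> //; exact: subring0.
- move/(_ t) => [|_ [/eqP|]]; last 2 first.
  + by rewrite (negPf t0).
  + by rewrite gt ltxx.
  exists 0, 1; rewrite mulr1 add0r; split=> //; last exact: subring1.
  by split; [exact: subring0|left].
(* Evaluation at [y] kills [t], while every element of the centre vanishes or has positive value at
   each point of the ball; so 1 is not in the ideal generated by the centre and [t]. *)
- move=> [b [s [[_ hb] _ /(congr1 (fun f => ev f y))]]].
  rewrite evD evM ty mul0r addr0 ev1 => E1.
  have : vgt v (ev b y) 0.
    case: hb => [->|hb]; first by rewrite ev0; left.
    have [b0|b0] := eqVneq b 0; first by rewrite b0 ev0; left.
    exact: vge_gt hb (gv_ball b0 ya).
  by rewrite -E1 vgtE ?oner_neq0 // v1 ltxx.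
Qed.

End NotDedekind.

(** * Finitely many transcendental points give a Dedekind domain *)

Lemma prime_ideal_pow (R P : {poly rat} -> Prop) f n :
  prime_ideal R P -> R 1 -> (forall x y, R x -> R y -> R (x * y)) ->
  R f -> P (f ^+ n) -> P f.
Proof.
move=> [_ P1 PM] R1 RM Rf; elim: n => [|n IH]; first by rewrite expr0.
have Rn : R (f ^+ n) by elim: n {IH} => [|n IH]; rewrite ?expr0 ?exprS //; apply: RM.
by rewrite exprS => /PM [].
Qed.

Section Dedekind.
Variable C : CpField.
Local Notation K := (cp_field C).
Local Notation v := (cp_val C).
Local Notation p := (cp_prime C).
Local Notation ev := (@ev C).

(** Some power of [y] has integral value and is scaled to a unit [x] by a power of p; as x^Q has the
    residue of [x], the residue of x^(Q-1) is 1. *)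
Lemma residue_one (y : K) : y != 0 -> exists (c : rat) (b : nat),
  (0 < b)%N /\ vgt v (1 - iQ C c * y ^+ b) 0.
Proof.
move=> y0; have [z [b [b0 hb]]] := rat_split (v y).
have [q0 vq] := v_iQ_pz C (- z); set q := _ ^ _ in q0 vq.
have iq0 : iQ C q != 0 by rewrite fmorph_eq0.
have yb0 : y ^+ b != 0 by rewrite expf_neq0.
pose x := iQ C q * y ^+ b; have x0 : x != 0 by rewrite mulf_neq0.
have vx : v x = 0 by rewrite vM // vq vX // hb intrN addNr.
have [|Q Q1 /(_ ord0) h] := @frobenius_fix_all C 1 (fun _ => x).
  by move=> _; right; rewrite vx.
exists (q ^+ Q.-1), (b * Q.-1)%N; split.
  by rewrite muln_gt0 b0 /= -ltnS prednK // ltnW.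
rewrite rmorphXn /= exprM -exprMn -/x.
have E : 1 - x ^+ Q.-1 = - ((x ^+ Q - x) * x^-1).
  rewrite -(prednK (ltnW Q1)) exprS /=; field; exact: x0.
rewrite E; apply: vgtN; rewrite mulrC; apply: vgtM0 => //.
by right; rewrite vV // vx oppr0.
Qed.

(** The points are treated in order of value. For the point [y] of least value, [w0 = 1 - c X^b] has
    positive value at [y] and stays integral at each other [z], because c z^b has at least the value
    0 of c y^b. A high power of [w0] then outweighs whatever value [w'] takes at [y]. *)
Lemma interpolate_zero_one (l : seq K) : (forall y, y \in l -> y != 0) ->
  exists w : {poly rat}, w.[0] = 1 /\ forall y, y \in l -> vgt v (ev w y) 0.
Proof.
pose r (x y : K) := v x <= v y.
have rtot : total r by move=> x y; apply: le_total.
have rtr : transitive r by move=> y x z; apply: le_trans.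
suff : forall s : seq K, sorted r s -> (forall y, y \in s -> y != 0) ->
  exists w : {poly rat}, w.[0] = 1 /\ forall y, y \in s -> vgt v (ev w y) 0.
  move=> H l0; have [y|w [w0 hw]] := H (sort r l) (sort_sorted rtot l).
  - by rewrite mem_sort; apply: l0.
  - by exists w; split=> // y yl; apply: hw; rewrite mem_sort.
elim=> [|y s IH] ss s0; first by exists 1; rewrite hornerC.
have y0 := s0 y (mem_head _ _).
have [z zs|w' [w'0 hw']] := IH (path_sorted ss); first by apply: s0; rewrite inE zs orbT.
have hle z : z \in s -> v y <= v z by move: (order_path_min rtr ss) => /allP h /h.
have [c [b [b0 hy]]] := residue_one y0.
pose w0 : {poly rat} := 1 - c *: 'X^b.
have ev0E z : ev w0 z = 1 - iQ C c * z ^+ b by rewrite evB ev1 evZ evX ev_var.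
have [u0 vu] : iQ C c * y ^+ b != 0 /\ v (iQ C c * y ^+ b) = 0.
  have := @v_near _ v 1 (iQ C c * y ^+ b) (oner_neq0 _); rewrite v1; apply.
  by rewrite -opprB; apply: vgtN.
have c0 : iQ C c != 0 by apply: contraNneq u0 => ->; rewrite mul0r.
have hw0 z : z \in s -> vge v (ev w0 z) 0.
  move=> zs; rewrite ev0E; apply: vgeB; first exact: vge1.
  have z0 : z != 0 by apply: s0; rewrite inE zs orbT.
  right; rewrite vM ?expf_neq0 // vX // -[leLHS]vu vM ?expf_neq0 // vX // lerD2l.
  by rewrite ler_wpM2l ?hle.
have [t0 t00 ht0] : exists2 s0, 0 < s0 & vge v (ev w0 y) s0.
  by rewrite ev0E; apply: vgt_ge.
have [t ht] := nat_upper_bound [:: (1 - v (ev w' y)) / t0].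
exists (w0 ^+ t * w'); split.
  by rewrite hornerM horner_exp /w0 !hornerE expr0n eqn0Ngt b0 /= mulr0 subr0 expr1n mul1r.
move=> z; rewrite inE => /orP [/eqP ->|zs]; rewrite evM evX; last first.
  by apply: vgtM0; [apply/vgeX0/hw0|apply: hw'].
apply: vge_gt (vgeM (vgeX t ht0) (vge_refl v _)).
have := ht _ (mem_head _ _); rewrite ler_pdivrMr // => h; lra.
Qed.

Variables (R : {poly rat} -> Prop) (n : nat) (a : 'I_n -> K) (e : nat).
Hypothesis RE' : forall f, R f <-> forall i, vge v (ev f (a i)) 0.
Hypothesis aO : forall i, vge v (a i) 0.
Hypothesis a_trans : forall i f, f != 0 -> ev f (a i) != 0.
Hypothesis e_gt0 : (0 < e)%N.
Hypothesis a_disc : forall i, value_denominator e (a i).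

Let E (x : K) := exists i, x = a i.
Let RE f : R f <-> forall x, E x -> vge v (ev f x) 0.
Proof. by rewrite RE'; split=> [h x [i ->] //|h i]; apply: h; exists i. Qed.
Let EO x : E x -> vge v x 0. Proof. by case=> i ->. Qed.

Let R1 := subring1 RE.
Let R0 := subring0 RE.
Let RB := subringB RE.
Let RM := subringM RE.
Let RX := subringX RE.
Let Rclear := subring_clear RE EO.
Let Rp k : R (p%:R ^+ k)%:P. Proof. exact: subring_pX RE k. Qed.

(** Since w(0) = 1, X divides 1 - w^t. Substituting [q] for X exhibits w(q)^t, which is small at
    every point, as 1 - q h. *)
Lemma approx_inverse q N : q != 0 ->
  exists h, forall i, vge v (ev (1 - q * h) (a i)) N.
Proof.
move=> q0; have [y|w [w0 hw]] := @interpolate_zero_one [seq ev q (a i) | i : 'I_n].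
  by move=> /mapP [i _ ->]; apply: a_trans.
have hw1 i : exists s, 0 < s /\ vge v (ev w (ev q (a i))) s.
  have /vgt_ge [s s0 hs] : vgt v (ev w (ev q (a i))) 0; last by exists s.
  by apply/hw/map_f; rewrite mem_enum.
have /choice [s hs] := hw1.
have [t ht] := nat_upper_boundf (fun i => N / s i).
have /factor_theorem [u uE] : root (1 - w ^+ t) 0.
  by rewrite /root !hornerE w0 expr1n subrr.
exists (u \Po q) => i; have [si0 hsi] := hs i.
have -> : 1 - q * (u \Po q) = (w \Po q) ^+ t.
  rewrite -rmorphXn /= -[w ^+ t](subKr 1) uE subr0 rmorphB rmorphM /= comp_polyX.
  by rewrite comp_polyC mulrC.
rewrite evX {1}/ev map_comp_poly horner_comp; apply: vge_le (vgeX t hsi).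
by rewrite -ler_pdivrMr.
Qed.

(** Euclidean division in Q[X]: a p-power multiple of each remainder lies in the ideal, so
    minimality of the degree makes the remainder vanish. The cofactor [h] is only in Q[X], in
    general not in [R]. *)
Lemma min_degree_generator I : ideal_of R I -> (exists f, I f /\ f != 0) ->
  exists q, [/\ I q, q != 0, (forall g, I g -> g != 0 -> (size q <= size g)%N) &
    forall g, I g -> exists h, g = q * h].
Proof.
move=> [IR I0 IB IM] [f [If f0]].
have [|m [q [Iq q0 <-]] hmin] := @classical_min (fun m => exists q, [/\ I q, q != 0 & size q = m]).
  by exists (size f), f.
exists q; split=> // g Ig => [g0|]; first by apply: hmin; exists g.
have [k Rk] := Rclear (g %/ q)%R.
exists (g %/ q)%R; rewrite mulrC [LHS](divp_eq g q).
have : I (p%:R ^+ k *: (g %% q)%R).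
  have -> : p%:R ^+ k *: (g %% q)%R = (p%:R ^+ k)%:P * g - (p%:R ^+ k *: (g %/ q)%R) * q.
    by rewrite {2}(divp_eq g q) -!mul_polyC; ring.
  by apply: IB; apply: IM.
have [->|r0] := eqVneq (g %% q)%R 0; first by rewrite addr0.
have rk0 : p%:R ^+ k *: (g %% q)%R != 0 by rewrite scaler_eq0 negb_or pQX_neq0.
move=> Ir; have := hmin _ (ex_intro _ _ (And3 Ir rk0 erefl)).
by rewrite size_scale ?pQX_neq0 // leqNgt ltn_modp q0.
Qed.

Lemma p_divides f N : (forall i, vge v (ev f (a i)) N%:R) ->
  exists2 g, R g & f = (p%:R ^+ N)%:P * g.
Proof.
move=> h; exists ((p%:R ^- N) *: f); last first.
  by rewrite mul_polyC scalerA mulfV ?pQX_neq0 // scale1r.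
apply/RE' => i; rewrite evZ fmorphV /= iQ_pX; apply: vge_le (vgeM (vge_refl v _) (h i)).
by rewrite vV ?pX_neq0 // v_pX addNr.
Qed.

(** Some power f^Q has the residue of [f] at every point, so a power of f^Q - f is divisible by p in
    [R] and lies in [P]; primality then cancels one factor [f]. *)
Lemma prime_over_p P f : prime_ideal R P -> P (p%:R)%:P -> R f -> ~ P f ->
  exists m, P (f ^+ m.+1 - 1).
Proof.
move=> hP Pp Rf nPf; have [[_ _ _ PM] _ Pprime] := hP.
have [|Q Q1 hQ] := @frobenius_fix_all C n (fun i => ev f (a i)).
  by move=> i; move/RE': Rf; apply.
pose h := f ^+ Q - f; have Rh : R h by apply: RB => //; apply: RX.
have hh i : exists s, 0 < s /\ vge v (ev h (a i)) s.
  have /vgt_ge [s s0 hs] : vgt v (ev h (a i)) 0; last by exists s.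
  by rewrite evB evX.
have /choice [s hs] := hh.
have [t ht] := nat_upper_boundf (fun i => (s i)^-1).
have [|g Rg gE] := @p_divides (h ^+ t) 1.
  move=> i; have [si0 hsi] := hs i; rewrite evX; apply: vge_le (vgeX t hsi).
  by rewrite -ler_pdivrMr // div1r.
have Ph : P h.
  apply: (@prime_ideal_pow R P h t) => //; rewrite gE expr1 mulrC; exact: PM.
exists Q.-2; have [//|||//|//] := Pprime f (f ^+ Q.-2.+1 - 1).
- by apply: RB => //; apply: RX.
- by move: Ph; rewrite /h; case: (Q) Q1 => [|[|m]] // _; rewrite /= exprS mulrBr mulr1.
Qed.

(** If p lies in [P], a power of any [f] outside [P] is 1 modulo [P]. Otherwise [P] is closed under
    division by p within [R], and an [f] in [J] outside [P] is coprime to the element [q] of least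
    degree. Bezout puts some p^N into [J], and [approx_inverse] writes 1 as q h plus a multiple of
    p^N. *)
Lemma primes_maximal P : prime_ideal R P -> (exists x, P x /\ x != 0) -> maximal_ideal R P.
Proof.
move=> hP P_neq0; have [idP nP1 Pprime] := hP; have [PR P0 PB PM] := idP.
split=> // J [JR J0 JB JM] PJ.
case: (EM (exists f, J f /\ ~ P f)) => [[f [Jf nPf]]|h]; last first.
  by left=> x Jx; apply: contrapT => nPx; apply: h; exists x.
right; have Rf := JR _ Jf.
have JD x y : J x -> J y -> J (x + y).
  by move=> Jx Jy; rewrite -[y]opprK -[- y]sub0r; apply: (JB) => //; apply: JB.
case: (EM (P (p%:R)%:P)) => [Pp|nPp].
  have [m Pm] := prime_over_p hP Pp Rf nPf.
  have -> : 1 = f ^+ m * f - (f ^+ m.+1 - 1) by rewrite exprSr; ring.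
  by apply: JB; [apply: JM => //; apply: RX|apply: PJ].
have nPk k : ~ P (p%:R ^+ k)%:P.
  rewrite polyC_exp => /(prime_ideal_pow hP R1 RM) h; apply: nPp; apply: h.
  by have := Rp 1; rewrite expr1.
have Psat k x : R x -> P (p%:R ^+ k *: x) -> P x.
  by move=> Rx; rewrite -mul_polyC => /(Pprime _ _ (Rp k) Rx) [/nPk|].
have [q [Pq q0 qmin qgen]] := min_degree_generator idP P_neq0.
(* A common factor [g] of positive degree would split a p-power multiple of [q] in [R]. Primality
   then puts into [P] a multiple of the cofactor, whose degree is too small, or of [g]; in the
   second case [q] divides [g], hence [f], and [Psat] gives [P f]. *)
have cop : coprimep q f.
  set g := gcdp q f; have g0 : g != 0 by rewrite gcdp_eq0 negb_and q0.
  have /dvdpP [h hE] : (g %| q)%R by rewrite dvdp_gcdl.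
  have h0 : h != 0 by apply: contraNneq q0 => h0; rewrite hE h0 mul0r.
  rewrite /coprimep eqn_leq -/g [in X in _ && X]size_poly_gt0 g0 andbT leqNgt.
  apply/negP => sg.
  have [k1 R1'] := Rclear g; have [k2 R2'] := Rclear h.
  have : P ((p%:R ^+ k1 *: g) * (p%:R ^+ k2 *: h)).
    have -> : (p%:R ^+ k1 *: g) * (p%:R ^+ k2 *: h) = ((p%:R ^+ k1)%:P * (p%:R ^+ k2)%:P) * q.
      by rewrite hE -!mul_polyC; ring.
    by apply: PM => //; apply: RM.
  case/(Pprime _ _ R1' R2') => [Pg|Ph].
    have [h' h'E] := qgen _ Pg.
    have /dvdpP [u uE] : (q %| f)%R.
      apply: dvdp_trans (dvdp_gcdr q f); rewrite -/g.
      by rewrite -(dvdpZr _ _ (pQX_neq0 C k1)) h'E dvdp_mulr.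
    have [k Rk] := Rclear u; apply: nPf; apply: (Psat k) => //.
    by rewrite uE scalerAl; apply: PM.
  have := qmin _ Ph; rewrite scaler_eq0 negb_or pQX_neq0 h0 => /(_ isT).
  rewrite size_scale ?pQX_neq0 // hE size_mul //.
  by move: sg; case: (size g) => [|[|s]] // _; rewrite addnS /= addnS ltnNge leq_addr.
have /Bezout_coprimepP [[u w] /= /eqpP [[c1 c2] /= /andP [c10 c20] bez]] := cop.
have [k1 Rk1] := Rclear u; have [k2 Rk2] := Rclear w.
have [k3 Rk3] := Rclear (c1 / c2)%:P.
pose N := (k1 + k2 + k3)%N.
have JN : J (p%:R ^+ N)%:P.
  have -> : (p%:R ^+ N)%:P = ((p%:R ^+ k2)%:P * (p%:R ^+ k3 *: (c1 / c2)%:P)) * ((p%:R ^+ k1 *: u) * q)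
     + ((p%:R ^+ k1)%:P * (p%:R ^+ k3 *: (c1 / c2)%:P)) * ((p%:R ^+ k2 *: w) * f).
    have bez' : (c1 / c2)%:P * (u * q + w * f) = 1.
      rewrite polyCM mulrAC mul_polyC bez -mul_polyC mulr1 -polyCM divff //.
    rewrite /N !exprD !polyCM -!mul_polyC -[LHS]mulr1 -bez'; ring.
  apply: JD.
    by apply: (JM); [apply: RM|apply: JM => //; apply: PJ].
  by apply: (JM); [apply: RM|apply: JM].
have [h hh] := approx_inverse N%:R q0.
have [g Rg gE] := p_divides hh.
have Jw : J (1 - q * h) by rewrite gE mulrC; apply: JM.
(* [h] is only in Q[X], but q h lies in [R] and a p-power multiple of it lies in [P]; [Psat] removes
   the power. *)
have Jqh : J (q * h).
  have Rqh : R (q * h) by rewrite -[q * h](subKr 1); apply: RB => //; apply: JR.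
  apply: PJ; have [k Rk] := Rclear h; apply: (Psat k) => //.
  by rewrite scalerAr mulrC; apply: PM.
by rewrite -[1](subrK (q * h)); apply: JD.
Qed.

(** * Total values and two generators for every ideal *)

Let va f i := v (ev f (a i)).

Let vaM f g i : f != 0 -> g != 0 -> va (f * g) i = va f i + va g i.
Proof. by move=> f0 g0; rewrite /va evM vM ?a_trans. Qed.

Let R_va f i : R f -> f != 0 -> 0 <= va f i.
Proof. by move=> /RE' /(_ i) h f0; apply/(vgeE v _ (a_trans i f0)). Qed.

Lemma total_value f : R f -> f != 0 -> exists m : nat, \sum_i e%:R * va f i = m%:R.
Proof.
move=> Rf f0; have h i : exists m : nat, e%:R * va f i = m%:R.
  have [z hz] := a_disc (a_trans i f0); case: z hz => m hm; first by exists m.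
  have : 0 <= e%:R * va f i by rewrite mulr_ge0 ?ler0n ?R_va.
  by rewrite hm ler0z.
have /choice [m hm] := h; exists (\sum_i m i)%N.
by rewrite natr_sum; apply: eq_bigr => i _.
Qed.

Lemma approx_inverse_value f h i : f != 0 -> vgt v (ev (1 - f * h) (a i)) 0 ->
  h != 0 /\ va h i = - va f i.
Proof.
move=> f0; rewrite evB ev1 evM => H.
have [] := @v_near _ v 1 (ev f (a i) * ev h (a i)) (oner_neq0 _).
  by rewrite v1 -opprB; apply: vgtN.
rewrite mulf_eq0 negb_or => /andP [fi hi]; rewrite vM // v1 => E0; split.
  by apply: contraNneq hi => ->; rewrite ev0.
by rewrite /va; lra.
Qed.

(* If some g in I has smaller value than f at some index, then an element
   f + x^k g with x in R of value 0 exactly where g/f has least value improves f. *)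
Lemma improve_total_value I f g i0 : ideal_of R I -> I f -> I g -> f != 0 -> g != 0 ->
  va g i0 < va f i0 -> exists f', [/\ I f', f' != 0 &
    \sum_i e%:R * va f' i < \sum_i e%:R * va f i].
Proof.
move=> [IR I0 IB IM] If Ig f0 g0 lt0.
have [h hh] := approx_inverse 1 f0.
have hv i : h != 0 /\ va h i = - va f i.
  by apply: approx_inverse_value => //; apply: vge_gt (hh i).
have [h0 _] := hv i0.
pose F i := va g i - va f i.
have [j Fj] : exists j, forall i, F j <= F i.
  by case: (@arg_minP _ _ _ i0 xpredT F isT) => j _ hj; exists j => i; apply: hj.
have Fj0 : F j < 0 by apply: le_lt_trans (Fj i0) _; rewrite subr_lt0.
have [z [b [b0 hb]]] := rat_split (F j).
have : z < 0 by rewrite -(ltrz0 rat) -hb pmulr_rlt0 // ltr0n.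
case: z hb => // m hb _.
have gh0 : g * h != 0 by rewrite mulf_neq0.
(* [g * h] has the values [F i]. As p^(m+1) has value [- b * F j], the values of [x] are
   [b * (F i - F j)]: zero exactly where [F] is least. *)
pose x := p%:R ^+ m.+1 *: (g * h) ^+ b.
have x0 : x != 0 by rewrite scaler_eq0 negb_or pQX_neq0 expf_neq0.
have vx i : va x i = b%:R * (F i - F j).
  rewrite /va /x evZ evX iQ_pX vM ?pX_neq0 ?expf_neq0 ?a_trans // v_pX vX ?a_trans //.
  rewrite -/(va _ i) vaM // (hv i).2 -/(F i) [RHS]mulrBr hb NegzE mulrNz -pmulrn; ring.
have vx0 i : 0 <= va x i by rewrite vx mulr_ge0 ?ler0n ?subr_ge0.
have Rx : R x by apply/RE' => i; right; apply: vx0.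
have [k hk] := nat_upper_boundf (fun i => (va f i + 1) / va x i).
have evE i : ev (f + x ^+ k * g) (a i) = ev f (a i) + ev x (a i) ^+ k * ev g (a i).
  by rewrite evD evM evX.
have vxg i : v (ev x (a i) ^+ k * ev g (a i)) = k%:R * va x i + va g i.
  by rewrite vM ?expf_neq0 ?a_trans // vX ?a_trans.
have step i : va x i = 0 -> ev (f + x ^+ k * g) (a i) != 0 /\ va (f + x ^+ k * g) i < va f i.
  move=> xi; have lt_i : va g i < va f i.
    rewrite -subr_lt0 -/(F i); apply: le_lt_trans Fj0.
    have : b%:R * (F i - F j) = 0 by rewrite -vx.
    by move/eqP; rewrite mulf_eq0 pnatr_eq0 eqn0Ngt b0 subr_eq0 /= => /eqP ->.
  have [||n0 vn] := @vD_lt _ v (ev x (a i) ^+ k * ev g (a i)) (ev f (a i)).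
  - by rewrite mulf_neq0 ?expf_neq0 ?a_trans.
  - by right; rewrite vxg xi mulr0 add0r.
  by rewrite /va evE addrC vn vxg xi mulr0 add0r.
have xj : va x j = 0 by rewrite vx subrr mulr0.
have [nj ltj] := step j xj.
exists (f + x ^+ k * g); split.
- rewrite -[_ * g]opprK; apply: (IB) => //; rewrite -sub0r; apply: IB => //.
  by apply: IM => //; apply: RX.
- by apply: contraNneq nj => ->; rewrite ev0.
rewrite (bigD1 j) //= [ltRHS](bigD1 j) //=.
apply: ltr_leD; first by rewrite ltr_pM2l // ltr0n.
apply: ler_sum => i _; rewrite ler_pM2l ?ltr0n //.
have [xi|xi] := eqVneq (va x i) 0; first by rewrite ltW // (step i xi).2.
have xi0 : 0 < va x i by rewrite lt_def xi vx0.
have [||n0 vn] := @vD_lt _ v (ev f (a i)) (ev x (a i) ^+ k * ev g (a i)).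
- exact: a_trans.
- right; rewrite vxg; have := hk i; rewrite ler_pdivrMr // => hki.
  have := R_va i (IR _ Ig) g0; rewrite /va in hki *; lra.
by rewrite {1}/va evE vn.
Qed.

(** An [f] of least total value has least value at every point, since otherwise it could be
    improved. With g = q u, the identity g = f (g h) + q u (1 - f h) has coefficients in [R]: g h
    because [h] has the values opposite to those of [f], and u (1 - f h) because 1 - f h has larger
    value than [q] everywhere. *)
Lemma points_noetherian : noetherian R.
Proof.
move=> I idI; have [IR I0 IB IM] := idI.
case: (EM (exists f, I f /\ f != 0)) => [I_neq0|h]; last first.
  exists [::]; split=> // x Ix; exists [::]; split=> //.
  rewrite big_ord0; apply: contrapT => /eqP x0; apply: h; by exists x.
have [q [Iq q0 _ qgen]] := min_degree_generator idI I_neq0.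
have [|m [f [If f0 fm]] hmin] := @classical_min (fun m => exists f,
    [/\ I f, f != 0 & \sum_i e%:R * va f i = m%:R]).
  have [f [If f0]] := I_neq0; have [m hm] := total_value (IR _ If) f0.
  by exists m, f.
have fle g i : I g -> g != 0 -> va f i <= va g i.
  move=> Ig g0; rewrite leNgt; apply/negP => lt_gf.
  have [f' [If' f'0 lt']] := improve_total_value idI If Ig f0 g0 lt_gf.
  have [m' hm'] := total_value (IR _ If') f'0.
  have : (m <= m')%N by apply: hmin; exists f'.
  by rewrite -(ler_nat rat) -hm' -fm leNgt lt'.
exists [:: f; q]; split=> [x|g Ig]; first by rewrite !inE => /orP [] /eqP ->.
have [N hN] := nat_upper_boundf (fun i => va q i).
(* [N] alone balances [q]; the extra 1 keeps the value of 1 - f h positive even for N = 0, which is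
   what makes the values of [h] opposite to those of [f]. *)
have [h hh] := approx_inverse N.+1%:R f0.
have hv i : h != 0 /\ va h i = - va f i.
  by apply: approx_inverse_value => //; apply: vge_gt (hh i); rewrite ltr0n.
have [u gE] := qgen g Ig.
exists [:: g * h; u * (1 - f * h)]; split=> //; last first.
  by rewrite !big_ord_recl big_ord0 /= [in LHS]gE [in RHS]gE; ring.
have [g0|g0] := eqVneq g 0.
  have -> : u = 0.
    by move/eqP: gE; rewrite g0 eq_sym mulf_eq0 (negPf q0) => /eqP.
  by move=> r; rewrite g0 !mul0r !inE orbb => /eqP ->.
have u0 : u != 0 by apply: contraNneq g0 => u0; rewrite gE u0 mulr0.
move=> r; rewrite !inE => /orP [] /eqP ->; apply/RE' => i; rewrite evM.
  have [h0 hi] := hv i; right; rewrite vM ?a_trans // -/(va g i) -/(va h i) hi.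
  by rewrite subr_ge0 fle.
apply: vge_le (vgeM (vge_refl v _) (hh i)).
have := fle g i Ig g0; have := R_va i (IR _ Ig) g0; have := hN i.
rewrite gE vaM // /va -natr1; lra.
Qed.

End Dedekind.

(** If [w x] were negative, dividing the monic equation by the power of [x] one below its degree
    would express [x] through its coefficients and powers of 1/x, all of them integral. *)
Lemma valuation_integral (F : fieldType) (w : F -> int) (x : F) (P : {poly F}) :
  (forall y z, y != 0 -> z != 0 -> w (y * z) = w y + w z) ->
  (forall y z, y != 0 -> z != 0 -> y + z != 0 -> Num.min (w y) (w z) <= w (y + z)) ->
  P \is monic -> (forall i, P`_i != 0 -> 0 <= w P`_i) -> root P x -> x != 0 -> 0 <= w x.
Proof.
move=> wM wD Pmon VP Px x0; rewrite leNgt; apply/negP => wx.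
pose V y := y != 0 -> 0 <= w y.
have VD y z : V y -> V z -> V (y + z).
  move=> Vy Vz; have [->|y0] := eqVneq y 0; first by rewrite add0r.
  have [->|z0] := eqVneq z 0; first by rewrite addr0.
  by move=> yz; apply: le_trans (wD _ _ y0 z0 yz); rewrite le_min Vy ?Vz.
have VM y z : V y -> V z -> V (y * z).
  move=> Vy Vz; rewrite /V mulf_eq0 negb_or => /andP [y0 z0].
  by rewrite wM // addr_ge0 ?Vy ?Vz.
have w1 : w 1 = 0.
  by have := wM 1 1 (oner_neq0 _) (oner_neq0 _); rewrite mulr1; lia.
have V1 : V 1 by rewrite /V w1.
have VN1 : V (-1).
  by move=> n1; have := wM (-1) (-1) n1 n1; rewrite mulrNN mulr1 w1; lia.
have Vy : V x^-1.
  by move=> x'0; have := wM x x^-1 x0 x'0; rewrite mulfV // w1; lia.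
have VX m : V (x^-1 ^+ m) by elim: m => [|m IH]; rewrite ?expr0 ?exprS //; apply: VM.
suff /(_ x0) : V x by rewrite leNgt wx.
have szP : (1 < size P)%N.
  rewrite ltnNge; apply/negP => /size1_polyC PE; move: Px Pmon.
  rewrite PE /root hornerC monicE lead_coefC => /eqP ->.
  by rewrite eq_sym oner_eq0.
move: Px; rewrite /root horner_coef; case E : (size P) szP => [|[|n]] // _.
rewrite big_ord_recr /=; have -> : P`_n.+1 = 1 by move/monicP: Pmon; rewrite lead_coefE E.
rewrite mul1r addrC addr_eq0 => /eqP h.
have -> : x = -1 * \sum_(j < n.+1) P`_j * x^-1 ^+ (n - j).
  apply: (@mulIf _ (x ^+ n)); first by rewrite expf_neq0.
  rewrite -exprS h mulN1r mulNr mulr_suml; congr (- _); apply: eq_bigr => j _.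
  rewrite -mulrA; congr (_ * _); rewrite exprVn mulrC.
  have -> : x ^+ n = x ^+ j * x ^+ (n - j) by rewrite -exprD subnKC // -ltnS.
  by rewrite mulfK // expf_neq0.
apply: (VM) => //; elim/big_ind : _ => [|y z|j _]; [by rewrite /V eqxx|exact: VD|].
by apply: VM => //; apply: VP.
Qed.

Lemma Krull_integrally_closed R : Krull_domain R -> integrally_closed R.
Proof.
move=> [I [w [hw hR _]]] x [P [Pmon PR Px]]; apply/hR => i x0; have [wM wD] := hw i.
apply: (valuation_integral wM wD Pmon _ Px x0) => j.
by have [r [Rr ->]] := PR j; apply: (hR _).1; exists r.
Qed.

(** * Chevalley extension of a subring *)

Definition subring_pred (F : fieldType) (B : F -> Prop) : Prop :=
  [/\ B 1, forall x y, B x -> B y -> B (x - y) & forall x y, B x -> B y -> B (x * y)].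

Section SubringPred.
Variables (F : fieldType) (B : F -> Prop).
Hypothesis hB : subring_pred B.

Lemma spred1 : B 1. Proof. by case: hB. Qed.
Lemma spredB x y : B x -> B y -> B (x - y). Proof. by case: hB => _ h _; apply: h. Qed.
Lemma spredM x y : B x -> B y -> B (x * y). Proof. by case: hB => _ _; apply. Qed.
Lemma spred0 : B 0. Proof. by rewrite -(subrr 1); apply: spredB; apply: spred1. Qed.
Lemma spredN x : B x -> B (- x).
Proof. by move=> Bx; rewrite -sub0r; apply: spredB => //; apply: spred0. Qed.
Lemma spredD x y : B x -> B y -> B (x + y).
Proof. by move=> Bx By; rewrite -[y]opprK; apply: spredB => //; apply: spredN. Qed.
Lemma spredX x n : B x -> B (x ^+ n).
Proof.
by move=> Bx; elim: n => [|n IH]; rewrite ?expr0 ?exprS; [apply: spred1|apply: spredM].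
Qed.
Lemma spred_sum (I : Type) (l : seq I) (P : pred I) f :
  (forall i, P i -> B (f i)) -> B (\sum_(i <- l | P i) f i).
Proof. by move=> h; elim/big_ind : _ => //; [apply: spred0|apply: spredD]. Qed.
End SubringPred.

Section Chevalley.
Variables (F : fieldType) (A : F -> Prop) (t : F).
Hypotheses (subA : subring_pred A) (At : A t) (t0 : t != 0) (At' : ~ A t^-1).

Let good (B : F -> Prop) := [/\ subring_pred B, forall x, A x -> B x & ~ B t^-1].

Lemma maximal_subring : exists2 B, good B &
  forall B', good B' -> (forall x, B x -> B' x) -> forall x, B' x -> B x.
Proof.
(* Adjoining [A] to every set makes the union of the empty chain admissible in Zorn's lemma as
   well. *)
pose U (X : set F) x := A x \/ X x.
have [|X [gX maxX]] := @Zorn_bigcup F (fun X => good (U X)).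
  move=> Fam hFam tot.
  have two x y : U (\bigcup_(X in Fam) X)%classic x -> U (\bigcup_(X in Fam) X)%classic y ->
      A x /\ A y \/ exists X, [/\ Fam X, U X x & U X y].
    move=> [Ax|[X FX Xx]] [Ay|[Y FY Yy]]; first by left.
    - by right; exists Y; split=> //; [left|right].
    - by right; exists X; split=> //; [right|left].
    - right; have [XY|YX] := tot X Y FX FY.
        by exists Y; split=> //; right=> //; apply: XY.
      by exists X; split=> //; right=> //; apply: YX.
  have up X x : Fam X -> U X x -> U (\bigcup_(X in Fam) X)%classic x.
    by move=> FX [Ax|Xx]; [left|right; exists X].
  split; [split| |].
  - by left; apply: spred1.
  - move=> x y Ux Uy; have [[Ax Ay]|[X [FX Xx Xy]]] := two x y Ux Uy.
      by left; apply: spredB.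
    by apply: (up X) => //; have [sX _ _] := hFam X FX; apply: spredB.
  - move=> x y Ux Uy; have [[Ax Ay]|[X [FX Xx Xy]]] := two x y Ux Uy.
      by left; apply: spredM.
    by apply: (up X) => //; have [sX _ _] := hFam X FX; apply: spredM.
  - by left.
  - by case=> [//|[X FX Xt]]; have [_ _] := hFam X FX; apply; right.
exists (U X) => // B' gB' XB' x B'x; apply: contrapT => nUx.
have [sB' AB' ntB'] := gB'.
have UE : U B' = B' by apply/funext => y; apply/propext; split=> [[/AB'|]|]//; right.
apply: (maxX B'); last by rewrite UE.
split; last by move=> B'X; apply: nUx; right; apply: B'X.
by move=> y Xy; apply: XB'; right.
Qed.

(** In a maximal [B] the elements 1 + t b are units, because inverting them does not produce 1/t. If
    neither [x] nor 1/x were in [B], then 1/t would be a polynomial over [B] in each of them, and of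
    two such relations of least length one could shorten the other. *)
Lemma exists_valuation_ring : exists B : F -> Prop,
  [/\ subring_pred B, forall x, A x -> B x, ~ B t^-1 & forall x, B x \/ B x^-1].
Proof.
have [B [sB AB ntB] maxB] := maximal_subring.
exists B; split=> //.
have Bt : B t by apply: AB.
have t1 b : B b -> 1 + t * b != 0.
  move=> Bb; apply/eqP => h; apply: ntB.
  have -> : t^-1 = - b; last exact: spredN.
  by apply: (mulfI t0); rewrite mulfV // mulrN; apply/eqP; rewrite -addr_eq0 h.
have unit1 b : B b -> B (1 + t * b)^-1.
  move=> Bb; pose B' x := exists u c, [/\ B u, B c & x = u / (1 + t * c)].
  have BB' x : B x -> B' x.
    by move=> Bx; exists x, 0; rewrite mulr0 addr0 divr1; split=> //; apply: spred0.
  have cc c c' : B c -> B c' -> B (c + c' + t * c * c').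
    by move=> *; apply: spredD; rewrite // ?mulrA; [apply: spredD|apply: spredM => //; apply: spredM].
  have ccE c c' : 1 + t * (c + c' + t * c * c') = (1 + t * c) * (1 + t * c') by ring.
  apply: (maxB B') => //; last first.
    by exists 1, b; rewrite div1r; split=> //; apply: spred1.
  split; [split| |].
  - by apply: BB'; apply: spred1.
  - move=> _ _ [u [c [Bu Bc ->]]] [u' [c' [Bu' Bc' ->]]].
    exists (u * (1 + t * c') - u' * (1 + t * c)), (c + c' + t * c * c'); split.
    + by apply: spredB => //; apply: spredM => //; apply: spredD => //; rewrite ?spred1 //;
        [exact: spred1|apply: spredM|exact: spred1|apply: spredM].
    + exact: cc.
    + by rewrite ccE; field; rewrite !t1.
  - move=> _ _ [u [c [Bu Bc ->]]] [u' [c' [Bu' Bc' ->]]].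
    exists (u * u'), (c + c' + t * c * c'); split; [exact: spredM|exact: cc|].
    by rewrite ccE; field; rewrite !t1.
  - by move=> x /AB/BB'.
  - move=> [u [c [Bu Bc h]]]; apply: ntB.
    have -> : t^-1 = u - c; last exact: spredB.
    apply: (mulfI t0); rewrite mulfV // mulrBr.
    have : t * u = 1 + t * c.
      move/(congr1 (fun y => t * y * (1 + t * c))): h.
      by rewrite mulfV // mul1r -[RHS]mulrA divfK ?t1 // => ->.
    by move=> ->; rewrite addrK.
pose Bp (P : {poly F}) := forall i, B P`_i.
have ext x : ~ B x -> exists P, Bp P /\ P.[x] = t^-1.
  move=> nBx; apply: contrapT => nP; apply: nBx.
  apply: (maxB (fun y => exists P, Bp P /\ P.[x] = y)).
  - split; [split| |].
    + by exists 1; rewrite hornerC; split=> // i; rewrite coef1; case: (i == 0%N); [apply: spred1|apply: spred0].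
    + move=> _ _ [P [BP <-]] [Q [BQ <-]]; exists (P - Q); rewrite hornerD hornerN.
      by split=> // i; rewrite coefB; apply: spredB.
    + move=> _ _ [P [BP <-]] [Q [BQ <-]]; exists (P * Q); rewrite hornerM.
      by split=> // i; rewrite coefM; apply: spred_sum => // j _; apply: spredM.
    + move=> y /AB By; exists y%:P; rewrite hornerC; split=> // i.
      by rewrite coefC; case: (i == 0%N) => //; apply: spred0.
    + exact: nP.
  - move=> y By; exists y%:P; rewrite hornerC; split=> // i.
    by rewrite coefC; case: (i == 0%N) => //; apply: spred0.
  - exists 'X; rewrite hornerX; split=> // i; rewrite coefX.
    by case: (i == 1%N); [apply: spred1|apply: spred0].
pose W x n := exists P : {poly F}, [/\ Bp P, P.[x] = t^-1 & size P = n].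
(* In t Q(1/x) = 1 the constant term moves over to form the unit 1 - t Q_0. Multiplied by a power of
   [x], this writes the top power of [x] occurring in [P] through lower ones. *)
have reduce x n m : x != 0 -> W x n -> W x^-1 m -> (m <= n)%N ->
   exists2 n', (n' < n)%N & W x n'.
  move=> x0 [P [BP Px szP]] [Q [BQ Qx szQ]] mn.
  have m0 : (0 < m)%N.
    rewrite lt0n; apply/eqP => m0; move/eqP: szQ Qx; rewrite m0 size_poly_eq0 => /eqP ->.
    by rewrite horner0 => /esym/eqP; rewrite invr_eq0 (negPf t0).
  case: n m mn m0 szP szQ => [|n] [|m] // mn _ szP szQ.
  pose u := (1 - t * Q`_0)^-1.
  have Bu : B u by rewrite /u -mulrN; apply: unit1; apply: spredN.
  have u0 : 1 - t * Q`_0 != 0 by rewrite -mulrN; apply: t1; apply: spredN.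
  have xn : x ^+ n = \sum_(k < m) t * (u * Q`_k.+1) * x ^+ (n - k.+1).
    apply: (mulfI u0); rewrite mulr_sumr mulrBl mul1r.
    have : t * Q.[x^-1] * x ^+ n = x ^+ n by rewrite Qx mulfV // mul1r.
    rewrite horner_coef szQ big_ord_recl /= expr0 mulr1 => {1}<-.
    rewrite mulrDr mulrDl [X in X - _]addrC addrK mulr_sumr mulr_suml.
    apply: eq_bigr => k _; rewrite /bump /= add1n.
    have kn : (k < n)%N by have := ltn_ord k; lia.
    have -> : x ^+ n = x ^+ (k.+1) * x ^+ (n - k.+1) by rewrite -exprD subnKC.
    rewrite /u exprVn; field.
    by rewrite ?u0 ?x0 ?expf_neq0 ?x0.
  pose S : {poly F} := \sum_(k < m) (t * (u * Q`_k.+1)) *: 'X^(n - k.+1).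
  have SE : S.[x] = x ^+ n.
    by rewrite xn horner_sum; apply: eq_bigr => k _; rewrite hornerZ hornerXn.
  have BS : Bp S.
    move=> i; rewrite coef_sum; apply: spred_sum => // k _; rewrite coefZ coefXn.
    apply: spredM => //; last by case: (i == _); [apply: spred1|apply: spred0].
    by apply: spredM => //; apply: spredM.
  have szS : (size S <= n)%N.
    apply: (leq_trans (size_sum _ _ _)); apply/bigmax_leqP => k _.
    apply: (leq_trans (size_scale_leq _ _)); rewrite size_polyXn.
    by have := ltn_ord k; lia.
  pose P0 : {poly F} := \poly_(i < n) P`_i.
  exists (size (P0 + P`_n *: S)).
    rewrite ltnS; apply: (leq_trans (size_polyD _ _)); rewrite geq_max size_poly /=.
    exact: (leq_trans (size_scale_leq _ _)).
  exists (P0 + P`_n *: S); split=> // [i|].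
    rewrite coefD coef_poly coefZ; apply: spredD => //; last exact: spredM.
    by case: ltnP => // _; apply: spred0.
  rewrite hornerD hornerZ SE -Px [RHS]horner_coef szP big_ord_recr /=; congr (_ + _).
  by rewrite horner_poly.
move=> x; case: (EM (B x)) => [|nBx]; [by left|right].
apply: contrapT => nBx'.
have x0 : x != 0 by apply/eqP => x0; apply: nBx; rewrite x0; apply: spred0.
have [n [P [BP Px <-]] hn] : exists2 n, W x n & forall m, W x m -> (n <= m)%N.
  by apply: classical_min; have [P [BP Px]] := ext x nBx; exists (size P), P.
have [m [Q [BQ Qx <-]] hm] : exists2 n, W x^-1 n & forall m, W x^-1 m -> (n <= m)%N.
  by apply: classical_min; have [P' [BP' Px']] := ext _ nBx'; exists (size P'), P'.
have WP : W x (size P) by exists P.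
have WQ : W x^-1 (size Q) by exists Q.
case: (leqP (size Q) (size P)) => [QP|/ltnW PQ].
  by have [k kl /hn] := reduce x _ _ x0 WP WQ QP; rewrite leqNgt kl.
have := reduce x^-1 _ _ _ WQ; rewrite invrK invr_eq0 => /(_ _ x0 WP PQ) [k kl /hm].
by rewrite leqNgt kl.
Qed.

End Chevalley.

(** * Extending a valuation of Q(X) to K(X) *)

Lemma seq_argmin (T : eqType) (f : T -> rat) (l : seq T) : l != [::] ->
  exists2 x, x \in l & forall y, y \in l -> f x <= f y.
Proof.
elim: l => // x [|z l] IH _.
  by exists x => [|y]; rewrite inE // => /eqP ->.
have [//|y yl hy] := IH.
have [xy|yx] := leP (f x) (f y).
  exists x => [|u]; rewrite inE ?eqxx // => /orP [/eqP -> //|/hy].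
  exact: le_trans.
exists y => [|u]; first by rewrite inE yl orbT.
by rewrite inE => /orP [/eqP ->|/hy //]; apply: ltW.
Qed.

Lemma inv_eq_div (F : fieldType) (a b c : F) : c != 0 -> a^-1 = b / c -> a^-1 * c = b.
Proof. by move=> c0 ->; rewrite divfK. Qed.

Section TensorExtension.
Variable C : CpField.
Local Notation K := (cp_field C).
Local Notation v := (cp_val C).
Local Notation p := (cp_prime C).
Local Notation emb := (map_poly (iQ C)).
Variable w : {poly rat} -> int.
Hypothesis wM : forall f g, f != 0 -> g != 0 -> w (f * g) = w f + w g.
Hypothesis wD : forall f g, f != 0 -> g != 0 -> f + g != 0 ->
  Num.min (w f) (w g) <= w (f + g).
Hypothesis w_Zp : forall q, q != 0 -> vge v (iQ C q) 0 -> 0 <= w q%:P.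
Hypothesis w_p : 0 < w (p%:R)%:P.

Implicit Types (f g h : {poly rat}) (r : int) (s : seq (K * {poly rat})).

Definition wge f r := f = 0 \/ r <= w f.

Lemma wgeD f g r : wge f r -> wge g r -> wge (f + g) r.
Proof.
move=> [->|hf]; first by rewrite add0r.
move=> [->|hg]; first by rewrite addr0; right.
have [->|f0] := eqVneq f 0; first by rewrite add0r; right.
have [->|g0] := eqVneq g 0; first by rewrite addr0; right.
have [->|fg0] := eqVneq (f + g) 0; [by left|right].
by apply: le_trans (wD f0 g0 fg0); rewrite le_min hf.
Qed.

Lemma wgeM f g r r' : wge f r -> wge g r' -> wge (f * g) (r + r').
Proof.
move=> [->|hf]; first by left; rewrite mul0r.
move=> [->|hg]; first by left; rewrite mulr0.
have [->|f0] := eqVneq f 0; first by left; rewrite mul0r.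
have [->|g0] := eqVneq g 0; first by left; rewrite mulr0.
by right; rewrite wM // lerD.
Qed.

Lemma wgeZ q f r : vge v (iQ C q) 0 -> wge f r -> wge (q *: f) r.
Proof.
move=> hq hf; rewrite -mul_polyC -[r]add0r; apply: wgeM => //.
by have [->|q0] := eqVneq q 0; [left|right; apply: w_Zp].
Qed.

(** A list of pairs stands for a sum of tensors, with constants from O_K and polynomials of
    [w]-value at least [r]. *)
Definition span_mem s r := forall t, t \in s -> vge v t.1 0 /\ wge t.2 r.
Definition span_val s : {poly K} := \sum_(t <- s) t.1 *: emb t.2.

(* The tensor product of O_K with the valuation ring of w over Z_(p) induces the
   original valuation on Q(X); this is where flatness over Z_(p) enters, in the
   form of an elimination of one generator at a time. *)
Lemma span_val_wge s r g : span_mem s r -> emb g = span_val s -> wge g r.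
Proof.
have [m] := ubnP (size s); elim: m s g => // m IH s g szs hs gE.
have [->|g0] := eqVneq g 0; [by left|right].
rewrite leNgt; apply/negP => wg.
pose k := (size g).-1.
have gk : iQ C g`_k != 0 by rewrite fmorph_eq0 -/(lead_coef g) lead_coef_eq0.
pose c (t : K * {poly rat}) := iQ C (t.2)`_k.
have gkE : iQ C g`_k = \sum_(t <- s) t.1 * c t.
  rewrite -coef_map gE /span_val coef_sum; apply: eq_bigr => t _.
  by rewrite coefZ coef_map.
pose l := [seq t <- s | c t != 0].
have l0 : l != [::].
  apply/eqP => l0; move/eqP: gk; apply; rewrite gkE big_seq big1 // => t ts.
  have : t \notin l by rewrite l0.
  by rewrite mem_filter ts andbT negbK => /eqP ->; rewrite mulr0.
(* The pivot has the least value among the coefficients of X^k, so the quotients [q t] lie in Z_(p).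
   Subtracting these multiples of the pivot stays among rational polynomials of [w]-value at least
   [r] and uses one generator less. *)
have [t0] := seq_argmin (fun t => v (c t)) l0.
rewrite mem_filter => /andP [ct0 t0s] hmin.
have cmin t : t \in s -> vge v (c t / c t0) 0.
  move=> ts; have [->|ct] := eqVneq (c t) 0; first by left; rewrite mul0r.
  by right; rewrite v_div // subr_ge0 hmin // mem_filter ct.
have gmin : vge v (iQ C g`_k / c t0) 0.
  rewrite gkE mulr_suml big_seq; apply: vge_sum => t ts; rewrite -mulrA.
  by apply: vgeM0; [have [] := hs t ts|apply: cmin].
pose q (t : K * {poly rat}) := (t.2)`_k / (t0.2)`_k.
have qE t : iQ C (q t) = c t / c t0 by rewrite fmorph_div.
pose qg := g`_k / (t0.2)`_k.
have qgE : iQ C qg = iQ C g`_k / c t0 by rewrite fmorph_div.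
have [x0 w0] := hs t0 t0s.
pose s' := [seq (t.1, t.2 - q t *: t0.2) | t <- rem t0 s].
have : wge (g - qg *: t0.2) r.
  apply: (IH s').
  - by rewrite size_map size_rem //; move: szs; case: (s) t0s.
  - move=> _ /mapP [t ts ->] /=; have ts' := mem_rem ts; have [h1 h2] := hs t ts'.
    split=> //; rewrite -scaleNr; apply: wgeD => //; apply: wgeZ => //.
    by rewrite rmorphN /= qE; apply: vgeN; apply: cmin.
  - have -> : emb (g - qg *: t0.2) = emb g - iQ C qg *: emb t0.2.
      by rewrite rmorphB /= map_polyZ.
    rewrite /span_val big_map gE /span_val.
    have sumE : iQ C qg = t0.1 + \sum_(t <- rem t0 s) t.1 * iQ C (q t).
      rewrite qgE gkE (big_rem t0) //= mulrDl mulfK // mulr_suml.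
      by congr (_ + _); apply: eq_bigr => t _; rewrite qE mulrA.
    rewrite sumE (big_rem t0) //= scalerDl opprD addrACA subrr add0r scaler_suml -sumrB.
    by apply: eq_bigr => t _; rewrite rmorphB /= map_polyZ scalerBr scalerA.
have hq : wge (qg *: t0.2) r by apply: wgeZ => //; rewrite qgE.
move=> /wgeD/(_ hq); rewrite subrK => -[/eqP|]; first by rewrite (negPf g0).
by rewrite leNgt wg.
Qed.

Local Notation F := {fraction {poly K}}.
Local Notation iota := (@FracField.tofrac {poly K}).

Lemma iota_neq0 P : P != 0 -> iota P != 0.
Proof. by rewrite tofrac_eq0. Qed.

(** The image in K(X) of the tensor product over Z_(p) of O_K and the valuation ring of [w], written
    over a common rational denominator [g]. *)
Let A (x : F) := exists s g, [/\ g != 0, span_mem s (w g) & x = iota (span_val s) / iota (emb g)].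

Lemma span_val1 c f : span_val [:: (c, f)] = c *: emb f.
Proof. by rewrite /span_val big_seq1. Qed.

Lemma emb_neq0 f : f != 0 -> emb f != 0. Proof. exact: map_iQ_neq0. Qed.

Lemma tensor_subring : subring_pred A.
Proof.
split.
- exists [:: (1, 1)], 1; split; first exact: oner_neq0.
    by move=> t; rewrite inE => /eqP -> /=; split; [exact: vge1|right].
  by rewrite span_val1 scale1r divff // iota_neq0 // emb_neq0 // oner_neq0.
- move=> _ _ [s1 [g1 [g10 h1 ->]]] [s2 [g2 [g20 h2 ->]]].
  exists ([seq (t.1, t.2 * g2) | t <- s1] ++ [seq (- t.1, t.2 * g1) | t <- s2]), (g1 * g2).
  split; first by rewrite mulf_neq0.
    move=> t; rewrite mem_cat wM // => /orP [] /mapP [u us ->] /=.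
      by have [] := h1 u us; split=> //; apply: wgeM => //; right.
    have [] := h2 u us; split; first exact: vgeN.
    by rewrite addrC; apply: wgeM => //; right.
  have -> : span_val ([seq (t.1, t.2 * g2) | t <- s1] ++ [seq (- t.1, t.2 * g1) | t <- s2])
      = span_val s1 * emb g2 - span_val s2 * emb g1.
    rewrite /span_val big_cat !big_map /= !mulr_suml -sumrN; congr (_ + _).
      by apply: eq_bigr => t _; rewrite rmorphM scalerAl.
    by apply: eq_bigr => t _; rewrite rmorphM /= scaleNr scalerAl.
  have n1 := iota_neq0 (emb_neq0 g10); have n2 := iota_neq0 (emb_neq0 g20).
  have -> : emb (g1 * g2) = emb g1 * emb g2 by rewrite rmorphM.
  by rewrite tofracB !tofracM -mulNr (addf_div _ _ n1 n2) mulNr.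
- move=> _ _ [s1 [g1 [g10 h1 ->]]] [s2 [g2 [g20 h2 ->]]].
  exists [seq (t.1 * u.1, t.2 * u.2) | t <- s1, u <- s2], (g1 * g2).
  split; first by rewrite mulf_neq0.
    move=> _ /allpairsP [[t u] [ts us ->]] /=.
    have [x1 w1] := h1 t ts; have [x2 w2] := h2 u us.
    by split; [apply: vgeM0|rewrite wM //; apply: wgeM].
  have -> : span_val [seq (t.1 * u.1, t.2 * u.2) | t <- s1, u <- s2]
      = span_val s1 * span_val s2.
    rewrite /span_val big_allpairs_dep mulr_suml; apply: eq_bigr => t _.
    rewrite mulr_sumr; apply: eq_bigr => u _ /=.
    by rewrite rmorphM -scalerAl -scalerAr scalerA.
  have -> : emb (g1 * g2) = emb g1 * emb g2 by rewrite rmorphM.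
  by rewrite !tofracM mulf_div.
Qed.

(** Chevalley's theorem for [A] and t = p. If 1/p were in [A], some g/p would be spanned by
    polynomials of value at least [w g], hence have such a value itself, against w(p) > 0. *)
Lemma valuation_extension : exists B : F -> Prop,
  [/\ subring_pred B, forall x, B x \/ B x^-1,
      forall c, vge v c 0 -> B (iota c%:P), ~ B (iota (p%:R)%:P)^-1
    & forall f g, f != 0 -> g != 0 -> w g <= w f -> B (iota (emb f) / iota (emb g))].
Proof.
have AO c : vge v c 0 -> A (iota c%:P).
  move=> hc; exists [:: (c, 1)], 1; split; first exact: oner_neq0.
    by move=> t; rewrite inE => /eqP -> /=; split=> //; right.
  by rewrite span_val1 rmorph1 alg_polyC rmorph1 divr1.
have p0 : iota (p%:R)%:P != 0 by rewrite iota_neq0 // polyC_eq0 p_neq0.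
have [| |B [sB AB nB VB]] := exists_valuation_ring tensor_subring _ p0.
- by apply: AO; apply: vge_nat.
- move=> [s [g [g0 hs E]]].
  have g'0 : (p%:R)^-1 *: g != 0 by rewrite scaler_eq0 invr_eq0 negb_or pQ_neq0.
  have := @span_val_wge s (w g) ((p%:R)^-1 *: g) hs.
  rewrite map_polyZ => h.
  have [||] := h.
  + apply/eqP; rewrite -tofrac_eq; apply/eqP.
    rewrite -mul_polyC tofracM fmorphV rmorph_nat.
    have -> : iota ((p%:R)^-1)%:P = (iota (p%:R)%:P)^-1.
      apply: (mulfI p0); rewrite mulfV // -tofracM -polyCM mulfV ?p_neq0 //.
    exact: (inv_eq_div (iota_neq0 (emb_neq0 g0)) E).
  + by move/eqP; rewrite (negPf g'0).
  + rewrite leNgt => /negP; apply.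
    have {2}-> : g = (p%:R)%:P * ((p%:R)^-1 *: g).
      by rewrite mul_polyC scalerA mulfV ?pQ_neq0 // scale1r.
    by rewrite wM ?polyC_eq0 ?pQ_neq0 // ltrDr.
exists B; split=> // [c /AO/AB //|f g f0 g0 wfg]; apply: AB.
exists [:: (1, f)], g; split=> //; last by rewrite span_val1 scale1r.
by move=> t; rewrite inE => /eqP -> /=; split; [exact: vge1|right].
Qed.

End TensorExtension.

(** * Describing the extension by a point or a ball *)

Section ValuationRing.
Variable C : CpField.
Local Notation K := (cp_field C).
Local Notation v := (cp_val C).
Local Notation p := (cp_prime C).
Variables (F : fieldType) (j : {rmorphism K -> F}) (B : F -> Prop).
Hypothesis sB : subring_pred B.
Hypothesis VB : forall x, B x \/ B x^-1.
Hypothesis BO : forall c, vge v c 0 -> B (j c).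
Hypothesis nBp : ~ B (j p%:R)^-1.
Implicit Types (x y z : F) (c : K) (r s : rat).

Let B1 := spred1 sB.
Let B0 := spred0 sB.
Let BD := spredD sB.
Let BB := spredB sB.
Let BM := spredM sB.
Let BN := spredN sB.
Let BX := spredX sB.

Lemma j_neq0 c : c != 0 -> j c != 0. Proof. by rewrite fmorph_eq0. Qed.

(** [v] has rank one: if [B] contained a constant of negative value, 1/p would be an element of O_K
    times one of its powers. *)
Lemma BjE c : c != 0 -> B (j c) <-> 0 <= v c.
Proof.
move=> c0; split=> [Bc|h]; last by apply: BO; right.
rewrite leNgt; apply/negP => neg.
have [n /(_ _ (mem_head _ _)) hn] := nat_upper_bound [:: (- v c)^-1].
apply: nBp; have -> : (j p%:R)^-1 = j c ^+ n * j (c ^- n / p%:R).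
  rewrite -rmorphXn -rmorphM mulrA mulfV ?expf_neq0 // mul1r fmorphV //.
apply: BM; first exact: BX.
apply: BO; right; rewrite v_div ?invr_eq0 ?expf_neq0 ?p_neq0 // vV ?expf_neq0 //.
rewrite vX // v_p; move: hn; rewrite -div1r ler_pdivrMr ?oppr_gt0 // mulrN; lra.
Qed.

(** * The maximal ideal of [B] and values relative to constants *)

Definition maxB x := x = 0 \/ ~ B x^-1.

Lemma maxB_B x : maxB x -> B x.
Proof. by case=> [->|h] //; case: (VB x). Qed.

Lemma B_or_maxB x : B x \/ maxB x^-1.
Proof. by case: (EM (B x)) => h; [left|right; right; rewrite invrK]. Qed.

Lemma maxBM x y : B x -> maxB y -> maxB (x * y).
Proof.
have [->|x0] := eqVneq x 0; first by left; rewrite mul0r.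
have [->|y0] := eqVneq y 0; first by left; rewrite mulr0.
move=> Bx [/eqP|nBy]; [by rewrite (negPf y0)|right=> h; apply: nBy].
have -> : y^-1 = x * (x * y)^-1 by rewrite invfM mulrA mulfV // mul1r.
exact: BM.
Qed.

Lemma maxBMr x y : maxB x -> B y -> maxB (x * y).
Proof. by move=> hx hy; rewrite mulrC; apply: maxBM. Qed.

Lemma maxBN x : maxB x -> maxB (- x).
Proof. by move=> h; rewrite -mulN1r; apply: maxBM => //; apply: BN. Qed.

Lemma not_maxB1 : ~ maxB 1.
Proof. by case=> [/eqP|]; rewrite ?oner_eq0 ?invr1 //; apply. Qed.

Lemma maxBD x y : maxB x -> maxB y -> maxB (x + y).
Proof.
have H a b : maxB a -> maxB b -> B (a / b) -> maxB (a + b).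
  move=> ha hb hab; have [b0|b0] := eqVneq b 0; first by rewrite b0 addr0.
  have -> : a + b = (a / b + 1) * b by field.
  by apply: maxBM => //; apply: BD.
move=> hx hy; case: (VB (x / y)) => h; first exact: H.
by rewrite addrC; apply: H => //; rewrite -invf_div.
Qed.

Lemma maxBB x y : maxB x -> maxB y -> maxB (x - y).
Proof. by move=> hx /maxBN; apply: maxBD. Qed.

Lemma one_maxB x : maxB x -> 1 + x != 0 /\ B (1 + x)^-1.
Proof.
move=> hx; have h0 : 1 + x != 0.
  apply/eqP => h; apply: not_maxB1; have -> : 1 = - x by apply/eqP; rewrite -addr_eq0 h.
  exact: maxBN.
split=> //; case: (B_or_maxB (1 + x)^-1) => //; rewrite invrK => h; exfalso.
by apply: not_maxB1; rewrite -(addrK x 1); apply: maxBB.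
Qed.

Lemma B_expr x n : (0 < n)%N -> B (x ^+ n) -> B x.
Proof.
move=> n0 h; have [->|x0] := eqVneq x 0; first exact: B0.
case: (VB x) => // h'; have -> : x = x ^+ n * x^-1 ^+ n.-1.
  by case: n n0 {h} => // n _; rewrite exprS exprVn mulfK ?expf_neq0.
by apply: BM => //; apply: BX.
Qed.

(* B may have rank greater than one, so values of elements of F are expressed by
   comparison with constants of K. *)
Definition usim x y := B (x / y) /\ B (y / x).

Definition hasval x r := x != 0 /\ exists c, [/\ c != 0, v c = r & usim x (j c)].

Lemma usimM x x' y y' : usim x y -> usim x' y' -> usim (x * x') (y * y').
Proof.
by move=> [h1 h2] [h3 h4]; split; rewrite -mulf_div; apply: BM.
Qed.

Lemma usim_sym x y : usim x y -> usim y x. Proof. by case. Qed.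

Lemma usim_trans y x z : y != 0 -> usim x y -> usim y z -> usim x z.
Proof.
move=> y0 [h1 h2] [h3 h4]; split.
  by have := BM h1 h3; rewrite mulrA divfK.
by have := BM h4 h2; rewrite mulrA divfK.
Qed.

Lemma usim_refl x : x != 0 -> usim x x.
Proof. by move=> x0; split; rewrite divff. Qed.

Lemma usim_hasval x y r : x != 0 -> usim x y -> hasval y r -> hasval x r.
Proof.
move=> x0 xy [y0 [c [c0 vc yc]]]; split=> //; exists c; split=> //.
exact: usim_trans yc.
Qed.

Lemma hasval_neq0 x r : hasval x r -> x != 0. Proof. by case. Qed.

Lemma hasval_j c : c != 0 -> hasval (j c) (v c).
Proof. by move=> c0; split; [exact: j_neq0|exists c; split=> //; apply/usim_refl/j_neq0]. Qed.

Lemma hasvalM x y r s : hasval x r -> hasval y s -> hasval (x * y) (r + s).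
Proof.
move=> [x0 [c [c0 <- h]]] [y0 [c' [c'0 <- h']]]; split; first by rewrite mulf_neq0.
by exists (c * c'); rewrite mulf_neq0 // vM // rmorphM; split=> //; apply: usimM.
Qed.

Lemma hasvalV x r : hasval x r -> hasval x^-1 (- r).
Proof.
move=> [x0 [c [c0 <- [h1 h2]]]]; split; first by rewrite invr_eq0.
exists c^-1; rewrite invr_eq0 c0 vV // fmorphV; split=> //.
by split; rewrite invrK mulrC.
Qed.

Lemma hasval_div x y r s : hasval x r -> hasval y s -> hasval (x / y) (r - s).
Proof. by move=> hx /hasvalV; apply: hasvalM. Qed.

Lemma hasval1 : hasval 1 0.
Proof. by have := hasval_j (oner_neq0 K); rewrite v1 rmorph1. Qed.

Lemma hasvalX x r n : hasval x r -> hasval (x ^+ n) (n%:R * r).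
Proof.
move=> h; elim: n => [|n IH]; first by rewrite mul0r expr0; apply: hasval1.
by rewrite exprS -nat1r mulrDl mul1r; apply: hasvalM.
Qed.

Lemma hasval_B x r : hasval x r -> B x <-> 0 <= r.
Proof.
move=> [x0 [c [c0 <- [h1 h2]]]]; rewrite -BjE //; split=> h.
  by have := BM h2 h; rewrite divfK.
by have := BM h1 h; rewrite divfK ?j_neq0.
Qed.

Lemma hasval_maxB x r : hasval x r -> maxB x <-> 0 < r.
Proof.
move=> h; rewrite /maxB; have := hasval_B (hasvalV h); have x0 := hasval_neq0 h.
rewrite oppr_ge0 => H; split=> [[/eqP|nB]|r0]; first by rewrite (negPf x0).
  by rewrite ltNge; apply/negP => /H.
by right=> /H; rewrite leNgt r0.
Qed.

Lemma hasval_inj x r s : hasval x r -> hasval x s -> r = s.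
Proof.
move=> hr hs; have x0 := hasval_neq0 hr.
have H a b : hasval x a -> hasval x b -> b <= a.
  move=> ha hb; rewrite -subr_ge0; apply/(hasval_B (hasval_div ha hb)).
  by rewrite divff.
by apply/eqP; rewrite eq_le !H.
Qed.

Lemma hasvalD x y r : hasval x r -> maxB (y / x) -> hasval (x + y) r.
Proof.
move=> h hy; have x0 := hasval_neq0 h; have [n0 h1] := one_maxB hy.
have E : x + y = (1 + y / x) * x by field.
have xy0 : x + y != 0 by rewrite E mulf_neq0.
apply: (usim_hasval xy0 _ h); rewrite /usim E; split.
  by rewrite mulfK //; apply: BD => //; apply: maxB_B.
by rewrite invfM mulrCA divff // mulr1.
Qed.

Lemma hasval_root x r n : x != 0 -> (0 < n)%N -> hasval (x ^+ n) (n%:R * r) -> hasval x r.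
Proof.
move=> x0 n0 h; have [c c0 vc] := rat_value C r; split=> //; exists c; split=> //.
have hc := hasvalX n (hasval_j c0); rewrite vc in hc.
split; apply: (B_expr n0); rewrite expr_div_n.
  by apply/(hasval_B (hasval_div h hc)); rewrite subrr.
by apply/(hasval_B (hasval_div hc h)); rewrite subrr.
Qed.

Lemma hasval_ext x r s : hasval x r -> r = s -> hasval x s. Proof. by move=> h <-. Qed.

(** Divisibility in [B] by a constant of value [r]. Unlike [hasval], this also applies to 0 and to
    elements comparable to no constant. *)
Definition bge x r := exists c, [/\ c != 0, v c = r & B (x / j c)].

Lemma bgeP x c r : c != 0 -> v c = r -> bge x r <-> B (x / j c).
Proof.
move=> c0 vc; split=> [[c' [c'0 vc' h]]|h]; last by exists c.
have -> : x / j c = (x / j c') * j (c' / c).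
  by rewrite fmorph_div mulrA divfK // j_neq0.
by apply: BM => //; apply: BO; right; rewrite v_div // vc vc' subrr.
Qed.

Lemma bge0 r : bge 0 r.
Proof. by have [c c0 vc] := rat_value C r; exists c; rewrite mul0r. Qed.

Lemma bgeD x y r : bge x r -> bge y r -> bge (x + y) r.
Proof.
move=> [c [c0 vc h]] /(bgeP _ c0 vc) h'; exists c; split=> //.
by rewrite mulrDl; apply: BD.
Qed.

Lemma bgeN x r : bge x r -> bge (- x) r.
Proof. by move=> [c [c0 vc h]]; exists c; split=> //; rewrite mulNr; apply: BN. Qed.

Lemma bgeB x y r : bge x r -> bge y r -> bge (x - y) r.
Proof. by move=> hx /bgeN; apply: bgeD. Qed.

Lemma bgeM x y r s : bge x r -> bge y s -> bge (x * y) (r + s).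
Proof.
move=> [c [c0 <- h]] [c' [c'0 <- h']]; exists (c * c'); rewrite mulf_neq0 // vM //.
by split=> //; rewrite rmorphM invfM mulrACA; apply: BM.
Qed.

Lemma bge_B x : bge x 0 <-> B x.
Proof. by rewrite (bgeP x (oner_neq0 K) (v1 v)) rmorph1 divr1. Qed.

Lemma bgeM0 x y r : B x -> bge y r -> bge (x * y) r.
Proof. by move=> /bge_B hx hy; have := bgeM hx hy; rewrite add0r. Qed.

Lemma bgeMr0 x y r : bge x r -> B y -> bge (x * y) r.
Proof. by move=> hx hy; rewrite mulrC; apply: bgeM0. Qed.

Lemma bge_j c r : vge v c r -> bge (j c) r.
Proof.
move=> h; have [c' c'0 vc'] := rat_value C r; exists c'; split=> //.
have [->|c0] := eqVneq c 0; first by rewrite rmorph0 mul0r.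
by rewrite -fmorph_div; apply: BO; right; rewrite v_div // vc' subr_ge0 -(vgeE v).
Qed.

Lemma j_bge c r : bge (j c) r -> vge v c r.
Proof.
have [->|c0] := eqVneq c 0; first by left.
move=> [c' [c'0 vc']]; rewrite -fmorph_div BjE ?mulf_neq0 ?invr_eq0 //.
by rewrite v_div // vc' subr_ge0; right.
Qed.

Lemma bge_le x r s : s <= r -> bge x r -> bge x s.
Proof.
move=> sr [c' [c'0 vc' h]]; have [d d0 vd] := rat_value C s; exists d; split=> //.
have -> : x / j d = (x / j c') * j (c' / d).
  by rewrite fmorph_div mulrA divfK // j_neq0.
by apply: BM => //; apply: BO; right; rewrite v_div // vd vc' subr_ge0.
Qed.

Lemma bge_maxB x r : 0 < r -> bge x r -> maxB x.
Proof.
move=> r0 [c [c0 vc h]]; have -> : x = (x / j c) * j c by rewrite divfK ?j_neq0.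
by apply: maxBM => //; apply/(hasval_maxB (hasval_j c0)); rewrite vc.
Qed.

Lemma hasval_bge x r s : hasval x r -> bge x s <-> s <= r.
Proof.
move=> h; have [c c0 vc] := rat_value C s; rewrite (bgeP x c0 vc).
by rewrite (hasval_B (hasval_div h (hasval_j c0))) vc subr_ge0.
Qed.

Lemma bge_sum (I : Type) (l : seq I) (P : pred I) f r :
  (forall i, P i -> bge (f i) r) -> bge (\sum_(i <- l | P i) f i) r.
Proof. by move=> h; elim/big_ind : _ => //; [exact: bge0|move=> x y; apply: bgeD]. Qed.

Lemma not_bge x c r : c != 0 -> v c = r -> ~ bge x r -> maxB (j c / x).
Proof.
move=> c0 vc; rewrite (bgeP x c0 vc) => h; case: (B_or_maxB (x / j c)) => //.
by rewrite invf_div.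
Qed.

Lemma horner_map_roots (P : {poly K}) x :
  (map_poly j P).[x] = j (lead_coef P) * \prod_(g <- roots_of P) (x - j g).
Proof.
rewrite {1}(roots_ofE P) map_polyZ hornerZ rmorph_prod horner_prod; congr (_ * _).
by apply: eq_bigr => g _; rewrite rmorphB /= map_polyX map_polyC /= !hornerE.
Qed.

Lemma hasval_map_poly (P : {poly K}) x (m : K -> rat) : P != 0 ->
  (forall g, g \in roots_of P -> hasval (x - j g) (m g)) ->
  hasval (map_poly j P).[x] (v (lead_coef P) + \sum_(g <- roots_of P) m g).
Proof.
move=> P0 h; rewrite horner_map_roots; apply: hasvalM.
  by apply: hasval_j; rewrite lead_coef_eq0.
elim: (roots_of P) h => [|g s IH] h; first by rewrite !big_nil; apply: hasval1.
rewrite !big_cons; apply: hasvalM; first by apply: h; rewrite mem_head.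
by apply: IH => g' gs; apply: h; rewrite inE gs orbT.
Qed.

Lemma bge_horner (P : {poly K}) x : B x -> exists r, bge (map_poly j P).[x] r.
Proof.
move=> Bx; have [k hk] := nat_upper_bound [seq - v c | c <- P : seq K].
exists (- k%:R); rewrite horner_coef; apply: bge_sum => i _.
rewrite coef_map; apply: bgeMr0; last exact: BX.
apply: bge_j; have [sz|sz] := leqP (size P) i; first by rewrite nth_default //; left.
by right; rewrite lerNl; apply: hk; apply: (map_f (fun c => - v c)); apply: mem_nth.
Qed.

(** * The image [xi] of X and the valuation [w] on rational polynomials *)

Variable xi : F.
Hypothesis eval_neq0 : forall P : {poly K}, P != 0 -> (map_poly j P).[xi] != 0.
Variable w : {poly rat} -> int.
Hypothesis wM : forall f g, f != 0 -> g != 0 -> w (f * g) = w f + w g.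
Hypothesis w_p : 0 < w (p%:R)%:P.
Hypothesis w_X : 0 <= w 'X.
Local Notation emb := (map_poly (iQ C)).
Local Notation E f := ((map_poly j (emb f)).[xi]).
Hypothesis hw : forall f g, f != 0 -> g != 0 -> w g <= w f -> B (E f / E g).
Local Notation e := (absz (w (p%:R)%:P)).
Local Notation wv f := ((w f)%:~R / e%:R : rat).
Implicit Types (f g h : {poly rat}).

Let e_gt0 : (0 < e)%N. Proof. by rewrite absz_gt0 gt_eqF. Qed.
Let eQ_gt0 : 0 < e%:R :> rat. Proof. by rewrite ltr0n. Qed.
Let eQ_neq0 : e%:R != 0 :> rat. Proof. by rewrite gt_eqF. Qed.

Lemma E_mul f g : E (f * g) = E f * E g.
Proof. by rewrite !rmorphM hornerM. Qed.
Lemma E_sub f g : E (f - g) = E f - E g.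
Proof. by rewrite !rmorphB hornerD hornerN. Qed.
Lemma E_X f n : E (f ^+ n) = E f ^+ n.
Proof. by rewrite !rmorphXn horner_exp. Qed.
Lemma E_C q : E q%:P = j (iQ C q).
Proof. by rewrite !map_polyC hornerC. Qed.
Lemma E_1 : E 1 = 1.
Proof. by rewrite !rmorph1 hornerC. Qed.
Lemma E_var : E 'X = xi.
Proof. by rewrite !map_polyX hornerX. Qed.
Lemma E_neq0 f : f != 0 -> E f != 0.
Proof. by move=> f0; rewrite eval_neq0 // map_iQ_neq0. Qed.

Lemma w_one : w 1 = 0.
Proof.
have := wM (oner_neq0 _) (oner_neq0 _); rewrite mulr1 => /eqP.
by rewrite -subr_eq0 opprD addNKr oppr_eq0 => /eqP.
Qed.

Lemma w_exp f n : f != 0 -> w (f ^+ n) = w f * n%:Z.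
Proof.
move=> f0; elim: n => [|n IH]; first by rewrite expr0 w_one mulr0.
by rewrite exprS wM ?expf_neq0 // IH; lia.
Qed.

Lemma w_scalar (z : int) : w (p%:R ^ z)%:P = w (p%:R)%:P * z.
Proof.
have pk k : w (p%:R ^+ k)%:P = w (p%:R)%:P * k%:Z.
  by rewrite polyC_exp w_exp // polyC_eq0 pQ_neq0.
case: z => k; first exact: pk.
have := @wM (p%:R ^ Negz k)%:P (p%:R ^+ k.+1)%:P.
rewrite -[p%:R ^ Negz k]/(p%:R ^- k.+1) !polyC_eq0 invr_eq0 pQX_neq0 => /(_ isT isT).
rewrite -polyCM mulVf ?pQX_neq0 // w_one pk NegzE; lia.
Qed.

(** As e = w(p), the product of f^e and p^(- w f) has [w]-value 0 and is a unit of [B]; an e-th root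
    then gives the value of [f]. *)
Lemma hasval_E f : f != 0 -> hasval (E f) (wv f).
Proof.
move=> f0; have [q0 vq] := v_iQ_pz C (- w f); set q := _ ^ _ in q0 vq.
have h0 : q%:P * f ^+ e != 0 by rewrite mulf_neq0 ?polyC_eq0 ?expf_neq0.
have wh : w (q%:P * f ^+ e) = 0.
  rewrite wM ?polyC_eq0 ?expf_neq0 // w_scalar w_exp // gtz0_abs //; lia.
have hv0 : hasval (E (q%:P * f ^+ e)) 0.
  split; first exact: E_neq0.
  exists 1; rewrite oner_neq0 v1; split=> //; rewrite rmorph1 -E_1.
  by split; apply: hw; rewrite ?wh ?w_one // oner_neq0.
apply: (@hasval_root _ _ e) => //; first exact: E_neq0.
have iq0 : iQ C q != 0 by rewrite fmorph_eq0.
have -> : E f ^+ e = E (q%:P * f ^+ e) / j (iQ C q).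
  by rewrite E_mul E_C E_X mulrC mulKf // j_neq0.
apply: hasval_ext (hasval_div hv0 (hasval_j iq0)) _.
by rewrite vq intrN sub0r opprK mulrC divfK.
Qed.

Lemma wv_ge0 f : (0 <= wv f) = (0 <= w f).
Proof. by rewrite pmulr_lge0 ?invr_gt0 // ler0z. Qed.

Lemma B_xi : B xi.
Proof.
by rewrite -E_var; apply/(hasval_B (hasval_E (negbT (polyX_eq0 _)))); rewrite wv_ge0.
Qed.

Lemma xi_sub_neq0 b : xi - j b != 0.
Proof.
have := @eval_neq0 ('X - b%:P); rewrite polyXsubC_eq0 => /(_ isT).
by rewrite rmorphB /= map_polyX map_polyC /= !hornerE.
Qed.

Definition realizes a D := valid_pair v a D /\
  forall f, f != 0 -> in_Zpad v a D f <-> 0 <= w f.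

Lemma denominator_of_values a :
  (forall f, ev f a != 0 -> exists2 g, g != 0 & v (ev f a) = wv g) ->
  finite_ramification v a.
Proof.
move=> h; apply: (@ev_finite_ramification C a e) => // f f0.
have [g g0 ->] := h f f0; exists (w g).
by rewrite mulrC divfK.
Qed.

(** For [b] other than [a], xi - b has the value of the constant a - b. A nonzero rational f with
    f(a) = 0 would be divisible by X - a and exceed every bound, whereas [w f] is finite; this makes
    [a] transcendental. The values at [a] then lie in (1/e)Z, which bounds the ramification. *)
Lemma realizes_point a : (forall N : nat, bge (xi - j a) N%:R) -> realizes a None.
Proof.
move=> ha.
have aO : vge v a 0.
  apply: j_bge; have -> : j a = xi - (xi - j a) by ring.
  by apply: bgeB; [apply/bge_B/B_xi|apply: (ha 0)].
have val_b b : b != a -> hasval (xi - j b) (v (a - b)).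
  move=> ba; have ab0 : a - b != 0 by rewrite subr_eq0 eq_sym.
  have -> : xi - j b = j (a - b) + (xi - j a) by rewrite rmorphB; ring.
  apply: hasvalD; first exact: hasval_j.
  have [N /(_ _ (mem_head _ _)) hN] := nat_upper_bound [:: v (a - b) + 1].
  have hab := hasvalV (hasval_j ab0).
  have h1 : bge (j (a - b))^-1 (- v (a - b)) by apply/(hasval_bge _ hab).
  apply: (@bge_maxB _ (N%:R - v (a - b))); last exact: bgeM.
  by lra.
have tr f : f != 0 -> ev f a != 0.
  move=> f0; apply/negP => /factor_theorem [g gE].
  have [r hr] := bge_horner g B_xi.
  have [N /(_ _ (mem_head _ _)) hN] := nat_upper_bound [:: wv f - r + 1].
  have : bge (E f) (r + N%:R).
    rewrite gE rmorphM hornerM; apply: bgeM => //.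
    by rewrite rmorphB /= map_polyX map_polyC /= !hornerE.
  by move/(hasval_bge _ (hasval_E f0)); lra.
have val_f f : f != 0 -> hasval (E f) (v (ev f a)).
  move=> f0; have F0 := map_iQ_neq0 C f0; have fa := tr f f0.
  apply: hasval_ext (@hasval_map_poly _ _ (fun b => v (a - b)) F0 _) _.
    move=> b; rewrite mem_roots_of // => rb; apply: val_b.
    by apply: contraTneq rb => ->.
  have [k hk] := nat_upper_bound [seq v (a - b) | b <- roots_of (emb f)].
  have /(gval_generic F0) [] : forall b, b \in roots_of (emb f) ->
      a != b /\ v (a - b) = mval (a - b) k%:R.
    move=> b br; have ab : a != b.
      by apply: contraNneq fa => ->; rewrite mem_roots_of // in br.
    split=> //; rewrite /mval subr_eq0 (negPf ab) min_l //.
    exact/hk/(map_f (fun b => v (a - b))).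
  move=> _; rewrite /ev => ->; congr (_ + _); rewrite !big_seq; apply: eq_bigr => b br.
  rewrite /mval min_l; last exact/hk/(map_f (fun b => v (a - b))).
  rewrite subr_eq0; case: eqP => // ab; move: fa.
  by rewrite ab /ev -[_ == 0]/(root _ _) -mem_roots_of // br.
have wvE f : f != 0 -> v (ev f a) = wv f.
  by move=> f0; apply: hasval_inj (val_f f f0) (hasval_E f0).
split; last by move=> f f0; rewrite -wv_ge0 -wvE //= vgeE ?tr.
split=> //; last first.
  by move=> [q [q0 qa]]; have := tr q q0; rewrite /ev (eqP qa) eqxx.
split=> //; apply: denominator_of_values => f fa; exists f; last first.
  by apply: wvE; apply: contraNneq fa => ->; rewrite ev0.
by apply: contraNneq fa => ->; rewrite ev0.
Qed.

Lemma limit_of_approximations : (forall N : nat, exists b, bge (xi - j b) N%:R) ->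
  exists a, forall N : nat, bge (xi - j a) N%:R.
Proof.
move=> /choice [b hb].
have bounds (N : rat) : exists n : nat, N <= n%:R.
  by have [n hn] := nat_upper_bound [:: N]; exists n; apply: hn; rewrite mem_head.
have [|l hl] := @cp_complete C b.
  move=> N; have [n0 hn0] := bounds N; exists n0 => m n m0 n0'.
  apply: j_bge; have -> : j (b m - b n) = (xi - j (b n)) - (xi - j (b m)).
    by rewrite rmorphB; ring.
  by apply: bgeB; apply: bge_le (hb _); apply: (le_trans hn0); rewrite ler_nat.
exists l => N; have [n0 hn0] := hl N%:R; set n := maxn n0 N.
have -> : xi - j l = (xi - j (b n)) + j (b n - l) by rewrite rmorphB; ring.
apply: bgeD; last by apply/bge_j/hn0/leq_maxl.
by apply: bge_le (hb n); rewrite ler_nat leq_maxr.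
Qed.

Definition closest a := forall b, B ((xi - j a) / (xi - j b)).

(** The distance from [xi] to [a] exceeds the precision [N], so moving [a] to an algebraic [y]
    within that precision loses no closeness. *)
Lemma closest_algebraic a N : closest a -> ~ bge (xi - j a) N ->
  exists2 y, algebraic_over_Q y & closest y.
Proof.
move=> ca nb; have [y [ay hy]] := cp_dense a N; exists y => // b.
have [c c0 vc] := rat_value C N.
have x0 := xi_sub_neq0 a.
have -> : (xi - j y) / (xi - j b) = ((xi - j y) / (xi - j a)) * ((xi - j a) / (xi - j b)).
  by rewrite mulrA divfK.
apply: BM => //.
have -> : (xi - j y) / (xi - j a) = 1 + j (a - y) / (xi - j a).
  by rewrite rmorphB; field.
apply: BD => //.
have -> : j (a - y) / (xi - j a) = (j (a - y) / j c) * (j c / (xi - j a)).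
  by rewrite mulrA divfK // j_neq0.
apply: BM; first by apply/(bgeP _ c0 vc)/bge_j.
by apply: maxB_B; apply: not_bge c0 vc nb.
Qed.

(* The value of X - a is read off any polynomial over Q vanishing at a. *)
Lemma closest_value a (q : {poly rat}) : closest a -> q != 0 -> root (emb q) a ->
  exists d, hasval (xi - j a) d.
Proof.
move=> ca q0 qa; set x := xi - j a; have x0 : x != 0 := xi_sub_neq0 a.
(* Each factor is comparable either to [x], and then counted by [m], or to the constant a - b. The
   factor of [a] itself makes [m] positive, so the value of [x] is recovered by an m-th root. *)
have prodE (s : seq K) : exists m c, [/\ c != 0, a \in s -> (0 < m)%N &
    usim (\prod_(b <- s) (xi - j b)) (x ^+ m * j c)].
  elim: s => [|b s [m [c [c0 hm hs]]]].
    by exists 0%N, 1; rewrite oner_neq0 big_nil rmorph1 mulr1 expr0; split=> //; apply: usim_refl; exact: oner_neq0.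
  rewrite big_cons; case: (B_or_maxB ((xi - j b) / x)) => hb.
    have hbx : usim (xi - j b) x by split; [exact: hb|exact: (ca b)].
    by exists m.+1, c; split=> //; rewrite exprS -mulrA; apply: usimM.
  rewrite invf_div in hb.
  have [ba|ba] := eqVneq b a.
    by move: hb; rewrite ba divff // => /not_maxB1.
  have ab0 : a - b != 0 by rewrite subr_eq0 eq_sym.
  exists m, (c * (a - b)); split; first by rewrite mulf_neq0.
    by rewrite inE eq_sym (negPf ba).
  rewrite mulrC rmorphM mulrA; apply: usimM => //.
  have y0 := xi_sub_neq0 b.
  have E1 : j (a - b) = (xi - j b) * (1 + - (x / (xi - j b))).
    by rewrite mulrDr mulr1 mulrN mulrCA divff // mulr1 /x rmorphB; ring.
  have [n0 h1] := one_maxB (maxBN hb).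
  split; rewrite E1; first by rewrite invfM mulrA divff // mul1r.
  by rewrite mulrAC divff // mul1r; apply: BB => //; apply: maxB_B.
have F0 := map_iQ_neq0 C q0.
have [m [c [c0 /(_ _) hm hs]]] := prodE (roots_of (emb q)).
have m0 : (0 < m)%N by apply: hm; rewrite mem_roots_of.
have := hasval_E q0; rewrite horner_map_roots => hE.
have lc0 : lead_coef (emb q) != 0 by rewrite lead_coef_eq0.
have xm0 : x ^+ m * j c != 0 by rewrite mulf_neq0 ?expf_neq0 ?j_neq0.
have hP := hasval_div hE (hasval_j lc0).
rewrite mulrC mulKf ?j_neq0 // in hP.
have hx := hasval_div (usim_hasval xm0 (usim_sym hs) hP) (hasval_j c0).
rewrite mulfK ?j_neq0 // in hx.
exists ((wv q - v (lead_coef (emb q)) - v c) / m%:R).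
by apply: (@hasval_root _ _ m) => //; apply: hasval_ext hx _; rewrite [RHS]mulrC divfK // pnatr_eq0 -lt0n.
Qed.

(** If v(a - b) is below [d], the constant a - b dominates; otherwise xi - b is a [B]-multiple of xi
    - a, and conversely because [a] is closest. *)
Lemma closest_hasval a d b : closest a -> hasval (xi - j a) d ->
  hasval (xi - j b) (mval (a - b) d).
Proof.
move=> ca hx; rewrite /mval subr_eq0; have [<- //|ab] := eqVneq a b.
have ab0 : a - b != 0 by rewrite subr_eq0.
have y0 := xi_sub_neq0 b.
have yE : xi - j b = j (a - b) + (xi - j a) by rewrite rmorphB; ring.
have [lt_d|le_d] := ltP (v (a - b)) d.
  rewrite yE; apply: hasvalD; first exact: hasval_j.
  by apply/(hasval_maxB (hasval_div hx (hasval_j ab0))); rewrite subr_gt0.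
apply: (usim_hasval y0 _ hx); split; last exact: (ca b).
have -> : (xi - j b) / (xi - j a) = 1 + j (a - b) / (xi - j a).
  by rewrite yE mulrDl divff ?xi_sub_neq0 // addrC.
apply: BD => //; apply/(hasval_B (hasval_div (hasval_j ab0) hx)).
by rewrite subr_ge0.
Qed.

(** As [b] is not closest, xi - a is strictly smaller than xi - b, so a - b equals xi - b up to a
    1-unit. *)
Lemma not_closest_hasval a b : closest a -> ~ closest b ->
  a != b /\ hasval (xi - j b) (v (a - b)).
Proof.
move=> ca ncb; have [c hc] : exists c, ~ B ((xi - j b) / (xi - j c)).
  by apply: contrapT => h; apply: ncb => c; apply: contrapT => hc; apply: h; exists c.
have hm : maxB ((xi - j a) / (xi - j b)).
  have -> : (xi - j a) / (xi - j b) = ((xi - j a) / (xi - j c)) * ((xi - j c) / (xi - j b)).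
    by rewrite mulrA divfK // xi_sub_neq0.
  apply: maxBM; first exact: (ca c).
  by case: (B_or_maxB ((xi - j b) / (xi - j c))) => //; rewrite invf_div.
have ab : a != b.
  by apply/eqP => ab; move: hm; rewrite ab divff ?xi_sub_neq0 // => /not_maxB1.
have ab0 : a - b != 0 by rewrite subr_eq0.
split=> //; have y0 := xi_sub_neq0 b.
have E1 : j (a - b) = (xi - j b) * (1 + - ((xi - j a) / (xi - j b))).
  by rewrite mulrDr mulr1 mulrN mulrCA divff // mulr1 rmorphB; ring.
have [n0 h1] := one_maxB (maxBN hm).
apply: (usim_hasval y0 _ (hasval_j ab0)).
split; rewrite E1; first by rewrite invfM mulrA divff // mul1r.
by rewrite mulrAC divff // mul1r; apply: BB => //; apply: maxB_B.
Qed.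

(* Choosing the closest algebraic a of least degree over Q, the polynomials of
   smaller degree take at a the values prescribed by w, which bounds the
   ramification. *)
Lemma realizes_ball a0 N : closest a0 -> ~ bge (xi - j a0) N ->
  exists a d, realizes a (Some d).
Proof.
move=> ca0 nb0; have [y0 [q1 [q10 q1y]] cy0] := closest_algebraic ca0 nb0.
have [|m [a [q [ca q0 qa sq]]] hmin] := @classical_min (fun m => exists a q,
    [/\ closest a, q != 0, root (emb q) a & size q = m]).
  by exists (size q1), y0, q1.
have [d hd] := closest_value ca q0 qa.
have val_b b := closest_hasval b ca hd.
have d0 : 0 <= d.
  apply/(hasval_B hd); have := BM (ca 0) B_xi.
  by have xi0 := xi_sub_neq0 0; rewrite rmorph0 subr0 in xi0 *; rewrite divfK.
have aO : vge v a 0.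
  apply: j_bge; have -> : j a = xi - (xi - j a) by ring.
  by apply: bgeB; [apply/bge_B/B_xi|apply/(hasval_bge _ hd)].
exists a, d; split; last first.
  move=> f f0; rewrite in_Zpad_gval // -wv_ge0.
  have F0 := map_iQ_neq0 C f0.
  have -> // : wv f = gval a d (emb f).
  apply: hasval_inj (hasval_E f0) _.
  exact: (@hasval_map_poly _ _ (fun b => mval (a - b) d) F0 (fun b _ => val_b b)).
split=> //; last by apply: algebraic_over_Q_alg_over_Qp; exists q.
split=> //; apply: denominator_of_values => f fa.
pose g := (f %% q)%R.
have gE : ev f a = ev g a.
  by rewrite {1}(divp_eq f q) evD evM /ev (eqP (qa : (emb q).[a] == 0)) mulr0 add0r.
have g0 : g != 0 by apply: contraNneq fa; rewrite gE => ->; rewrite ev0.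
exists g => //; rewrite gE; have F0 := map_iQ_neq0 C g0.
apply: (@hasval_inj (E g)); last exact: hasval_E.
have hroot b : b \in roots_of (emb g) -> a != b /\ hasval (xi - j b) (v (a - b)).
  rewrite mem_roots_of // => gb; apply: not_closest_hasval => // cb.
  have := hmin (size g) (ex_intro _ b (ex_intro _ g (And4 cb g0 gb erefl))).
  by rewrite -sq leqNgt ltn_modp q0.
apply: hasval_ext (@hasval_map_poly _ _ (fun b => v (a - b)) F0 (fun b hb => (hroot b hb).2)) _.
rewrite /ev horner_roots_of vM ?lead_coef_eq0 //; last first.
  by rewrite prodf_seq_neq0; apply/allP => b /hroot [ab _] /=; rewrite subr_eq0.
congr (_ + _); elim: (roots_of _) hroot => [|b s IH] hs; first by rewrite !big_nil v1.
rewrite !big_cons vM ?subr_eq0.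
- by rewrite IH // => b' bs; apply: hs; rewrite inE bs orbT.
- by have [] := hs b (mem_head _ _).
- rewrite prodf_seq_neq0; apply/allP => b' bs /=; rewrite subr_eq0.
  by have [] := hs b'; rewrite ?inE ?bs ?orbT.
Qed.

(** * 1-units, and the case where no constant is closest to [xi] *)

Let near1 x := maxB (x - 1).

Lemma near1_unit x : near1 x -> [/\ x != 0, B x & B x^-1].
Proof.
move=> h; have [n0 h1] := one_maxB h; rewrite addrC subrK in n0 h1.
by split=> //; rewrite -(subrK 1 x); apply: BD => //; apply: maxB_B.
Qed.

Lemma near1M x y : near1 x -> near1 y -> near1 (x * y).
Proof.
move=> hx hy; have [_ Bx _] := near1_unit hx; rewrite /near1.
have -> : x * y - 1 = x * (y - 1) + (x - 1) by ring.
by apply: maxBD => //; apply: maxBM.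
Qed.

Lemma near1V x : near1 x -> near1 x^-1.
Proof.
move=> hx; have [x0 _ Bx] := near1_unit hx.
have -> : x^-1 = 1 - (x - 1) * x^-1 by field.
by rewrite /near1 addrC addKr; apply/maxBN/maxBMr.
Qed.

Lemma near1_hasval x c : c != 0 -> near1 (x / j c) -> hasval x (v c).
Proof.
move=> c0 h; have [n0 h1 h2] := near1_unit h.
split; first by apply: contraNneq n0 => ->; rewrite mul0r.
by exists c; split=> //; split=> //; rewrite -invf_div.
Qed.

Section Unattained.
Hypothesis no_closest : forall a, ~ closest a.

Lemma closer a : exists b, maxB ((xi - j b) / (xi - j a)).
Proof.
have [b hb] : exists b, ~ B ((xi - j a) / (xi - j b)).
  by apply: contrapT => h; apply: (no_closest (a := a)) => b; apply: contrapT => hb; apply: h; exists b.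
by exists b; case: (B_or_maxB ((xi - j a) / (xi - j b))) => //; rewrite invf_div.
Qed.

Lemma closer_seq (l : seq K) :
  exists b, forall c, c \in l -> maxB ((xi - j b) / (xi - j c)).
Proof.
elim: l => [|g l [b hb]]; first by exists 0.
have [b' [h1 h2]] : exists b', B ((xi - j b') / (xi - j b)) /\ maxB ((xi - j b') / (xi - j g)).
  have [g' hg'] := closer g.
  case: (VB ((xi - j g') / (xi - j b))) => h; first by exists g'.
  exists b; split; first by rewrite divff ?xi_sub_neq0.
  have -> : (xi - j b) / (xi - j g) = ((xi - j b) / (xi - j g')) * ((xi - j g') / (xi - j g)).
    by rewrite mulrA divfK ?xi_sub_neq0.
  by apply: maxBM => //; rewrite -invf_div.
exists b' => h; rewrite inE => /orP [/eqP -> //|/hb hh].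
have -> : (xi - j b') / (xi - j h) = ((xi - j b') / (xi - j b)) * ((xi - j b) / (xi - j h)).
  by rewrite mulrA divfK ?xi_sub_neq0.
exact: maxBM.
Qed.

(** Choose [b] closer to [xi] than every root of [P]. Each xi - g is then b - g up to a 1-unit, and
    so P(xi) is P(b) up to a 1-unit. *)
Lemma immediate (P : {poly K}) : P != 0 ->
  exists2 c, c != 0 & near1 ((map_poly j P).[xi] / j c).
Proof.
move=> P0; have [b hb] := closer_seq (roots_of P).
have hg (g : K) : g \in roots_of P -> b - g != 0 /\ near1 ((xi - j g) / j (b - g)).
  move=> gP; have y0 := xi_sub_neq0 g; have hm := hb g gP.
  have h1 : near1 (j (b - g) / (xi - j g)).
    have -> : j (b - g) / (xi - j g) = 1 - (xi - j b) / (xi - j g).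
      by rewrite rmorphB; field.
    by rewrite /near1 addrC addKr; apply: maxBN.
  have [n0 _ _] := near1_unit h1; split.
    by apply: contraNneq n0 => ->; rewrite rmorph0 mul0r.
  by rewrite -invf_div; apply: near1V.
exists P.[b].
  rewrite horner_roots_of mulf_neq0 ?lead_coef_eq0 // prodf_seq_neq0.
  by apply/allP => g /hg [].
rewrite horner_map_roots horner_roots_of rmorphM -mulf_div.
rewrite divff ?j_neq0 ?lead_coef_eq0 // mul1r rmorph_prod.
elim: (roots_of P) hg => [|g s IH] hs.
  by rewrite !big_nil divr1 /near1 subrr; left.
rewrite !big_cons -mulf_div; apply: near1M.
  by have [] := hs g (mem_head _ _).
by apply: IH => g' gs; apply: hs; rewrite inE gs orbT.
Qed.

Lemma immediate_frac (P Q : {poly K}) : P != 0 -> Q != 0 ->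
  exists2 c, c != 0 & near1 ((map_poly j P).[xi] / (map_poly j Q).[xi] / j c).
Proof.
move=> /immediate [c c0 hc] /immediate [d d0 hd].
exists (c / d); first by rewrite mulf_neq0 ?invr_eq0.
have -> : (map_poly j P).[xi] / (map_poly j Q).[xi] / j (c / d) =
   ((map_poly j P).[xi] / j c) / ((map_poly j Q).[xi] / j d).
  by rewrite fmorph_div !invf_div !mulf_div [(map_poly j Q).[xi] * _]mulrC.
by apply: near1M => //; apply: near1V.
Qed.

(** The image of Q(X) in [F], on which values are discrete. *)
Definition ratl x := exists f g, g != 0 /\ x = E f / E g.

Lemma ratlB x y : ratl x -> ratl y -> ratl (x - y).
Proof.
move=> [f [g [g0 ->]]] [f' [g' [g'0 ->]]]; exists (f * g' - f' * g), (g * g').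
rewrite mulf_neq0 // E_sub !E_mul -mulNr addf_div ?E_neq0 //; split=> //.
by rewrite mulNr.
Qed.

Lemma ratlM x y : ratl x -> ratl y -> ratl (x * y).
Proof.
move=> [f [g [g0 ->]]] [f' [g' [g'0 ->]]]; exists (f * f'), (g * g').
by rewrite mulf_neq0 // !E_mul mulf_div.
Qed.

Lemma ratlV x : ratl x -> ratl x^-1.
Proof.
move=> [f [g [g0 ->]]]; have [->|f0] := eqVneq f 0.
  exists 0, 1; rewrite oner_neq0; split=> //.
  by rewrite !rmorph0 !horner0 !mul0r invr0.
by exists g, f; rewrite invf_div.
Qed.

Lemma ratl_E f : ratl (E f).
Proof. by exists f, 1; rewrite oner_neq0 E_1 divr1. Qed.

Lemma ratlX x n : ratl x -> ratl (x ^+ n).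
Proof.
move=> h; elim: n => [|n IH]; last by rewrite exprS; apply: ratlM.
by rewrite expr0 -E_1; apply: ratl_E.
Qed.

Lemma ratl_p k : ratl (j (p%:R ^+ k)).
Proof. by rewrite -iQ_pX -E_C; apply: ratl_E. Qed.

Lemma ratl_val x : ratl x -> x != 0 -> exists z : int, hasval x (z%:~R / e%:R).
Proof.
move=> [f [g [g0 ->]]] x0; have f0 : f != 0.
  by apply: contraNneq x0 => ->; rewrite !rmorph0 horner0 mul0r.
exists (w f - w g); rewrite intrB mulrBl.
by apply: hasval_div; apply: hasval_E.
Qed.

(** [w] need not map onto Z, so e = w(p) may be a proper multiple of the ramification index [e1].
    Division with remainder by the [n] for which n/e is the least positive value gives e = e1 n. *)
Lemma ratl_uniformizer : exists (pi : F) (e1 : nat),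
  [/\ ratl pi, (0 < e1)%N, hasval pi e1%:R^-1 &
      forall x, ratl x -> x != 0 -> exists z : int, hasval x (z%:~R / e1%:R)].
Proof.
have p0 := j_neq0 (p_neq0 C).
have hp : hasval (j p%:R) 1 by rewrite -(v_p C); apply/hasval_j/p_neq0.
have Lp : ratl (j p%:R) by have := ratl_p 1; rewrite expr1.
have [|n [n0 [pi [Lpi hpi]]] hmin] := @classical_min (fun n => (0 < n)%N /\
    exists x, ratl x /\ hasval x (n%:R / e%:R)).
  by exists e; split=> //; exists (j p%:R); rewrite divff.
have nQ0 : (n%:R : rat) != 0 by rewrite pnatr_eq0 -lt0n.
have key x (z : int) : ratl x -> hasval x (z%:~R / e%:R) -> exists k : int, z = k * n%:Z.
  move=> Lx hx; exists (z %/ n)%Z.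
  set r := (z %% n)%Z; have zE : z = (z %/ n)%Z * n + r := divz_eq z n.
  suff : r = 0 by move=> r0; rewrite {1}zE r0 addr0.
  have r0 : 0 <= r by rewrite modz_ge0 // eqz_nat -lt0n.
  have rn : r < n%:Z by rewrite ltz_pmod.
  apply/eqP; apply: contraT => rneq.
  have hpk (k : int) : exists y, ratl y /\ hasval y (k%:~R * (n%:R / e%:R)).
    case: k => k; first by exists (pi ^+ k); split; [exact: ratlX|exact: hasvalX].
    exists (pi ^+ k.+1)^-1; split; first exact/ratlV/ratlX.
    by rewrite NegzE mulrNz mulNr; apply/hasvalV/hasvalX.
  have [y [Ly hy]] := hpk (- (z %/ n)%Z).
  have : (n <= `|r|)%N; last by rewrite -lez_nat gez0_abs // leNgt rn.
  apply: hmin; split; first by rewrite absz_gt0.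
  exists (x * y); split; first exact: ratlM.
  have rE : (`|r|%:R : rat) = r%:~R by rewrite pmulrn gez0_abs.
  have zQ : (z%:~R : rat) = (z %/ n)%Z%:~R * n%:R + r%:~R by rewrite {1}zE intrD intrM.
  apply: hasval_ext (hasvalM hx hy) _; rewrite rE zQ intrN; field.
  exact: eQ_neq0.
have [e1 e1E] : exists e1 : nat, e = (e1 * n)%N.
  have [|k kE] := key (j p%:R) e%:Z Lp; first by rewrite -pmulrn divff.
  exists `|k|%N; have : 0 <= k.
    by rewrite -(pmulr_lge0 _ (x := n%:Z)) // -kE.
  by move: kE; case: k => // k kE _; apply/eqP; rewrite -eqz_nat kE.
have e10 : (0 < e1)%N by have := e_gt0; rewrite e1E muln_gt0 => /andP [].
have e1Q : (e1%:R : rat) != 0 by rewrite pnatr_eq0 -lt0n.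
exists pi, e1; split=> //.
  by apply: hasval_ext hpi _; rewrite e1E natrM; field; rewrite e1Q nQ0.
move=> x Lx x0; have [z hz] := ratl_val Lx x0; have [k kE] := key x z Lx hz.
exists k; apply: hasval_ext hz _; rewrite kE e1E natrM intrM -pmulrn.
by field; rewrite e1Q nQ0.
Qed.

(** x^p - y^p is x - y times a sum congruent to p y^(p-1) modulo x - y; both p and the correction
    have value at least [s]. *)
Lemma bge_expr_p x y r s : B x -> B y -> s <= 1 -> s <= r -> bge (x - y) r ->
  bge (x ^+ p - y ^+ p) (r + s).
Proof.
move=> Bx By s1 sr h; rewrite subrXX; apply: bgeM => //.
have hX m : bge (x ^+ m - y ^+ m) r.
  rewrite subrXX; apply: bgeMr0 => //; apply: spred_sum => // i _.
  by apply: BM; apply: BX.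
have -> : \sum_(i < p) x ^+ (p.-1 - i) * y ^+ i =
   \sum_(i < p) (x ^+ (p.-1 - i) - y ^+ (p.-1 - i)) * y ^+ i + j p%:R * y ^+ p.-1.
  have -> : j p%:R * y ^+ p.-1 = \sum_(i < p) y ^+ (p.-1 - i) * y ^+ i.
    transitivity (\sum_(i < p) y ^+ p.-1).
      by rewrite rmorph_nat mulr_natl sumr_const card_ord.
    apply: eq_bigr => i _; rewrite -exprD subnK //.
    by rewrite -ltnS prednK ?p_gt0.
  by rewrite -big_split; apply: eq_bigr => i _ /=; ring.
apply: bgeD.
  apply: bge_sum => i _; apply: bgeMr0; last exact: BX.
  exact: bge_le (hX _).
apply: bgeMr0; last exact: BX.
by apply: bge_j; right; rewrite v_p.
Qed.

Lemma bge_expr_pX x y s k : B x -> B y -> 0 < s -> s <= 1 -> bge (x - y) s ->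
  bge (x ^+ (p ^ k) - y ^+ (p ^ k)) (k.+1%:R * s).
Proof.
move=> Bx By s0 s1 h; elim: k => [|k IH]; first by rewrite expn0 !expr1 mul1r.
rewrite expnSr !exprM -natr1 mulrDl mul1r; apply: bge_expr_p => //; try exact: BX.
by rewrite -[leLHS]mul1r ler_pM2r // ler1n.
Qed.

(** Immediacy gives a constant with the residue of [u]. Raising both to the power p^(k m) keeps this
    residue, by the Frobenius relation, keeps [t] in Q(X), and brings the two together at a rate
    linear in [m]. *)
Lemma teichmuller u N : ratl u -> hasval u 0 -> exists t c,
  [/\ ratl t, vge v c 0, maxB (u - t) & bge (t - j c) N].
Proof.
move=> Lu hu; have [f [g [g0 uE]]] := Lu.
have u0 := hasval_neq0 hu; have Bu : B u by apply/(hasval_B hu).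
have f0 : f != 0 by apply: contraNneq u0 => f0; rewrite uE f0 !rmorph0 horner0 mul0r.
have F0 := map_iQ_neq0 C f0; have G0 := map_iQ_neq0 C g0.
have [c c0] := immediate_frac F0 G0; rewrite -uE => hc.
have vc : v c = 0 by apply: hasval_inj (near1_hasval c0 hc) hu.
have cO : vge v c 0 by right; rewrite vc.
have Bc : B (j c) by apply: BO.
have my : maxB (u - j c).
  have -> : u - j c = j c * (u / j c - 1).
    by rewrite mulrBr mulr1 mulrCA divff ?mulr1 // j_neq0.
  exact: maxBM.
(* An element of the maximal ideal of a ring of higher rank need not have a rational value;
   immediacy applied to the numerator of u - c provides one. The cap at 1, the value of p, is what
   [bge_expr_pX] requires. *)
have [s [s0 s1 hs]] : exists s, [/\ 0 < s, s <= 1 & bge (u - j c) s].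
  have [->|y0] := eqVneq (u - j c) 0; first by exists 1; split=> //; apply: bge0.
  have yE : u - j c = (map_poly j (emb f - c *: emb g)).[xi] / E g.
    rewrite rmorphB /= map_polyZ hornerD hornerN hornerZ uE mulrBl mulfK //.
    exact: E_neq0.
  have P0 : emb f - c *: emb g != 0.
    by apply: contraNneq y0; rewrite yE => ->; rewrite rmorph0 horner0 mul0r.
  have [d d0] := immediate_frac P0 G0; rewrite -yE => /(near1_hasval d0) hd.
  have vd := (hasval_maxB hd).1 my.
  exists (Num.min (v d) 1); rewrite lt_min vd ge_min lexx orbT; split=> //.
  by apply/(hasval_bge _ hd); rewrite ge_min lexx.
have [k k0 hk] := frobenius_fix cO.
have [m /(_ _ (mem_head _ _)) hm] := nat_upper_bound [:: N / s].
have q0 : (0 < p ^ k)%N by rewrite expn_gt0 p_gt0.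
have hkm := frobenius_iter m q0 cO hk; rewrite -expnM in hkm.
have ht := bge_expr_pX (k * m) Bu Bc s0 s1 hs.
exists (u ^+ (p ^ (k * m))), (c ^+ (p ^ (k * m))); split.
- exact: ratlX.
- exact: vgeX0.
- set q := (p ^ (k * m))%N in hkm ht *.
  have -> : u - u ^+ q = (u - j c) - j (c ^+ q - c) - (u ^+ q - j c ^+ q).
    by rewrite rmorphB rmorphXn; ring.
  apply: maxBB; last by apply: bge_maxB ht; rewrite mulr_gt0 ?ltr0n.
  apply: maxBB => //; have [r r0 hr] := vgt_ge hkm.
  by apply: (bge_maxB r0); apply: bge_j.
- rewrite rmorphXn; apply: bge_le ht; rewrite -ler_pdivrMr //; apply: (le_trans hm).
  by rewrite ler_nat ltnW // ltnS leq_pmull.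
Qed.

Section Expansion.
Variables (pi : F) (e1 : nat).
Hypothesis Lpi : ratl pi.
Hypothesis e1_gt0 : (0 < e1)%N.
Hypothesis hpi : hasval pi e1%:R^-1.
Hypothesis disc : forall x, ratl x -> x != 0 -> exists z : int, hasval x (z%:~R / e1%:R).

Let e1Q : (e1%:R : rat) != 0. Proof. by rewrite pnatr_eq0 -lt0n. Qed.
Let e1Q0 : 0 < (e1%:R : rat). Proof. by rewrite ltr0n. Qed.

(** An element of value n/e1 whose p-part is a constant: only the powers of [pi] below [e1] then
    occur, with coefficients in K. *)
Let bn n := j (p%:R ^+ (n %/ e1)) * pi ^+ (n %% e1).

Let bn_val n : hasval (bn n) (n%:R / e1%:R).
Proof.
apply: hasval_ext (hasvalM (hasval_j (pX_neq0 C _)) (hasvalX _ hpi)) _.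
by rewrite v_pX [in RHS](divn_eq n e1) natrD natrM mulrDl mulfK.
Qed.

Let bn_ratl n : ratl (bn n).
Proof. by apply: ratlM; [exact: ratl_p|exact: ratlX]. Qed.

Let B_pi : B pi. Proof. by apply/(hasval_B hpi); rewrite invr_ge0 ltW. Qed.

(** Discreteness enters here: a positive value on Q(X) is at least 1/e1. *)
Let bn_step x n : ratl x -> maxB x -> B (x * bn n / bn n.+1).
Proof.
move=> Lx mx; have [->|x0] := eqVneq x 0; first by rewrite !mul0r.
have [z hz] := disc Lx x0; have := (hasval_maxB hz).1 mx.
rewrite pmulr_lgt0 ?invr_gt0 // ltr0z => z0.
apply/(hasval_B (hasval_div (hasvalM hz (bn_val n)) (bn_val n.+1))).
rewrite -mulrDl -mulrBl pmulr_lge0 ?invr_gt0 // -natr1.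
have : 1 <= z%:~R :> rat by rewrite ler1z.
lra.
Qed.

(** Each step subtracts from the remainder [y] a digit [t] times [bn n]. This keeps [y] in Q(X),
    where discreteness raises its level from n to n + 1; the constant near [t] is what [c] records,
    at the cost of an error of value at least [N]. *)
Lemma expansion n x N : ratl x -> B x -> exists (c : 'I_e1 -> K) y,
  [/\ forall i, vge v (c i) 0, ratl y, B (y / bn n) &
      bge (x - y - \sum_i j (c i) * pi ^+ i) N].
Proof.
move=> Lx Bx; elim: n => [|n [c [y [cO Ly By hy]]]].
  exists (fun _ => 0), x; split=> //; first by left.
    by rewrite /bn div0n mod0n !expr0 rmorph1 mulr1 divr1.
  rewrite subrr sub0r; apply: bgeN; apply: bge_sum => i _.
  by rewrite rmorph0 mul0r; apply: bge0.
have b0 := hasval_neq0 (bn_val n).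
set u := y / bn n in By; have yE : y = u * bn n by rewrite divfK.
have Lu : ratl u by apply: ratlM => //; apply: ratlV.
case: (EM (maxB u)) => [mu|nmu].
  by exists c, y; split=> //; rewrite yE; apply: bn_step.
have u0 : u != 0 by apply/eqP => u0; apply: nmu; left.
have [z hz] := disc Lu u0.
have hu : hasval u 0.
  apply: (hasval_ext hz); apply/eqP; rewrite eq_le; apply/andP; split.
    by rewrite leNgt; apply/negP => h; apply: nmu; apply/(hasval_maxB hz).
  exact/(hasval_B hz).
have [t [d [Lt dO mt ht]]] := teichmuller N Lu hu.
pose i0 : 'I_e1 := Ordinal (ltn_pmod n e1_gt0).
exists (fun i => c i + (if i == i0 then d * p%:R ^+ (n %/ e1) else 0)), ((u - t) * bn n).
split.
- move=> i; apply: vD => //; case: ifP => _; last by left.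
  by apply: vgeM0 => //; apply/vgeX0/vge_nat.
- by apply: ratlM => //; apply: ratlB.
- by apply: bn_step => //; apply: ratlB.
have -> : \sum_i j (c i + (if i == i0 then d * p%:R ^+ (n %/ e1) else 0)) * pi ^+ i =
    \sum_i j (c i) * pi ^+ i + j d * bn n.
  under eq_bigr => i _ do rewrite rmorphD mulrDl.
  rewrite big_split /=; congr (_ + _).
  rewrite (bigD1 i0) //= eqxx big1 ?addr0; first by rewrite rmorphM mulrA.
  by move=> i /negPf ->; rewrite rmorph0 mul0r.
have -> : x - (u - t) * bn n - (\sum_i j (c i) * pi ^+ i + j d * bn n) =
   (x - y - \sum_i j (c i) * pi ^+ i) + (t - j d) * bn n by rewrite {1}yE; ring.
apply: bgeD => //; apply: bgeMr0 => //.
by apply/(hasval_B (bn_val n)); rewrite divr_ge0.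
Qed.

Lemma approximate_root (G : {poly K}) x (N : rat) : G \is monic -> (1 < size G)%N ->
  bge (map_poly j G).[x] ((size G).-1%:R * N) -> exists b, bge (x - j b) N.
Proof.
move=> Gm szG; have szr : size G = (size (roots_of G)).+1.
  by rewrite {1}(roots_ofE G) (monicP Gm) scale1r size_prod_XsubC.
rewrite horner_map_roots (monicP Gm) rmorph1 mul1r szr /= => h.
apply: contrapT => hno; have [c c0 vc] := rat_value C N.
have H (s : seq K) : (0 < size s)%N ->
    maxB (j (c ^+ size s) / \prod_(b <- s) (x - j b)).
  have one b : maxB (j c / (x - j b)).
    by apply: not_bge c0 vc _ => hb; apply: hno; exists b.
  elim: s => // g s IH _; rewrite big_cons /= exprS rmorphM -mulf_div.
  case: s IH => [|g' s] IH; last by apply: maxBM; [apply: maxB_B|apply: IH].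
  by rewrite big_nil expr0 rmorph1 divr1 mulr1.
have sz0 : (0 < size (roots_of G))%N by rewrite -ltnS -szr.
have := H _ sz0; set P := \prod_(b <- _) _ in h *; set m := size _ in h *.
have cm0 : c ^+ m != 0 by rewrite expf_neq0.
have vcm : v (c ^+ m) = m%:R * N by rewrite vX // vc.
move/(bgeP _ cm0 vcm): h => h1 h2.
have := maxBM h1 h2; rewrite mulrA divfK ?j_neq0 //.
have [P0|P0] := eqVneq P 0; last by rewrite divff // => /not_maxB1.
move: P0 => /eqP; rewrite prodf_seq_eq0 => /hasP [g _ /= /eqP xg] _.
by apply: hno; exists g; rewrite xg; apply: bge0.
Qed.

(** Expanding pi^e1 in lower powers of [pi] gives a monic polynomial of degree [e1] over O_K that
    almost vanishes at [pi], so [pi] is close to a root [g] of it. Replacing [pi] by [g] in the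
    expansion of [xi] leaves a constant. *)
Lemma approximate_xi (N : nat) : exists b, bge (xi - j b) N%:R.
Proof.
have bge_y n y : B (y / bn n) -> bge y (n%:R / e1%:R).
  move=> h; rewrite -(divfK (hasval_neq0 (bn_val n)) y); apply: bgeM0 => //.
  exact/(hasval_bge _ (bn_val n)).
(* Approximating a root to [N] in degree [e1] requires the value [e1 * N], that is the level
   [e1 * e1 * N], since level n means value n/e1. *)
have [c [y [cO Ly By hy]]] := @expansion (e1 * e1 * N)%N (pi ^+ e1) (e1%:R * N%:R)
   (ratlX e1 Lpi) (BX e1 B_pi).
pose S : {poly K} := \sum_(i < e1) c i *: 'X^i.
have szS : (size S <= e1)%N.
  apply: (leq_trans (size_sum _ _ _)); apply/bigmax_leqP => i _.
  by apply: (leq_trans (size_scale_leq _ _)); rewrite size_polyXn.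
have szG : size ('X^e1 - S) = e1.+1.
  by rewrite size_polyDl ?size_polyXn // size_polyN ltnS.
have SE x : (map_poly j S).[x] = \sum_i j (c i) * x ^+ i.
  rewrite rmorph_sum horner_sum; apply: eq_bigr => i _ /=.
  by rewrite map_polyZ map_polyXn hornerZ hornerXn.
have [|||g hg] := @approximate_root ('X^e1 - S) pi N%:R.
- by rewrite monicE lead_coefDl ?lead_coefXn // size_polyXn size_polyN ltnS.
- by rewrite szG ltnS.
- rewrite szG /= rmorphB /= map_polyXn hornerD hornerN hornerXn SE.
  have -> : pi ^+ e1 - \sum_i j (c i) * pi ^+ i =
     (pi ^+ e1 - y - \sum_i j (c i) * pi ^+ i) + y by ring.
  apply: bgeD => //; have := bge_y _ _ By; congr bge.
  by rewrite -mulnA [(e1 * _)%N]mulnC !natrM mulfK // mulrC.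
have Bg : B (j g).
  have -> : j g = pi - (pi - j g) by ring.
  by apply: BB => //; apply/bge_B; apply: bge_le hg; rewrite ler0n.
have [|c' [y' [c'O Ly' By' hy']]] := @expansion (e1 * N)%N xi N%:R _ B_xi.
  by rewrite -E_var; apply: ratl_E.
exists (\sum_i c' i * g ^+ i).
have -> : xi - j (\sum_i c' i * g ^+ i) = (xi - y' - \sum_i j (c' i) * pi ^+ i) + y'
    + \sum_i j (c' i) * (pi ^+ i - j g ^+ i).
  under [X in _ = _ + X]eq_bigr => i _ do rewrite mulrBr.
  rewrite sumrB rmorph_sum; under [X in _ - X = _]eq_bigr => i _ do rewrite rmorphM rmorphXn.
  by rewrite /=; ring.
apply: bgeD.
  apply: bgeD => //; have := bge_y _ _ By'; congr bge.
  by rewrite mulnC natrM mulfK.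
apply: bge_sum => i _; apply: bgeM0; first exact: BO.
rewrite subrXX; apply: bgeMr0 => //; apply: spred_sum => // k _.
by apply: BM; apply: BX.
Qed.

End Expansion.
End Unattained.

Theorem realizes_exists : exists a D, realizes a D.
Proof.
case: (EM (exists a, forall N : nat, bge (xi - j a) N%:R)) => [[a ha]|hno].
  by exists a, None; apply: realizes_point.
(* If every precision were reached, completeness would provide a constant infinitely close to [xi];
   so one bound [N] serves all constants. *)
have [N hN] : exists N : nat, forall b, ~ bge (xi - j b) N%:R.
  apply: contrapT => h; apply: hno; apply: limit_of_approximations => N.
  by apply: contrapT => h'; apply: h; exists N => b hb; apply: h'; exists b.
case: (EM (exists a, closest a)) => [[a ca]|nc].
  by have [a' [d hd]] := realizes_ball ca (hN a); exists a', (Some d).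
have no a : ~ closest a by move=> ca; apply: nc; exists a.
have [pi [e1 [Lpi e10 hpi disc]]] := ratl_uniformizer.
by have [b /hN] := approximate_xi no Lpi e10 hpi disc N.
Qed.

End ValuationRing.

(** * The main theorem *)

Lemma eval_at_image (K F : fieldType) (i : {rmorphism {poly K} -> F}) (P : {poly K}) :
  (map_poly (i \o polyC) P).[i 'X] = i P.
Proof.
elim/poly_ind: P => [|P c IH]; first by rewrite !rmorph0 horner0.
rewrite rmorphD [in RHS]rmorphD !rmorphM /= map_polyX map_polyC /=.
by rewrite hornerD hornerMX hornerC IH.
Qed.

Lemma dvaluation_realized (C : CpField) (W : {fraction {poly rat}} -> int) :
  is_dvaluation W ->
  (forall q, q != 0 -> vge (cp_val C) (iQ C q) 0 -> 0 <= W (toF q%:P)) ->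
  0 < W (toF ((cp_prime C)%:R)%:P) -> 0 <= W (toF 'X) ->
  exists a D, valid_pair (cp_val C) a D /\
    forall f, f != 0 -> in_Zpad (cp_val C) a D f <-> 0 <= W (toF f).
Proof.
move=> [WM WD] WZ Wp WX; pose w f := W (toF f).
have t0 f : f != 0 -> toF f != 0 by rewrite /toF tofrac_eq0.
have wM f g : f != 0 -> g != 0 -> w (f * g) = w f + w g.
  by move=> f0 g0; rewrite /w /toF tofracM; exact: WM (t0 _ f0) (t0 _ g0).
have wD f g : f != 0 -> g != 0 -> f + g != 0 -> Num.min (w f) (w g) <= w (f + g).
  move=> f0 g0 fg0; have := t0 _ fg0; rewrite /w /toF tofracD => fg0'.
  exact: WD (t0 _ f0) (t0 _ g0) fg0'.
have [B [sB VB BO nB hw]] := valuation_extension wM wD WZ Wp.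
pose i : {rmorphism {poly C} -> {fraction {poly C}}} := @FracField.tofrac {poly C}.
apply: (@realizes_exists C {fraction {poly C}} (i \o polyC) B sB VB BO nB (i 'X) _ w wM Wp WX).
  by move=> P P0; rewrite eval_at_image /i /= tofrac_eq0.
by move=> f g f0 g0 wfg; rewrite !eval_at_image; apply: hw.
Qed.

Lemma enumerate_In (I : Type) (P : pred I) (s : seq I) : exists n (g : 'I_n -> I),
  (forall k, P (g k)) /\ (forall i, List.In i s -> P i -> exists k, g k = i).
Proof.
elim: s => [|x s [n [g [Pg hg]]]].
  by exists 0%N, (fun k : 'I_0 => False_rect I (notF (ltn_ord k))); split=> // -[].
have [Px|nPx] := boolP (P x); last first.
  exists n, g; split=> // i [<- Pi|]; [by rewrite Pi in nPx|exact: hg].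
exists n.+1, (fun k => if unlift ord0 k is Some k' then g k' else x); split.
  by move=> k; case: unliftP => [k' _|_].
move=> i [<- _|si Pi]; first by exists ord0; rewrite unlift_none.
by have [k <-] := hg i si Pi; exists (lift ord0 k); rewrite liftK.
Qed.

Section MainTheorem.
Variable C : CpField.
Local Notation K := (cp_field C).
Local Notation v := (cp_val C).
Local Notation p := (cp_prime C).
Variable R : {poly rat} -> Prop.
Hypothesis R_Zp : contains_ZpX p R.
Hypothesis R_Krull : Krull_domain R.

Lemma contains_integral (f : {poly rat}) : (forall i, vge v (iQ C f`_i) 0) -> R f.
Proof. by move=> h; apply: R_Zp => i; apply/denq_vge. Qed.

Lemma contains_scalar q : vge v (iQ C q) 0 -> R q%:P.
Proof.
move=> hq; apply: contains_integral => i; rewrite coefC; case: eqP => // _.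
by rewrite rmorph0; left.
Qed.

Lemma Krull_representation : exists (n : nat) (a : 'I_n -> K) (D : 'I_n -> option rat),
  (forall i, valid_pair v (a i) (D i)) /\ represents v R a D.
Proof.
have [I [w [hw hR fin]]] := R_Krull.
have toF0 f : f != 0 -> toF f != 0 by rewrite /toF tofrac_eq0.
have RP f : R f <-> forall i, f != 0 -> 0 <= w i (toF f).
  split=> [Rf i f0|h].
    by have [H _] := hR (toF f); apply: H (toF0 f f0); exists f.
  have [_ H] := hR (toF f); have [i|g [Rg /eqP]] := H.
    by rewrite /toF tofrac_eq0; apply: h.
  by rewrite /toF tofrac_eq => /eqP ->.
have p0 : ((p%:R)%:P : {poly rat}) != 0 by rewrite polyC_eq0 pQ_neq0.
have [s hs] := fin _ (toF0 _ p0).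
have [n [g [Pg hg]]] := enumerate_In (fun i => w i (toF (p%:R)%:P) != 0) s.
have wp_ge0 i : 0 <= w i (toF (p%:R)%:P).
  by apply: (RP _).1 p0; apply: contains_scalar; rewrite rmorph_nat; apply: vge_nat.
have real k : exists aD : K * option rat, valid_pair v aD.1 aD.2 /\
    forall f, f != 0 -> in_Zpad v aD.1 aD.2 f <-> 0 <= w (g k) (toF f).
  have [|||a [D h]] := @dvaluation_realized C (w (g k)) (hw _); last by exists (a, D).
  - move=> q q0 hq; apply: (RP _).1; last by rewrite polyC_eq0.
    exact: contains_scalar.
  - by rewrite lt_def Pg wp_ge0.
  - apply: (RP _).1; last by rewrite polyX_eq0.
    apply: contains_integral => i; rewrite coefX; case: eqP => _ /=.
      by rewrite rmorph1; apply: vge1.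
    by rewrite rmorph0; left.
have /choice [aD haD] := real.
exists n, (fun k => (aD k).1), (fun k => (aD k).2); split=> [k|f].
  by have [] := haD k.
have [->|f0] := eqVneq f 0.
  split=> _; last by apply/RP => i; rewrite eqxx.
  by move=> k; apply/in_Zpad_cball => x _; rewrite -/(ev 0 x) ev0; left.
split=> [/RP Rf k|h]; first by apply/(haD k).2 => //; apply: Rf.
(* A valuation with value 0 at p imposes nothing on Q[X]: some p^m f has coefficients in Z_(p),
   hence lies in [R], and the factor p^m does not change the value. *)
apply/RP => i _; have [wi|wi] := eqVneq (w i (toF (p%:R)%:P)) 0; last first.
  by have [k <-] := hg i (hs i wi) wi; apply/(haD k).2.
have [m hm] := clear_denominators C f.
have pm0 : (p%:R ^+ m : rat) != 0 by rewrite pQX_neq0.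
have : 0 <= w i (toF (p%:R ^+ m *: f)).
  by apply: (RP _).1; [exact: contains_integral|rewrite scaler_eq0 negb_or pm0].
have [wM _] := hw i.
elim: {hm} m {pm0} => [|m IH]; first by rewrite expr0 scale1r.
have pm0 : p%:R ^+ m *: f != 0 by rewrite scaler_eq0 negb_or pQX_neq0.
have -> : p%:R ^+ m.+1 *: f = (p%:R)%:P * (p%:R ^+ m *: f).
  by rewrite mul_polyC scalerA -exprS.
by rewrite /toF tofracM wM ?toF0 // wi add0r.
Qed.

Section Irredundant.
Variables (n : nat) (a : 'I_n -> K) (D : 'I_n -> option rat).
Hypothesis valid : forall i, valid_pair v (a i) (D i).
Hypothesis repr : represents v R a D.

Lemma represents_ev f : R f <-> forall x, Eset v a D x -> vge v (ev f x) 0.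
Proof. exact: (represents_IntQ R a D).1 repr f. Qed.

Lemma Eset_integral x : Eset v a D x -> vge v x 0.
Proof.
move=> [i]; have [[aO _]] := valid i; case: (D i) => [d|] /= d0 _; last by move->.
by move=> xa; rewrite -(subrK (a i) x); apply: vD => //; apply: vge_le xa.
Qed.

Lemma points_Dedekind : (forall i, D i = None) -> Dedekind_domain R.
Proof.
move=> DN.
have RE f : R f <-> forall i, vge v (ev f (a i)) 0.
  by rewrite repr; split=> h i; have := h i; rewrite DN.
have aO i : vge v (a i) 0 by have [[]] := valid i.
have tr i f : f != 0 -> ev f (a i) != 0.
  move=> f0; have [_ _] := valid i; rewrite DN => na; apply/negP => fa.
  by apply: na; exists f.
have hval i : exists e, (0 < e)%N /\ value_denominator e (a i).
  by have [[_ /finite_ramification_ev [e e0 he]] _ _] := valid i; exists e.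
have /choice [e he] := hval.
have e0 : (0 < \prod_i e i)%N by apply: prodn_gt0 => i; have [] := he i.
have disc i : value_denominator (\prod_i e i) (a i).
  move=> f fa; have [_ /(_ f fa) [z hz]] := he i.
  exists (z * (\prod_(k | k != i) e k)%:Z).
  by rewrite (bigD1 i) //= natrM mulrAC hz intrM -pmulrn.
split.
- exact: (points_noetherian RE aO tr e0 disc).
- exact: Krull_integrally_closed.
- by move=> P hP hP0; apply: (primes_maximal RE aO tr hP hP0).
Qed.

Hypothesis irr : irredundant v a D.

Lemma Dedekind_points : Dedekind_domain R <-> forall i, D i = None.
Proof.
split=> [ded i|]; last exact: points_Dedekind.
case Di: (D i) => [d|] //; exfalso.
have [f0 [good bad]] := irr i; rewrite Di in bad.
apply: (@not_Dedekind C R (Eset v a D) represents_ev Eset_integral (a i) d _ f0 bad _ ded).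
  by move=> x xa; exists i; rewrite Di.
move=> x [k xk]; have [ki|ki] := eqVneq k i.
  by left; move: xk; rewrite ki Di.
by right; have /in_Zpad_cball := good k ki; apply.
Qed.

(** A generic point of a ball of finite radius avoids any prescribed finite list. *)
Lemma finite_Eset : finite_set (Eset v a D) <-> forall i, D i = None.
Proof.
split=> [[s hs] i|DN].
  case Di: (D i) => [d|] //; exfalso.
  have [x xa xs] := generic_point (a i) d s.
  have /xs [/eqP] : x \in s by apply: hs; exists i; rewrite Di.
  exact.
exists [seq a i | i : 'I_n] => x [i]; rewrite DN => ->.
by apply: map_f; rewrite mem_enum.
Qed.

End Irredundant.
End MainTheorem.

Theorem mainTheorem10 (p : nat) (K : closedFieldType) (v : K -> rat)
  (R : {poly rat} -> Prop) :
  prime p -> is_Cp p v ->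
  is_subring R -> contains_ZpX p R -> Krull_domain R ->
  (exists (n : nat) (a : 'I_n -> K) (d : 'I_n -> option rat),
     [/\ (forall i, valid_pair v (a i) (d i)),
         represents v R a d
       & (forall f, R f <-> in_IntQ v (Eset v a d) f)]) /\
  (forall (n : nat) (a : 'I_n -> K) (d : 'I_n -> option rat),
     (forall i, valid_pair v (a i) (d i)) ->
     represents v R a d -> irredundant v a d ->
     (Dedekind_domain R <-> (n = 0%N \/ forall i, d i = None)) /\
     (Dedekind_domain R <-> finite_set (Eset v a d))).
Proof.
move=> p_pr hCp _ R_Zp R_Krull; have [_ [hM hD _ _ _]] := hCp.
pose C := @MkCpField p K (Valuation hM hD) p_pr hCp.
split.
  have [n [a [d [valid repr]]]] := @Krull_representation C R R_Zp R_Krull.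
  by exists n, a, d; split=> //; apply: (@represents_IntQ C R n a d).1.
move=> n a d valid repr irr.
have ded := @Dedekind_points C R R_Krull n a d valid repr irr.
split; last by rewrite ded -(@finite_Eset C n a d).
rewrite ded; split=> [|[n0|//]]; first by right.
by move=> i; case: (notF _); have := ltn_ord i; rewrite [X in (_ < X)%N]n0.
Qed.
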